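(* Let $\Delta(x,\hat x)=(x-\hat x)^2$, $\mu_X,\mu_{\hat X}\in\mathbb R$, $\sigma_X,\sigma_{\hat X}>0$, and $R,R_c\ge0$. Then $$D\big(R,R_c\,\big|\,\mathcal N(\mu_X,\sigma_X^2),\mathcal N(\mu_{\hat X},\sigma_{\hat X}^2)\big)=(\mu_X-\mu_{\hat X})^2+\sigma_X^2+\sigma_{\hat X}^2-2\sigma_X\sigma_{\hat X}\,\xi(R,R_c),$$ where $\xi(R,R_c):=\sqrt{(1-e^{-2R})(1-e^{-2(R+R_c)})}$.
   Context: All logarithms are natural. $D(R,R_c|p_X,p_{\hat X})$ is the output-constrained distortion-rate function: for a block length $n\ge1$, a code consists of finite sets $\mathcal J,\mathcal K$, a random seed $K$ uniform on $\mathcal K$ and independent of the source sequence $X^n=(X_1,\dots,X_n)$ (i.i.d. with marginal $p_X$), a stochastic encoder $p_{J|X^nK}$ producing $J\in\mathcal J$, and a stochastic decoder $p_{\hat X^n|JK}$ producing $\hat X^n\in\mathbb R^n$. A level $D$ is achievable with respect to $p_{\hat X}$ subject to $(R,R_c)$ if for some $n$ there is such a code with $\frac1n\log|\mathcal J|\le R$, $\frac1n\log|\mathcal K|\le R_c$, $\frac1n\sum_{t=1}^n\mathbb E[\Delta(X_t,\hat X_t)]\le D$, and $\hat X_1,\dots,\hat X_n$ i.i.d. with marginal $p_{\hat X}$; $D(R,R_c|p_X,p_{\hat X})$ is the infimum of achievable $D$. *)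

(* Defs.v *)
From HB Require Import structures.
From mathcomp Require Import all_boot all_order all_algebra.
From mathcomp Require Import all_classical all_reals all_analysis.
Set Implicit Arguments. Unset Strict Implicit. Unset Printing Implicit Defensive.
Import Order.TTheory GRing.Theory Num.Theory.
Local Open Scope classical_set_scope.
Local Open Scope ring_scope.

Section defs.
Context {R : realType}.

(* A (set function) law P on R^n (= n.-tuple R with the product Borel
   sigma-algebra) is the law of an i.i.d. sequence with marginal p:
   it is the product law on all measurable rectangles (these determine it). *)
Definition iid_law (n : nat) (P : set (n.-tuple R) -> \bar R)
    (p : set R -> \bar R) : Prop :=
  forall B : 'I_n -> set R, (forall i, measurable (B i)) ->
    P [set x | forall i, B i (tnth x i)] = (\prod_(i < n) p (B i))%E.

(* Average expected per-letter distortion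
   (1/n) sum_t E[Delta(X_t, Xhat_t)] of the code (K uniform on K, encoder e,
   decoder dec) when X^n has law PX. *)
Definition code_distortion (Delta : R -> R -> R) (n : nat) (J K : finType)
    (PX : probability (n.-tuple R) R)
    (e : n.-tuple R -> K -> J -> R)
    (dec : J -> K -> probability (n.-tuple R) R) : \bar R :=
  (\sum_(k : K) \sum_(j : J)
     ((#|K|%:R)^-1)%:E *
     \int[PX]_x ((e x k j)%:E *
        \int[dec j k]_y ((n%:R)^-1 * \sum_(t < n) Delta (tnth x t) (tnth y t))%:E))%E.

Definition code_output_law (n : nat) (J K : finType)
    (PX : probability (n.-tuple R) R)
    (e : n.-tuple R -> K -> J -> R)
    (dec : J -> K -> probability (n.-tuple R) R) : set (n.-tuple R) -> \bar R :=
  fun A => (\sum_(k : K) \sum_(j : J)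
     ((#|K|%:R)^-1)%:E * \int[PX]_x (e x k j)%:E * dec j k A)%E.

(* D is achievable w.r.t. pXhat subject to (Rt, Rc); PX n is the law of the
   source block X^n (i.i.d. with marginal p_X). *)
Definition achievable (Delta : R -> R -> R)
    (PX : forall n : nat, probability (n.-tuple R) R)
    (pXhat : set R -> \bar R) (Rt Rc D : R) : Prop :=
  exists (n : nat) (J K : finType)
         (e : n.-tuple R -> K -> J -> R)
         (dec : J -> K -> probability (n.-tuple R) R),
    [/\ (0 < n)%N, (0 < #|K|)%N,
        (n%:R)^-1 * ln (#|J|%:R) <= Rt &
        (n%:R)^-1 * ln (#|K|%:R) <= Rc] /\
    [/\ (forall x k j, 0 <= e x k j),
        (forall x k, \sum_(j : J) e x k j = 1) &
        (forall k j, measurable_fun [set: n.-tuple R] (fun x => e x k j))] /\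
    (code_distortion Delta (PX n) e dec <= D%:E)%E /\
    iid_law (code_output_law (PX n) e dec) pXhat.

Definition oc_distortion_rate (Delta : R -> R -> R)
    (PX : forall n : nat, probability (n.-tuple R) R)
    (pXhat : set R -> \bar R) (Rt Rc : R) : \bar R :=
  ereal_inf [set D%:E | D in [set D : R | achievable Delta PX pXhat Rt Rc D]].

Definition sq_err (x y : R) : R := (x - y) ^+ 2.

Definition xi (Rt Rc : R) : R :=
  Num.sqrt ((1 - expR (- (2 * Rt))) * (1 - expR (- (2 * (Rt + Rc))))).

End defs.

(* Main.v *)
Require Import Defs.
From HB Require Import structures.
From mathcomp Require Import all_boot all_order all_algebra.
From mathcomp Require Import all_classical all_reals all_analysis.
From mathcomp Require Import finmap measurable_realfun ring lra.

(* Standardize source and output to X and Y, so that the distortion of a code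
   is affine in the correlation (1/n) sum_t E[X_t Y_t].  X and Y are
   independent given the message m = (k, j), hence the correlation equals
   (1/n) E<E[X | m], E[Y | m]>.

   Converse.  If m takes at most exp(n r) values then
   E|E[X | m]|^2 <= n (1 - exp(-2 r)); the inequality 1 + psi <= exp psi applied
   to suitable Gaussian log-densities replaces the mutual information bound.
   Given k, m takes |J| values, and unconditionally |K||J| values; apply this to
   X with r = R and to Y with r = R + R_c, and use the Cauchy-Schwarz inequality.

   Achievability.  Take a codebook U_m of |K||J| independent standard Gaussian
   vectors and rho_1^2 < 1 - exp(-2 R), rho_2^2 < 1 - exp(-2 (R + R_c)).  With
   positive probability the mixture over j of N(rho_1 U_kj, 1 - rho_1^2) is for
   most k close to the source law, and the mixture over m of
   N(rho_2 U_m, 1 - rho_2^2) is close to the output law (soft covering).  The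
   densities, clipped and completed by small remainders, become soft partitions
   of unity w and v of exactly the two standard laws: w is the encoder, and the
   decoder draws from the output law reweighted by v_m, so that the output is
   exactly i.i.d.  Both sides are then close to rho_i U_m in mean square, and the
   converse bounds on E|E[X | m]|^2 and E|E[Y | m]|^2 turn this into
   correlation nearly rho_1 rho_2. *)

Set Implicit Arguments. Unset Strict Implicit. Unset Printing Implicit Defensive.
Import Order.TTheory GRing.Theory Num.Theory.
Local Open Scope classical_set_scope.
Local Open Scope ring_scope.
Import HBNNSimple.

(** * Measures with densities and product laws *)

(** Soft covering gives laws that are only close to the Gaussian ones, whereas the output must be
    exactly i.i.d. The encoder already fixes the probability [p m / #|K|] of each message, so the
    output side needs a partition of unity whose members have exactly these integrals. Hence the
    output mixture carries the actual probabilities instead of uniform ones, and its remainder is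
    shared among the messages in proportion to what each still lacks.

    A remainder of small mass may still be costly under quadratic distortion. Fourth moments of both
    blocks and of the codewords pay for it: mass times a large [lam], plus fourth moment over [lam].

    Mean square closeness to [rho1 * u] and [rho2 * u] alone does not confine the conditional means.
    The converse bounds their squares from above; the correlation is then the cross term of a
    nonnegative square, in which the norms of the codewords cancel.

    Gaussianity is recorded by moment generating functions only, so moments come from inequalities
    such as 1 + x <= exp x at small arguments and not from differentiation. *)

Section ge0_fun_ind.
Context {d} {T : measurableType d} {R : realType}.
Local Open Scope ereal_scope.

(** Simple functions arise from indicators by scaling and adding, and [nnsfun_approx] makes every
    nonnegative measurable function an increasing limit of them. *)
Lemma ge0_measurable_fun_ind (C : (T -> \bar R) -> Prop) :
  (forall A, measurable A -> C (fun x => (\1_A x)%:E)) ->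
  (forall (k : R) (f : T -> \bar R), (0 <= k)%R -> measurable_fun setT f ->
     (forall x, 0 <= f x) -> C f -> C (fun x => k%:E * f x)) ->
  (forall f g : T -> \bar R, measurable_fun setT f -> measurable_fun setT g ->
     (forall x, 0 <= f x) -> (forall x, 0 <= g x) ->
     C f -> C g -> C (fun x => f x + g x)) ->
  (forall (h : (T -> \bar R)^nat) (f : T -> \bar R), (forall n, measurable_fun setT (h n)) ->
     (forall n x, 0 <= h n x) -> (forall x, nondecreasing_seq (h ^~ x)) ->
     (forall x, h n x @[n --> \oo] --> f x) -> (forall n, C (h n)) -> C f) ->
  forall f : T -> \bar R, measurable_fun setT f -> (forall x, 0 <= f x) -> C f.
Proof.
move=> C1 CZ CD Clim f mf f0.
pose h := nnsfun_approx (@measurableT _ T) mf.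
apply: (Clim (fun n x => (h n x)%:E : \bar R) f) => //.
- by move=> n; apply/measurable_EFinP; exact: measurable_funP.
- by move=> n x; rewrite lee_fin; exact: fun_ge0.
- by move=> x a b ab; rewrite lee_fin; exact/lefP/nd_nnsfun_approx.
- by move=> x; exact: cvg_nnsfun_approx.
move=> n.
have -> : (fun x => (h n x)%:E) =
    (fun x => \sum_(y <- fset_set (range (h n))) (y%:E * (\1_(h n @^-1` [set y]) x)%:E)).
  apply/funext => x; rewrite fimfunE -fsumEFin// fsbig_finite//=.
have mA y : measurable (h n @^-1` [set y]).
  by rewrite -[X in measurable X]setTI; exact: (measurable_funP (h n)).
have : forall y, y \in (fset_set (range (h n)) : seq R) -> (0 <= y)%R.
  by move=> y; rewrite in_fset_set// => /set_mem[x _ <-]; exact: fun_ge0.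
elim: (fset_set (range (h n)) : seq R) => [|y s IH] s0.
  have := C1 set0 measurable0; congr C; apply/funext => x.
  by rewrite big_nil indic0.
have ysum x : 0 <= \sum_(j <- s) (j%:E * (\1_(h n @^-1` [set j]) x)%:E).
  rewrite big_seq; apply: sume_ge0 => z zs; apply: mule_ge0; rewrite lee_fin//.
  by apply: s0; rewrite inE zs orbT.
have m1 z : measurable_fun setT (fun x => z%:E * (\1_(h n @^-1` [set z]) x)%:E : \bar R).
  by apply/measurable_EFinP; apply: measurable_funM => //; exact: measurable_indic.
have y0 : (0 <= y)%R by apply: s0; rewrite inE eqxx.
have -> : (fun x => \sum_(j <- y :: s) (j%:E * (\1_(h n @^-1` [set j]) x)%:E)) =
    (fun x => y%:E * (\1_(h n @^-1` [set y]) x)%:E +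
       \sum_(j <- s) (j%:E * (\1_(h n @^-1` [set j]) x)%:E)).
  by apply/funext => x; rewrite big_cons.
apply: CD => //.
- exact: emeasurable_sum.
- by move=> x; rewrite mule_ge0// lee_fin.
- apply: CZ => //.
    by apply/measurable_EFinP; exact: measurable_indic.
  exact: C1.
- by apply: IH => z zs; apply: s0; rewrite inE zs orbT.
Qed.

End ge0_fun_ind.

Section density_measure.
Context {d} {T : measurableType d} {R : realType}.
Variables (P : {measure set T -> \bar R}) (w : T -> R).
Hypotheses (mw : measurable_fun setT w) (w0 : forall x, 0 <= w x).
Local Open Scope ereal_scope.

(** The two proofs are arguments so that the measure structure declared below can be inferred from
    the term itself. *)
Definition density_measure (_ : measurable_fun setT w) (_ : forall x, (0 <= w x)%R)
  : set T -> \bar R := fun A => \int[P]_(x in A) (w x)%:E.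

Local Notation nu := (density_measure mw w0).

Let nu0 : nu set0 = 0. Proof. exact: integral_set0. Qed.

Let nu_ge0 A : 0 <= nu A.
Proof. by apply: integral_ge0 => x _; rewrite lee_fin. Qed.

Let nu_sigma_additive : semi_sigma_additive nu.
Proof.
apply: (@semi_sigma_additive_nng_induced _ _ _ P (EFin \o w)).
  exact/measurable_EFinP.
by move=> x; rewrite lee_fin.
Qed.

HB.instance Definition _ := isMeasure.Build _ _ _ nu nu0 nu_ge0 nu_sigma_additive.

Lemma integral_density f : measurable_fun setT f -> (forall x, 0 <= f x) ->
  \int[nu]_x f x = \int[P]_x (f x * (w x)%:E).
Proof.
have mwE : measurable_fun setT (EFin \o w) by exact/measurable_EFinP.
move: f; apply: ge0_measurable_fun_ind.
- move=> A mA; rewrite integral_indic// setIT.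
  transitivity (\int[P]_(x in A) (w x)%:E); first by [].
  rewrite [LHS]integral_mkcond; apply: eq_integral => x _.
  by rewrite epatch_indic/= muleC.
- move=> k f k0 mf f0 IH; rewrite ge0_integralZl_EFin// IH.
  rewrite -ge0_integralZl_EFin//; last 2 first.
    by move=> x _; rewrite mule_ge0// lee_fin.
    exact: emeasurable_funM.
  by apply: eq_integral => x _; rewrite muleA.
- move=> f g mf mg f0 g0 IHf IHg; rewrite ge0_integralD// IHf IHg -ge0_integralD//.
  + by apply: eq_integral => x _; rewrite ge0_muleDl.
  + by move=> x _; rewrite mule_ge0// lee_fin.
  + exact: emeasurable_funM.
  + by move=> x _; rewrite mule_ge0// lee_fin.
  + exact: emeasurable_funM.
move=> h f mh h0 ndh hf IH.
have fE x : f x = limn (h ^~ x) by apply/esym/cvg_lim.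
have fwE x : f x * (w x)%:E = limn (fun n => h n x * (w x)%:E).
  by apply/esym/cvg_lim => //; apply: cvgeZr.
under [RHS]eq_integral do rewrite fwE.
under [LHS]eq_integral do rewrite fE.
rewrite monotone_convergence//.
rewrite monotone_convergence//.
- by congr (limn _); apply/funext => n; exact: IH.
- by move=> n; exact: emeasurable_funM.
- by move=> n x _; rewrite mule_ge0// lee_fin.
- by move=> x _ a b ab; rewrite lee_wpmul2r ?lee_fin//; exact: ndh.
Qed.

End density_measure.

Section measure_sum.
Context {d} {T : measurableType d} {R : realType} {I : finType}.
Variables (P : {measure set T -> \bar R}) (nu : I -> {measure set T -> \bar R}).
Hypothesis Pnu : forall A, measurable A -> P A = (\sum_i nu i A)%E.
Local Open Scope ereal_scope.

(** In the applications [P] is the law of a block and [nu i] its part belonging to message [i]. *)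
Lemma integral_fin_measure_sum f : measurable_fun setT f -> (forall x, 0 <= f x) ->
  \int[P]_x f x = \sum_i \int[nu i]_x f x.
Proof.
move: f; apply: ge0_measurable_fun_ind.
- move=> A mA; rewrite integral_indic// setIT Pnu//; apply: eq_bigr => i _.
  by rewrite integral_indic// setIT.
- move=> k f k0 mf f0 IH; rewrite ge0_integralZl_EFin// IH ge0_sume_distrr//.
    by apply: eq_bigr => i _; rewrite ge0_integralZl_EFin.
  by move=> i _; exact: integral_ge0.
- move=> f g mf mg f0 g0 IHf IHg; rewrite ge0_integralD// IHf IHg -big_split/=.
  by apply: eq_bigr => i _; rewrite ge0_integralD.
move=> h f mh h0 ndh hf IH.
have fE x : f x = limn (h ^~ x) by apply/esym/cvg_lim.
under eq_integral do rewrite fE.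
rewrite monotone_convergence//.
under eq_fun do rewrite IH.
apply/cvg_lim => //.
apply: cvg_nnesum => /=.
  by move=> i _; apply: nearW => n; exact: integral_ge0.
move=> i _; under eq_integral do rewrite fE.
by apply: cvg_monotone_convergence => // x _; exact: ndh.
Qed.

End measure_sum.

Lemma emeasurable_prod d (T : measurableType d) (R : realType) (I : Type) (s : seq I)
    (h : I -> T -> \bar R) : (forall i, measurable_fun setT (h i)) ->
  measurable_fun setT (fun x => \prod_(i <- s) h i x)%E.
Proof.
move=> mh; elim: s => [|i s IH].
  rewrite (_ : (fun _ => _) = cst 1%E) //.
  by apply/funext => x; rewrite big_nil.
rewrite (_ : (fun _ => _) = (fun x => h i x * \prod_(j <- s) h j x)%E).
  exact: emeasurable_funM.
by apply/funext => x; rewrite big_cons.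
Qed.

Section tuple_product.
Context {d} {T : measurableType d} {R : realType} (p : probability T R).
Local Open Scope ereal_scope.

Definition box n (B : 'I_n -> set T) : set (n.-tuple T) :=
  [set x | forall i, B i (tnth x i)].

Lemma measurable_box n (B : 'I_n -> set T) :
  (forall i, measurable (B i)) -> measurable (box B).
Proof.
move=> mB.
have -> : box B = \bigcap_(i in [set` 'I_n]) ((@tnth n T)^~ i @^-1` B i).
  by apply/seteqP; split => x /= Bx i; [move=> _; exact: Bx|exact: Bx].
apply: fin_bigcap_measurable => // i _.
rewrite -[X in measurable X]setTI; exact: measurable_tnth.
Qed.

(** A cylinder over one coordinate is a box whose other sides are [setT]. Boxes are moreover stable
    under intersection, which is what uniqueness of measures asks of a generator. *)
Lemma measurable_tuple_box n :
  measurable = <<s [set A : set (n.-tuple T) |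
    exists2 B : 'I_n -> set T, (forall i, measurable (B i)) & A = box B] >>.
Proof.
apply/seteqP; split.
- apply: smallest_sub; first exact: smallest_sigma_algebra.
  rewrite -bigcup_seq/= => A [i _ [C mC <-]].
  apply: sub_sigma_algebra => /=.
  exists (fun j => if j == i then C else setT).
    by move=> j; case: ifP.
  rewrite setTI; apply/seteqP; split => x /=.
    by move=> Cx j; case: eqP => [->|].
  by move=> /(_ i); rewrite eqxx.
- apply: smallest_sub; first exact: sigma_algebra_measurable.
  by move=> _ [B mB ->]; exact: measurable_box.
Qed.

Lemma tuple_measure_unique n (m1 m2 : {measure set (n.-tuple T) -> \bar R}) :
  (forall B : 'I_n -> set T, (forall i, measurable (B i)) -> m1 (box B) = m2 (box B)) ->
  m1 setT < +oo ->
  forall A, measurable A -> m1 A = m2 A.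
Proof.
move=> m12 m1oo; apply: (measure_unique _ (fun=> setT) (@measurable_tuple_box n)) => //.
- move=> _ _ [B mB ->] [C mC ->]; exists (fun i => B i `&` C i).
    by move=> i; exact: measurableI.
  by apply/seteqP; split => x /=; [move=> [Bx Cx] i; split|move=> BCx; split => i; have [] := BCx i].
- by move=> _; exists (fun=> setT) => //; apply/seteqP; split.
- by rewrite bigcup_const//; exists 0%N.
- by move=> _ [B mB ->]; exact: m12.
Qed.

(** Independence is encoded by integrals of products instead of probabilities of boxes: moment
    generating functions then factor at once, and so do functions of distinct codewords. *)
Definition integral_prod_law n (P : set (n.-tuple T) -> \bar R) :=
  forall g : 'I_n -> T -> \bar R, (forall i, measurable_fun setT (g i)) ->
    (forall i x, 0 <= g i x) ->
    \int[P]_x (\prod_i g i (tnth x i)) = \prod_i \int[p]_x g i x.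

Lemma integral_prod_law_box n (P : {measure set (n.-tuple T) -> \bar R}) :
  integral_prod_law P -> forall B : 'I_n -> set T, (forall i, measurable (B i)) ->
  P (box B) = \prod_i p (B i).
Proof.
move=> PP B mB.
transitivity (\prod_(i < n) \int[p]_x (\1_(B i) x)%:E); last first.
  by apply: eq_bigr => i _; rewrite integral_indic// setIT.
rewrite -PP; last 2 first.
- by move=> i; apply/measurable_EFinP; exact: measurable_indic.
- by move=> i x; rewrite lee_fin.
rewrite -[in LHS](setIT (box B)) -integral_indic//; last exact: measurable_box.
apply: eq_integral => x _; rewrite prodEFin; congr (_%:E).
rewrite indicE; have [/set_mem Bx|/negP Bx] := boolP (x \in box B).
  by rewrite big1// => i _; rewrite indicE mem_set//; exact: Bx.
have [i Bi] : exists i, ~ B i (tnth x i).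
  by apply/existsNP => Bx'; apply: Bx; exact/mem_set.
by rewrite (bigD1 i)//= indicE memNset// mul0r.
Qed.

(** Induction on [n]: the image of [p \x P] under cons prepends an independent letter, and Tonelli
    splits off its factor. *)
Lemma integral_prod_law_exists n :
  exists P : probability (n.-tuple T) R, integral_prod_law P.
Proof.
elim: n => [|n [P IH]].
  exists (dirac [tuple]) => g mg g0.
  under eq_integral do rewrite big_ord0.
  by rewrite big_ord0 integral_cst// mul1e; exact: probability_setT.
pose cns (z : T * n.-tuple T) : n.+1.-tuple T := [the n.+1.-tuple T of z.1 :: z.2].
have mcns : measurable_fun setT cns by exact: measurable_cons.
pose X : {mfun (T * n.-tuple T)%type >-> n.+1.-tuple T} :=
  HB.pack cns (isMeasurableFun.Build _ _ _ _ _ mcns).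
exists (distribution (p \x P) X) => g mg g0.
have mprod k (h : 'I_k -> T -> \bar R) : (forall i, measurable_fun setT (h i)) ->
    (forall i x, 0 <= h i x) ->
    measurable_fun setT (fun x : k.-tuple T => \prod_i h i (tnth x i)).
  move=> mh h0; apply: emeasurable_prod => i.
  by apply: measurableT_comp => //; exact: measurable_tnth.
rewrite ge0_integral_distribution//; last 2 first.
- exact: mprod.
- by move=> y; apply: prode_ge0.
rewrite fubini_tonelli1//; last 2 first.
- by apply: measurableT_comp => //; exact: mprod.
- by move=> y; apply: prode_ge0.
rewrite big_ord_recl.
transitivity (\int[p]_x (g ord0 x * \prod_(i < n) \int[p]_x g (lift ord0 i) x)).
  apply: eq_integral => x _; rewrite /fubini_F/=.
  rewrite -IH//.
  rewrite -ge0_integralZl//; last 2 first.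
  - exact: (mprod n (fun i => g (lift ord0 i))).
  - by move=> y _; apply: prode_ge0.
  apply: eq_integral => y _; rewrite big_ord_recl tnth0; congr (_ * _).
  by apply: eq_bigr => i _; rewrite tnthS.
rewrite ge0_integralZr// prode_ge0// => i _; exact: integral_ge0.
Qed.

(** Boxes determine a finite measure, so [P] agrees with the law of [integral_prod_law_exists] and
    inherits its integral formula. *)
Lemma integral_prod_lawP n (P : probability (n.-tuple T) R) :
  (forall B : 'I_n -> set T, (forall i, measurable (B i)) ->
    P (box B) = \prod_i p (B i)) -> integral_prod_law P.
Proof.
move=> PB g mg g0.
have [Q QP] := integral_prod_law_exists n.
rewrite -QP//; apply: eq_measure_integral => A mA _.
apply: tuple_measure_unique => //.
  move=> B mB; transitivity (\prod_i p (B i)); first exact: PB.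
  by apply/esym; exact: integral_prod_law_box.
by rewrite [X in X < _]probability_setT ltry.
Qed.

End tuple_product.

(** * Gaussian families *)

Section normal_mgf.
Context {R : realType}.

(* E[exp(a Z^2 + b Z)] for a standard normal Z and a < 1/2. *)
Definition gmgf (a b : R) : R :=
  expR (b ^+ 2 / (2 * (1 - 2 * a))) / Num.sqrt (1 - 2 * a).

Lemma gmgf_ge0 a b : 0 <= gmgf a b.
Proof. by rewrite divr_ge0// ?expR_ge0 ?sqrtr_ge0. Qed.

Lemma gmgf00 : gmgf 0 0 = 1.
Proof. by rewrite /gmgf mulr0 subr0 sqrtr1 expr0n/= mul0r expR0 divr1. Qed.

Lemma integral_normal_prob (m s : R) (f : R -> \bar R) :
  measurable_fun setT f -> (forall x, 0 <= f x)%E ->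
  (\int[normal_prob m s]_x f x =
   \int[lebesgue_measure]_x (f x * (normal_pdf m s x)%:E))%E.
Proof.
move=> mf f0.
by rewrite -(integral_density lebesgue_measure (measurable_normal_pdf m s)
  (normal_pdf_ge0 m s)).
Qed.

(** Completing the square: a normal density tilted by the exponential of a quadratic is a multiple
    of another normal density, whose variance [s ^+ 2 / (1 - 2 * a)] is positive because
    [a < 2^-1]. *)
Lemma expR_quad_normal_pdf (m s a b x : R) : 0 < s -> a < 2^-1 ->
  expR (a * ((x - m) / s) ^+ 2 + b * ((x - m) / s)) * normal_pdf m s x =
  gmgf a b *
    normal_pdf (m + s * b / (1 - 2 * a)) (s / Num.sqrt (1 - 2 * a)) x.
Proof.
move=> s0 a2; rewrite /gmgf.
have [c ca] : exists c, c = 1 - 2 * a by eexists.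
have aE : a = (1 - c) / 2 by rewrite ca; field.
have c0 : 0 < c by lra.
rewrite -ca.
have sc0 : 0 < Num.sqrt c by rewrite sqrtr_gt0.
have cn0 : c != 0 by rewrite gt_eqF.
have sn0 : s != 0 by rewrite gt_eqF.
have s'0 : s / Num.sqrt c != 0 by rewrite gt_eqF// divr_gt0.
rewrite !normal_pdfE// /normal_peak /normal_fun.
have -> : (s / Num.sqrt c) ^+ 2 = s ^+ 2 / c by rewrite expr_div_n sqr_sqrtr// ltW.
have -> : Num.sqrt (s ^+ 2 / c * pi *+ 2) = Num.sqrt (s ^+ 2 * pi *+ 2) / Num.sqrt c.
  have p0 : 0 <= s ^+ 2 * pi *+ 2 by rewrite mulrn_wge0// mulr_ge0 ?pi_ge0// sqr_ge0.
  rewrite -sqrtrV ?(ltW c0)// -sqrtrM//.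
  by rewrite mulrnAl (mulrAC (s ^+ 2)).
rewrite invf_div.
move: (Num.sqrt (s ^+ 2 * pi *+ 2))^-1 => p.
rewrite mulrCA -expRD.
have -> : a * ((x - m) / s) ^+ 2 + b * ((x - m) / s) + - (x - m) ^+ 2 / (s ^+ 2 *+ 2) =
   b ^+ 2 / (2 * c) + - (x - (m + s * b / c)) ^+ 2 / (s ^+ 2 / c *+ 2).
  by rewrite aE; field; rewrite sn0 cn0.
rewrite expRD; move: (expR _) (expR _) => e1 e2.
by move: (Num.sqrt c) sc0 => q q0; field; rewrite gt_eqF.
Qed.

Lemma normal_mgf (m s a b : R) : 0 < s -> a < 2^-1 ->
  (\int[normal_prob m s]_x
     (expR (a * ((x - m) / s) ^+ 2 + b * ((x - m) / s)))%:E = (gmgf a b)%:E)%E.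
Proof.
move=> s0 a2.
rewrite integral_normal_prob//; last first.
  apply/measurable_EFinP; apply: measurableT_comp => //.
  apply: measurable_funD; apply: measurable_funM => //; last first.
    by apply: measurable_funM => //; exact: measurable_funB.
  by apply: measurable_funX; apply: measurable_funM => //; exact: measurable_funB.
set m' := m + s * b / (1 - 2 * a); set s' := s / Num.sqrt (1 - 2 * a).
transitivity (\int[lebesgue_measure]_x ((gmgf a b)%:E * (normal_pdf m' s' x)%:E))%E; last first.
  rewrite ge0_integralZl_EFin ?gmgf_ge0//.
  - by rewrite integral_normal_pdf mule1.
  - by move=> x _; rewrite lee_fin normal_pdf_ge0.
  - by apply/measurable_EFinP; exact: measurable_normal_pdf.
by apply: eq_integral => x _; rewrite -!EFinM expR_quad_normal_pdf.
Qed.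

End normal_mgf.

Section mgf_moments.
Context {d} {T : measurableType d} {R : realType}.
Variables (nu : {measure set T -> \bar R}).
Hypothesis nu1 : (nu setT = 1)%E.

Lemma integral_1DZ (c : R) (g : T -> \bar R) : 0 <= c -> measurable_fun setT g ->
  (forall x, 0 <= g x)%E ->
  (\int[nu]_x (1 + c%:E * g x) = 1 + c%:E * \int[nu]_x g x)%E.
Proof.
move=> c0 mg g0; rewrite ge0_integralD//.
- by rewrite integral_cst// mul1e nu1 ge0_integralZl_EFin.
- by move=> x _; rewrite mule_ge0.
- exact: measurable_funeM.
Qed.

(* The hypothesis compares [g] with the square of a centred normal of variance [v]. *)
Lemma sq_mgf_integral_le (g : T -> R) (v : R) : 0 <= v <= 1 ->
  measurable_fun setT g -> (forall x, 0 <= g x) ->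
  (forall a : R, 0 < a <= 4^-1 ->
     (\int[nu]_x (expR (a * g x))%:E <= ((Num.sqrt (1 - 2 * a * v))^-1)%:E)%E) ->
  (\int[nu]_x (g x)%:E <= v%:E)%E.
Proof.
move=> /andP[v0 v1] mg g0 H.
have mgE : measurable_fun setT (fun x => (g x)%:E) by exact/measurable_EFinP.
(* On the left, 1 + a g <= exp (a g). On the right, 1 / s <= 1 + a v / s^2 for s^2 = 1 - 2 a v,
   which follows from (1 - s)^2 >= 0. *)
have key (a : R) : 0 < a <= 4^-1 ->
    (1 + a%:E * \int[nu]_x (g x)%:E <= (1 + a * v / (1 - 2 * a * v))%:E)%E.
  move=> /andP[a0 a4]; have w0 : 0 < 1 - 2 * a * v by nra.
  rewrite -integral_1DZ//; last by rewrite ltW.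
  apply: (@le_trans _ _ (\int[nu]_x (expR (a * g x))%:E)%E).
    apply: ge0_le_integral => //.
    - by move=> x _; rewrite adde_ge0 ?lee_fin ?mulr_ge0// ltW.
    - by apply: emeasurable_funD => //; exact: measurable_funeM.
    - apply/measurable_EFinP; apply: measurableT_comp => //.
      exact: measurable_funM.
    - by move=> x _; rewrite -EFinM -EFinD lee_fin expR_ge1Dx.
  rewrite (le_trans (H a _)) ?a0// lee_fin.
  set s := Num.sqrt _; have s0 : 0 < s by rewrite sqrtr_gt0.
  have sE : s ^+ 2 = 1 - 2 * a * v by rewrite sqr_sqrtr// ltW.
  rewrite -sE -div1r ler_pdivrMr// mulrDl mul1r.
  have -> : a * v / s ^+ 2 * s = a * v / s by field; rewrite gt_eqF.
  rewrite -(ler_pM2r s0) mul1r mulrDl divfK ?gt_eqF// -expr2 sE.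
  have : (1 - s) ^+ 2 >= 0 by exact: sqr_ge0.
  by rewrite sqrrB sE; lra.
have gfin : (\int[nu]_x (g x)%:E)%E \is a fin_num.
  rewrite ge0_fin_numE; last by apply: integral_ge0 => x _; rewrite lee_fin.
  have := key (4^-1) _; rewrite lexx invr_gt0 ltr0n/= => /(_ isT).
  case: (\int[nu]_x (g x)%:E)%E => [r _| |_]//; first exact: ltry.
  by rewrite gt0_muley ?lte_fin ?invr_gt0// addey// leye_eq.
move: key; rewrite -(fineK gfin); set x := fine _ => key.
rewrite lee_fin leNgt; apply/negP => vx.
have x0 : 0 < x by apply: le_lt_trans vx.
(* For a mean x > v, [key] reads x - 2 v (a x) <= v. With a x = (x - v) / 4 this becomes (x - v) (1
   - v / 2) <= 0, impossible since v <= 1. *)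
pose a := (x - v) / (4 * x).
have a0 : 0 < a by rewrite divr_gt0 ?subr_gt0// mulr_gt0.
have axE : a * x = (x - v) / 4 by rewrite /a; field; rewrite gt_eqF.
have a4 : a <= 4^-1 by rewrite /a ler_pdivrMr ?mulr_gt0// mulrA mulVf// mul1r; lra.
have := key a; rewrite a0 a4 => /(_ isT); rewrite -EFinM -EFinD lee_fin lerD2l.
have w0 : 0 < 1 - 2 * a * v by nra.
rewrite -mulrA ler_pM2l// ler_pdivlMr// mulrBr mulr1.
have -> : x * (2 * a * v) = 2 * v * (a * x) by ring.
rewrite axE; nra.
Qed.

End mgf_moments.

Section gauss.
Context {d} {T : measurableType d} {R : realType} {n : nat}.
Variables (P : probability T R) (f : 'I_n -> T -> R).

(* [f] is a standard Gaussian vector under [P], expressed through the moment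
   generating function of its coordinates and their squares. *)
Definition gauss := (forall i, measurable_fun setT (f i)) /\
  forall a b : 'I_n -> R, (forall i, a i < 2^-1) ->
  (\int[P]_x (expR (\sum_i (a i * f i x ^+ 2 + b i * f i x)))%:E =
   (\prod_i gmgf (a i) (b i))%:E)%E.

Hypothesis Pf : gauss.

Let mf i : measurable_fun setT (f i). Proof. by case: Pf. Qed.

Lemma gauss_mgf1 i a b : a < 2^-1 ->
  (\int[P]_x (expR (a * f i x ^+ 2 + b * f i x))%:E = (gmgf a b)%:E)%E.
Proof.
move=> a2; case: Pf => _ /(_ (fun j => if j == i then a else 0) (fun j => if j == i then b else 0)).
rewrite (bigD1 i)//= eqxx big1 ?mulr1; last first.
  by move=> j /negPf ->; exact: gmgf00.
move=> <-; last by move=> j; case: ifP => // _; rewrite invr_gt0.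
apply: eq_integral => x _; rewrite (bigD1 i)//= eqxx big1 ?addr0//.
by move=> j /negPf ->; rewrite !mul0r addr0.
Qed.

(** Two one-sided bounds replace the derivative of the moment generating function at 0: exponents
    [a > 0] bound the second moment from above, exponents [- a] from below. *)
Lemma gauss_sq i : (\int[P]_x (f i x ^+ 2)%:E = 1)%E.
Proof.
have msq : measurable_fun setT (fun x => f i x ^+ 2) by exact: measurable_funX.
have msqE : measurable_fun setT (fun x => (f i x ^+ 2)%:E) by exact/measurable_EFinP.
have P1 : (P setT = 1)%E by exact: probability_setT.
have le1 : (\int[P]_x (f i x ^+ 2)%:E <= 1)%E.
  apply: sq_mgf_integral_le => //; first by rewrite ler01 lexx.
    by move=> x; exact: sqr_ge0.
  move=> a /andP[a0 a4].
  have := @gauss_mgf1 i a 0 _; rewrite /gmgf expr0n/= mul0r expR0 mulr1 div1r => <-.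
    by under [leRHS]eq_integral do rewrite mul0r addr0.
  by lra.
have fi : (\int[P]_x (f i x ^+ 2)%:E)%E \is a fin_num.
  rewrite ge0_fin_numE ?(le_lt_trans le1) ?ltry//.
  by apply: integral_ge0 => x _; rewrite lee_fin sqr_ge0.
apply/eqP; rewrite eq_le le1/=.
have key (a : R) : 0 < a -> (1 <= a%:E * \int[P]_x (f i x ^+ 2)%:E + ((Num.sqrt (1 + 2 * a))^-1)%:E)%E.
  move=> a0.
  have := @gauss_mgf1 i (- a) 0 _; rewrite /gmgf expr0n/= mul0r expR0 div1r mulrN opprK => <-; last by lra.
  rewrite -ge0_integralZl_EFin//; last 2 first.
  - by move=> x _; rewrite lee_fin sqr_ge0.
  - by rewrite ltW.
  rewrite -ge0_integralD//; last 3 first.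
  - by move=> x _; rewrite mule_ge0// lee_fin ?sqr_ge0// ltW.
  - exact: measurable_funeM.
  - apply/measurable_EFinP; apply: measurableT_comp => //.
    by apply: measurable_funD; apply: measurable_funM.
  have -> : (1 = \int[P]_x (cst 1 x) :> \bar R)%E by rewrite integral_cst// mul1e.
  apply: ge0_le_integral => //.
  - apply: emeasurable_funD; first exact: measurable_funeM.
    apply/measurable_EFinP; apply: measurableT_comp => //.
    by apply: measurable_funD; apply: measurable_funM.
  - move=> x _; rewrite -EFinM -EFinD lee_fin/= mul0r addr0.
    by have := expR_ge1Dx (- a * f i x ^+ 2); lra.
move: key; rewrite -(fineK fi); set x := fine _ => key.
rewrite lee_fin leNgt; apply/negP => x1.
(* With s^2 = 1 + 2 a and s <= 1 + a, [key] yields 1 <= x (1 + 2 a). For this [a] that means (1 - x)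
   (x / 2 - 1) >= 0, impossible when x < 1. *)
pose a := (1 - x) / 4.
have a0 : 0 < a by rewrite /a; lra.
have := key a a0; rewrite -EFinM -EFinD lee_fin.
set s := Num.sqrt _; have w0 : 0 < 1 + 2 * a by lra.
have s0 : 0 < s by rewrite sqrtr_gt0.
have sE : s ^+ 2 = 1 + 2 * a by rewrite sqr_sqrtr// ltW.
have x0 : 0 <= x by apply: fine_ge0; apply: integral_ge0 => y _; rewrite lee_fin sqr_ge0.
have sV : s^-1 * s = 1 by rewrite mulVf// gt_eqF.
move=> H; have : 1 * s ^+ 2 <= (a * x + s^-1) * s ^+ 2 by rewrite ler_pM2r// sE.
rewrite [leRHS]mulrDl expr2 [s^-1 * _]mulrA sV mul1r -expr2 sE.
have : (1 - s) ^+ 2 >= 0 by exact: sqr_ge0.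
rewrite sqrrB sE expr1n mul1r => ?.
have : a = (1 - x) / 4 by [].
nra.
Qed.

Lemma gauss_integrable_sq i : P.-integrable setT (fun x => (f i x ^+ 2)%:E).
Proof.
apply/integrableP; split; first by apply/measurable_EFinP; exact: measurable_funX.
under eq_integral do rewrite gee0_abs ?lee_fin ?sqr_ge0//.
by rewrite gauss_sq ltry.
Qed.

Lemma gauss_integrable i : P.-integrable setT (fun x => (f i x)%:E).
Proof.
apply: (@le_integrable _ _ _ _ _ _ _ (fun x => (1 + f i x ^+ 2)%:E)) => //.
- exact/measurable_EFinP.
- move=> x _; rewrite lee_fin [leRHS]ger0_norm ?addr_ge0 ?sqr_ge0//.
  rewrite ler_norml; have : 0 <= (f i x + 1) ^+ 2 by exact: sqr_ge0.
  have : 0 <= (f i x - 1) ^+ 2 by exact: sqr_ge0.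
  by rewrite !expr2; nra.
- under eq_fun do rewrite EFinD.
  apply: integrableD => //; last exact: gauss_integrable_sq.
  exact: finite_measure_integrable_cst.
Qed.

(** From 1 + b f <= exp (b f), the mean m satisfies 1 + b m <= exp (b^2 / 2) for [b] of either sign;
    for small [b] the linear term would win unless m = 0. *)
Lemma gauss_mean i : \int[P]_x f i x = 0.
Proof.
have key (b : R) : (1 + b * \int[P]_x f i x <= expR (b ^+ 2 / 2)).
  have ib : P.-integrable setT (fun x => (b * f i x)%:E).
    by under eq_fun do rewrite EFinM; exact: integrableZl (gauss_integrable i).
  have i1 : P.-integrable setT (fun x => (1:R)%:E).
    exact: finite_measure_integrable_cst.
  have := @gauss_mgf1 i 0 b _; rewrite /gmgf mulr0 subr0 sqrtr1 divr1 mulr1 invr_gt0 ltr0n => /(_ isT) mgfE.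
  rewrite -lee_fin -mgfE.
  have -> : ((1 + b * \int[P]_x f i x)%:E = \int[P]_x (1 + b * f i x)%:E)%E.
    under eq_integral do rewrite EFinD.
    rewrite integralD_EFin// integral_cst// mul1e [X in (_ = X + _)%E]probability_setT.
    have -> : (\int[P]_x (b * f i x)%:E = b%:E * \int[P]_x (f i x)%:E)%E.
      under eq_integral do rewrite EFinM.
      by rewrite integralZl//; exact: gauss_integrable.
    rewrite EFinD EFinM; congr (_ + _ * _)%E.
    by rewrite /Rintegral fineK//; apply: integrable_fin_num => //; exact: gauss_integrable.
  apply: le_integral => //.
  - by under eq_fun do rewrite EFinD; exact: integrableD.
  - apply/integrableP; split.
      apply/measurable_EFinP; apply: measurableT_comp => //.
      by apply: measurable_funD; apply: measurable_funM => //; exact: measurable_funX.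
    by under eq_integral do rewrite gee0_abs ?lee_fin ?expR_ge0//; rewrite mgfE ltry.
  - by move=> x _; rewrite lee_fin mul0r add0r expR_ge1Dx.
set m := \int[P]_x f i x in key *.
(* Here exp (b^2 / 2) <= 1 / (1 - b^2 / 2) <= 1 + b^2. Below, b = m / 2 contradicts m <> 0 when |m|
   <= 1, and b = 1 or -1 handles larger m. *)
have bound (b : R) : -1 <= b <= 1 -> b * m <= b ^+ 2.
  move=> /andP[b1 b2]; have := key b.
  have : expR (- (b ^+ 2 / 2)) >= 1 - b ^+ 2 / 2 by have := expR_ge1Dx (- (b ^+ 2 / 2)); lra.
  have : 0 < expR (b ^+ 2 / 2) by exact: expR_gt0.
  have := @expRxMexpNx_1 R (b ^+ 2 / 2).
  set e := expR _; set e' := expR _ => ee' e0 e'1 km.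
  have b21 : b ^+ 2 <= 1 by rewrite expr2; nra.
  have : e * (1 - b ^+ 2 / 2) <= e * e' by rewrite ler_pM2l.
  rewrite ee'.
  nra.
apply/eqP; rewrite eq_le; apply/andP; split; rewrite leNgt; apply/negP => m0.
- have [m2|m2] := leP m 1.
    have := bound (m / 2); rewrite expr2; nra.
  by have := bound 1; rewrite expr2; nra.
- have [m2|m2] := leP (-1) m.
    have := bound (m / 2); rewrite expr2; nra.
  by have := bound (-1); rewrite expr2; nra.
Qed.

(** From exp x >= 1 + x^2 / 2 at x = z^2 / 4 one gets z^4 <= 32 exp (z^2 / 4), and the mean of the
    exponential is sqrt 2 <= 2. Only a constant independent of [n] matters later, so 64 is good
    enough. *)
Lemma gauss_fourth i : (\int[P]_x (f i x ^+ 4)%:E <= 64%:E)%E.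
Proof.
have m4 : measurable_fun setT (fun x => (f i x ^+ 4)%:E).
  by apply/measurable_EFinP; exact: measurable_funX.
have := @gauss_mgf1 i 4^-1 0 _; rewrite /gmgf expr0n/= mul0r expR0 div1r => H.
have {}H : (\int[P]_x (expR (4^-1 * f i x ^+ 2 + 0 * f i x))%:E <= 2%:E)%E.
  rewrite H; last by lra.
  have -> : 1 - 2 / 4 = 2^-1 :> R by lra.
  rewrite lee_fin sqrtrV// invrK -[leRHS]ger0_norm// -sqrtr_sqr ler_wsqrtr//.
  by rewrite expr2; lra.
apply: (@le_trans _ _ (\int[P]_x (32%:E * (expR (4^-1 * f i x ^+ 2 + 0 * f i x))%:E))%E).
  apply: ge0_le_integral => //.
  - by move=> x _; rewrite lee_fin -[4%N]/(2 * 2)%N exprM sqr_ge0.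
  - apply: measurable_funeM.
    apply/measurable_EFinP; apply: measurableT_comp => //.
    by apply: measurable_funD; apply: measurable_funM => //; exact: measurable_funX.
  - move=> x _; rewrite mul0r addr0 -EFinM lee_fin.
    have := @expR_ge1Dxn R (4^-1 * f i x ^+ 2) 1.
    rewrite mulr_ge0 ?sqr_ge0 ?invr_ge0// => /(_ isT).
    rewrite exprMn -exprM; change (2`!%:R : R) with (2:R); lra.
rewrite ge0_integralZl_EFin//.
- apply: (@le_trans _ _ (32%:E * 2%:E)%E); first by rewrite lee_pmul2l.
  by rewrite -EFinM lee_fin -natrM.
- apply/measurable_EFinP; apply: measurableT_comp => //.
  by apply: measurable_funD; apply: measurable_funM => //; exact: measurable_funX.
Qed.

End gauss.

Section normal_law.
Context {R : realType}.
Variables (m s : R).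

Let idR (x : measurableTypeR R) : R := x.

Let measurable_idR : measurable_fun [set: measurableTypeR R] idR.
Proof. by move=> _ A mA; rewrite setTI. Qed.

Let idR_mfun : {mfun measurableTypeR R >-> R} :=
  HB.pack idR (isMeasurableFun.Build _ _ _ _ idR measurable_idR).

(* [normal_prob] lives on [measurableTypeR R], whose display differs from that of [R]. *)
Definition normal_law : probability R R := distribution (normal_prob m s) idR_mfun.

Lemma normal_law_mgf (a b : R) : 0 < s -> a < 2^-1 ->
  (\int[normal_law]_x
     (expR (a * ((x - m) / s) ^+ 2 + b * ((x - m) / s)))%:E = (gmgf a b)%:E)%E.
Proof.
move=> s0 a2; rewrite -(normal_mgf m b s0 a2) ge0_integral_distribution//.
- apply/measurable_EFinP; apply: measurableT_comp => //.
  have mz : measurable_fun [set: R] (fun y : R => (y - m) / s).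
    by apply: measurable_funM => //; exact: measurable_funB.
  apply: measurable_funD; apply: measurable_funM => //.
  exact: measurable_funX.
Qed.

End normal_law.

(** [iid_law] speaks of boxes; [integral_prod_lawP] upgrades it to integrals of products, after
    which each coordinate contributes its own [gmgf]. *)
Lemma iid_normal_gauss {R : realType} n (P : probability (n.-tuple R) R) (m s : R) :
  0 < s -> iid_law P (normal_prob m s) ->
  gauss P (fun i x => (tnth x i - m) / s).
Proof.
move=> s0 HP.
have mz : measurable_fun [set: R] (fun y : R => (y - m) / s).
  by apply: measurable_funM => //; exact: measurable_funB.
split=> [i|a b a2].
  apply: (measurableT_comp mz); exact: measurable_tnth.
have PP : integral_prod_law (normal_law m s) P.
  by apply: integral_prod_lawP => B mB; exact: HP.
have := PP (fun i y => (expR (a i * ((y - m) / s) ^+ 2 + b i * ((y - m) / s)))%:E).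
move=> H; rewrite -prodEFin.
transitivity (\prod_(i < n) \int[normal_law m s]_x
   (expR (a i * ((x - m) / s) ^+ 2 + b i * ((x - m) / s)))%:E)%E; last first.
  by apply: eq_bigr => i _; rewrite normal_law_mgf.
rewrite -H.
- by apply: eq_integral => x _; rewrite prodEFin expR_sum.
- move=> i; apply/measurable_EFinP; apply: measurableT_comp => //.
  apply: measurable_funD; apply: measurable_funM => //.
  exact: measurable_funX.
- by move=> i x; rewrite lee_fin expR_ge0.
Qed.

(** * Integrals of quadratic polynomials against finite measures *)

Section square_integrable_family.
Context {d} {T : measurableType d} {R : realType} {I : finType}.
Variables (nu : {measure set T -> \bar R}) (f : I -> T -> R).

(** Finite mass instead of mass 1: the measures in view are parts of a law, weighted by the
    probability of a message. *)
Definition L2 := [/\ (nu setT < +oo)%E, forall t, measurable_fun setT (f t) &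
  forall t, (\int[nu]_x (f t x ^+ 2)%:E < +oo)%E].

Hypothesis nuf : L2.

Let mf t : measurable_fun setT (f t). Proof. by case: nuf. Qed.

Lemma L2_integrable_cst (c : R) : nu.-integrable setT (fun=> c%:E).
Proof.
apply/integrableP; split => //; rewrite integral_cst//.
have [nufin _ _] := nuf.
by rewrite lte_mul_pinfty ?abse_ge0.
Qed.

Lemma L2_integrable_sq t : nu.-integrable setT (fun x => (f t x ^+ 2)%:E).
Proof.
have [_ _ /(_ t) H] := nuf.
apply/integrableP; split; first by apply/measurable_EFinP; exact: measurable_funX.
by under eq_integral do rewrite gee0_abs ?lee_fin ?sqr_ge0//.
Qed.

Lemma L2_integrable t : nu.-integrable setT (fun x => (f t x)%:E).
Proof.
apply: (@le_integrable _ _ _ _ _ _ _ (fun x => (1 + f t x ^+ 2)%:E)) => //.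
- exact/measurable_EFinP.
- move=> x _; rewrite lee_fin [leRHS]ger0_norm ?addr_ge0 ?sqr_ge0//.
  rewrite ler_norml; have : 0 <= (f t x + 1) ^+ 2 by exact: sqr_ge0.
  have : 0 <= (f t x - 1) ^+ 2 by exact: sqr_ge0.
  by rewrite !expr2; nra.
- under eq_fun do rewrite EFinD.
  apply: integrableD => //; last exact: L2_integrable_sq.
  exact: L2_integrable_cst.
Qed.

Lemma L2_integrable_quad1 t (c0 c1 c2 : R) :
  nu.-integrable setT (fun x => (c0 + c1 * f t x + c2 * f t x ^+ 2)%:E) /\
  (\int[nu]_x (c0 + c1 * f t x + c2 * f t x ^+ 2)%:E =
   (c0 * fine (nu setT) + c1 * \int[nu]_x f t x + c2 * \int[nu]_x f t x ^+ 2)%:E)%E.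
Proof.
have i0 := L2_integrable_cst c0.
have i1 : nu.-integrable setT (fun x => (c1 * f t x)%:E).
  by under eq_fun do rewrite EFinM; exact: integrableZl (L2_integrable t).
have i2 : nu.-integrable setT (fun x => (c2 * f t x ^+ 2)%:E).
  by under eq_fun do rewrite EFinM; exact: integrableZl (L2_integrable_sq t).
have i01 : nu.-integrable setT (fun x => (c0 + c1 * f t x)%:E).
  by under eq_fun do rewrite EFinD; exact: integrableD.
split; first by under eq_fun do rewrite EFinD; exact: integrableD.
under eq_integral do rewrite EFinD.
rewrite integralD_EFin//.
have -> : (\int[nu]_x (c0 + c1 * f t x)%:E =
    c0%:E * nu setT + \int[nu]_x (c1 * f t x)%:E)%E.
  under eq_integral do rewrite EFinD.
  by rewrite integralD_EFin// integral_cst.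
have -> : (\int[nu]_x (c1 * f t x)%:E = c1%:E * \int[nu]_x (f t x)%:E)%E.
  by under eq_integral do rewrite EFinM; rewrite integralZl//; exact: L2_integrable.
have -> : (\int[nu]_x (c2 * f t x ^+ 2)%:E = c2%:E * \int[nu]_x (f t x ^+ 2)%:E)%E.
  by under eq_integral do rewrite EFinM; rewrite integralZl//; exact: L2_integrable_sq.
have [nufin _ _] := nuf.
rewrite !EFinD !EFinM fineK ?ge0_fin_numE// /Rintegral !fineK//.
- by apply: integrable_fin_num => //; exact: L2_integrable_sq.
- by apply: integrable_fin_num => //; exact: L2_integrable.
Qed.

Lemma L2_integrable_quad (c0 c1 c2 : I -> R) :
  nu.-integrable setT
    (fun x => (\sum_t (c0 t + c1 t * f t x + c2 t * f t x ^+ 2))%:E).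
Proof.
under eq_fun do rewrite -sumEFin.
apply: integrable_sum => // t _.
by have [] := L2_integrable_quad1 t (c0 t) (c1 t) (c2 t).
Qed.

Lemma integral_quad (c0 c1 c2 : I -> R) :
  (\int[nu]_x (\sum_t (c0 t + c1 t * f t x + c2 t * f t x ^+ 2))%:E =
   (\sum_t (c0 t * fine (nu setT) + c1 t * \int[nu]_x f t x +
            c2 t * \int[nu]_x f t x ^+ 2))%:E)%E.
Proof.
under eq_integral do rewrite -sumEFin.
rewrite integral_sum//; last first.
  by move=> t; have [] := L2_integrable_quad1 t (c0 t) (c1 t) (c2 t).
rewrite -sumEFin; apply: eq_bigr => t _.
by have [_ ->] := L2_integrable_quad1 t (c0 t) (c1 t) (c2 t).
Qed.

End square_integrable_family.

(** * Converse *)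

Section quantization_converse.
Context {d} {T : measurableType d} {R : realType} {n : nat} {I : finType}.
Variables (P : probability T R) (f : 'I_n -> T -> R).
Variable nu : I -> {measure set T -> \bar R}.
Hypothesis Pf : gauss P f.
Hypothesis Pnu : forall A, measurable A -> P A = (\sum_i nu i A)%E.

Lemma part_measure_le i (g : T -> \bar R) : measurable_fun setT g ->
  (forall x, 0 <= g x)%E -> (\int[nu i]_x g x <= \int[P]_x g x)%E.
Proof.
move=> mg g0; rewrite (integral_fin_measure_sum Pnu)//.
rewrite (bigD1 i)//= leeDl// sume_ge0// => j _; exact: integral_ge0.
Qed.

Lemma part_L2 i : L2 (nu i) f.
Proof.
have [mf _] := Pf; split => // [|t].
  have := @part_measure_le i (cst 1%E); rewrite !integral_cst// !mul1e => H.
  apply: le_lt_trans (H _ _) _ => //.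
  by rewrite [X in (X < _)%E]probability_setT ltry.
apply: le_lt_trans (part_measure_le i _ _) _.
- by apply/measurable_EFinP; exact: measurable_funX.
- by move=> x; rewrite lee_fin sqr_ge0.
- by rewrite (gauss_sq Pf) ltry.
Qed.

Lemma sum_part_mass : \sum_i fine (nu i setT) = 1.
Proof.
apply: EFin_inj; rewrite -sumEFin -(probability_setT P) Pnu//.
apply: eq_bigr => i _; have [nuoo _ _] := part_L2 i.
by rewrite fineK// ge0_fin_numE.
Qed.

Lemma sum_part_sq t : \sum_i \int[nu i]_x f t x ^+ 2 = 1.
Proof.
have [mf _] := Pf.
apply: EFin_inj; rewrite -sumEFin -(gauss_sq Pf t).
rewrite (integral_fin_measure_sum Pnu); last 2 first.
- by apply/measurable_EFinP; exact: measurable_funX.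
- by move=> x; rewrite lee_fin sqr_ge0.
apply: eq_bigr => i _; rewrite /Rintegral fineK//.
by apply: integrable_fin_num => //; exact: L2_integrable_sq (part_L2 i) _.
Qed.

(** [integral_fin_measure_sum] covers nonnegative integrands only, so the signed [f t] is reached
    through (1 + f)^2, whose other two terms are known. *)
Lemma sum_part_mean t : \sum_i \int[nu i]_x f t x = 0.
Proof.
have [mf _] := Pf.
pose c0 (i : I) : R := fine (nu i setT); pose c1 (i : I) := \int[nu i]_x f t x.
pose c2 (i : I) := \int[nu i]_x f t x ^+ 2.
have E : (\int[P]_x ((1 + f t x) ^+ 2)%:E = (\sum_i (c0 i + 2 * c1 i + c2 i))%:E)%E.
  rewrite (integral_fin_measure_sum Pnu); last 2 first.
  - by apply/measurable_EFinP; apply: measurable_funX; exact: measurable_funD.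
  - by move=> x; rewrite lee_fin sqr_ge0.
  rewrite -sumEFin; apply: eq_bigr => i _.
  have [_] := L2_integrable_quad1 (part_L2 i) t 1 2 1; rewrite !mul1r => <-.
  by apply: eq_integral => x _; congr (_%:E); ring.
have PL2 : L2 P f.
  split => // [|s]; last by rewrite (gauss_sq Pf) ltry.
  by rewrite [X in (X < _)%E]probability_setT ltry.
have [_] := L2_integrable_quad1 PL2 t 1 2 1.
rewrite !mul1r [X in fine X]probability_setT (gauss_mean Pf) mulr0 addr0.
have -> : (\int[P]_x (1 + 2 * f t x + 1 * f t x ^+ 2)%:E =
    \int[P]_x ((1 + f t x) ^+ 2)%:E)%E.
  by apply: eq_integral => x _; congr (_%:E); ring.
rewrite E => -[]; rewrite !big_split/= -mulr_sumr.
have PS : \int[P]_x f t x ^+ 2 = 1 by rewrite /Rintegral (gauss_sq Pf).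
rewrite sum_part_mass sum_part_sq PS; lra.
Qed.

(* The Gibbs variational principle applied to the Gaussians N(c, D I) with
   c = E[f | i] and D = e^(-2r): only [1 + psi <= expR psi] is used. *)
Lemma quantization_converse (r : R) : #|I|%:R <= expR (n%:R * r) ->
  \sum_i (\sum_t (\int[nu i]_x f t x) ^+ 2) / fine (nu i setT) <=
  n%:R * (1 - expR (- (2 * r))).
Proof.
move=> Ir.
pose D := expR (- (2 * r)); have D0 : 0 < D by exact: expR_gt0.
pose p i := fine (nu i setT).
pose F i t := \int[nu i]_x f t x.
pose c i t := F i t / p i.
pose a : R := (1 - D^-1) / 2.
have a2 : a < 2^-1 by have : 0 < D^-1 by [rewrite invr_gt0]; rewrite /a; lra.
(* Up to the additive constant n r, this is the log-density of N(c i, D I) relative to N(0, I).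
   Without that constant the exponential has mean D^(n/2) = exp (- n r). *)
pose psi i x := \sum_t (- (c i t ^+ 2 / (2 * D)) + c i t / D * f t x + a * f t x ^+ 2).
have [mf mgf] := Pf.
have mpsi i : measurable_fun setT (psi i).
  apply: measurable_sum => t; apply: measurable_funD; last first.
    by apply: measurable_funM => //; exact: measurable_funX.
  by apply: measurable_funD => //; exact: measurable_funM.
have exp_psi i : (\int[P]_x (expR (psi i x))%:E = (expR (- (n%:R * r)))%:E)%E.
  transitivity (\int[P]_x ((expR (\sum_t - (c i t ^+ 2 / (2 * D))))%:E *
     (expR (\sum_t (a * f t x ^+ 2 + c i t / D * f t x)))%:E))%E.
    apply: eq_integral => x _; rewrite -EFinM -expRD -big_split/=; congr (expR _)%:E.
    by apply: eq_bigr => t _; rewrite -addrA [c i t / D * _ + _]addrC.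
  rewrite ge0_integralZl_EFin ?expR_ge0//; last first.
    apply/measurable_EFinP; apply: measurableT_comp => //.
    apply: measurable_sum => t; apply: measurable_funD; apply: measurable_funM => //.
    exact: measurable_funX.
  rewrite (mgf (fun=> a) (fun t => c i t / D))// -EFinM expR_sum -big_split/=.
  rewrite [X in X%:E = _](_ : _ = \prod_(t < n) expR (- r)); last first.
    apply: eq_bigr => t _; rewrite /gmgf.
    have -> : 1 - 2 * a = D^-1 by rewrite /a; field; rewrite gt_eqF.
    rewrite sqrtrV ?ltW// invrK.
    have -> : Num.sqrt D = expR (- r).
      rewrite -[RHS]ger0_norm ?expR_ge0// -sqrtr_sqr expr2 -expRD; congr Num.sqrt.
      by rewrite /D; congr expR; ring.
    rewrite mulrA -expRD -[RHS]mul1r; congr (_ * _).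
    rewrite -[RHS]expR0; congr expR; field; exact: lt0r_neq0.
  by rewrite prodr_const card_ord -expRM_natl mulrN.
(* Integrate 1 + psi <= exp psi over the part [nu i], then enlarge the part to [P] on the right,
   where the mean of the exponential is known. *)
have key i : p i + \sum_t (- (c i t ^+ 2 / (2 * D)) * p i + c i t / D * F i t
     + a * \int[nu i]_x f t x ^+ 2) <= expR (- (n%:R * r)).
  rewrite -lee_fin EFinD -integral_quad; last exact: part_L2.
  have [nuoo _ _] := part_L2 i.
  have ipsi : (nu i).-integrable setT (fun x => (psi i x)%:E).
    exact: L2_integrable_quad (part_L2 i) _ _ _.
  have i1 := L2_integrable_cst (part_L2 i) 1.
  rewrite /p fineK ?ge0_fin_numE//.
  have -> : (nu i setT = \int[nu i]_x (1:R)%:E)%E by rewrite integral_cst// mul1e.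
  rewrite -integralD_EFin//.
  apply: (@le_trans _ _ (\int[nu i]_x (expR (psi i x))%:E)%E); last first.
    rewrite -(exp_psi i); apply: part_measure_le.
      by apply/measurable_EFinP; exact: measurableT_comp.
    by move=> x; rewrite lee_fin expR_ge0.
  apply: le_integral => //.
  - by under eq_fun do rewrite -EFinD EFinD; exact: integrableD.
  - apply/integrableP; split.
      by apply/measurable_EFinP; exact: measurableT_comp.
    under eq_integral do rewrite gee0_abs ?lee_fin ?expR_ge0//.
    apply: (@le_lt_trans _ _ (\int[P]_x (expR (psi i x))%:E)%E); last by rewrite exp_psi ltry.
    apply: part_measure_le; first by apply/measurable_EFinP; exact: measurableT_comp.
    by move=> x; rewrite lee_fin expR_ge0.
  - by move=> x _; rewrite -EFinD lee_fin expR_ge1Dx.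
have : \sum_i (p i + \sum_t (- (c i t ^+ 2 / (2 * D)) * p i + c i t / D * F i t
     + a * \int[nu i]_x f t x ^+ 2)) <= \sum_(i : I) expR (- (n%:R * r)).
  by apply: ler_sum => i _; exact: key.
rewrite sumr_const -[X in _ <= X]mulr_natl big_split/= sum_part_mass.
(* The number of messages enters here only. The bound 1 cancels the total mass of the parts, so the
   integrals of the [psi i] sum to at most 0. *)
have N1 : #|I|%:R * expR (- (n%:R * r)) <= 1.
  by rewrite expRN ler_pdivrMr ?expR_gt0// mul1r.
move=> /le_trans /(_ N1).
have -> : \sum_i \sum_t (- (c i t ^+ 2 / (2 * D)) * p i + c i t / D * F i t
     + a * \int[nu i]_x f t x ^+ 2) =
   (2 * D)^-1 * (\sum_i (\sum_t F i t ^+ 2) / p i) + a * n%:R.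
  have -> : n%:R = \sum_(t < n) \sum_i \int[nu i]_x f t x ^+ 2.
    under eq_bigr do rewrite sum_part_sq.
    by rewrite sumr_const card_ord.
  rewrite [X in _ + a * X]exchange_big/= !mulr_sumr -big_split/=; apply: eq_bigr => i _.
  rewrite mulr_suml !mulr_sumr -big_split/=; apply: eq_bigr => t _.
  (* For a message of mass zero, division by zero gives zero and both sides vanish. *)
  congr (_ + _); rewrite /c; have [->|p0] := eqVneq (p i) 0.
    by rewrite invr0 !mulr0 !mul0r addr0.
  by field; rewrite p0 gt_eqF.
move: (\sum_i _ / _) => V.
have : (2 * D)^-1 * (2 * D) = 1 by rewrite mulVf// gt_eqF// mulr_gt0.
have : D^-1 * D = 1 by rewrite mulVf// gt_eqF.
have : 0 < D^-1 by rewrite invr_gt0.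
rewrite /a invfM -/D; move: (D^-1) => E E0 ED _ H.
have : D * (2^-1 * E * V + (1 - E) / 2 * n%:R) <= 0 by rewrite pmulr_rle0//; lra.
have -> : D * (2^-1 * E * V + (1 - E) / 2 * n%:R) = (E * D) * V / 2 + (D - E * D) / 2 * n%:R.
  by ring.
rewrite ED; lra.
Qed.

End quantization_converse.

(** * Distortion of a code through conditional means *)

Lemma fin_measure_sum_exists d (T : measurableType d) (R : realType) (I : finType)
    (nu : I -> {measure set T -> \bar R}) :
  exists mu : {measure set T -> \bar R}, forall A, mu A = (\sum_i nu i A)%E.
Proof.
pose m (k : nat) : {measure set T -> \bar R} :=
  if insub k is Some i then nu (@enum_val I predT i) else mzero.
exists (msum m #|I|) => A; rewrite /msum/= big_enum_val/=.
by apply: eq_bigr => i _; rewrite /m valK.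
Qed.

Section mscale_integral.
Context {d} {T : measurableType d} {R : realType}.
Variables (D : {measure set T -> \bar R}) (q : {nonneg R}).

Lemma integral_mscale (g : T -> R) : D.-integrable setT (EFin \o g) ->
  (\int[mscale q D]_x (g x)%:E = q%:num%:E * \int[D]_x (g x)%:E)%E.
Proof.
move=> ig; have mg := measurable_int _ ig.
rewrite [LHS]integralE ge0_integral_mscale//; last exact: measurable_funepos.
rewrite ge0_integral_mscale//; last exact: measurable_funeneg.
have E := integralE D setT (EFin \o g).
transitivity (q%:num%:E * (\int[D]_x (EFin \o g)^\+ x - \int[D]_x (EFin \o g)^\- x))%E.
  apply/esym; apply: muleBr => //; exact: (integrable_add_def _ ig).
by rewrite -E.
Qed.

End mscale_integral.

Section distortion_term.
Context {d1} {T1 : measurableType d1} {d2} {T2 : measurableType d2}.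
Context {R : realType} {n : nat}.
Variables (P : {measure set T1 -> \bar R}) (w : T1 -> R).
Variables (mw : measurable_fun setT w) (w0 : forall x, 0 <= w x).
Variables (D : probability T2 R) (f : 'I_n -> T1 -> R) (g : 'I_n -> T2 -> R).
Variables (K : nat) (q : {nonneg R}).
Local Notation nuX := (density_measure P mw w0).
Local Notation nuY := (mscale q D).
Hypotheses (nuXf : L2 nuX f) (nuYg : L2 nuY g) (K0 : (0 < K)%N).
Hypothesis qE : q%:num = fine (nuX setT) / K%:R.

Let sqdist (a b c : R) (z : T1 * T2) : R :=
  n%:R^-1 * \sum_t (a * f t z.1 + c - b * g t z.2) ^+ 2.

(** The contribution of a single pair of seed and letter. The double integral is over a product
    measure, so the cross term is a product of means; the output mean carries the weight [q], and
    restoring it leaves the division by the source mass. *)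
Lemma distortion_term (a b c : R) :
  ((K%:R^-1)%:E * \int[P]_x ((w x)%:E * \int[D]_y (sqdist a b c (x, y))%:E) =
   (n%:R^-1 * \sum_t (c ^+ 2 * q%:num - 2 * b * c * \int[nuY]_y g t y
      + b ^+ 2 * \int[nuY]_y g t y ^+ 2
      + (2 * a * c * \int[nuX]_x f t x + a ^+ 2 * \int[nuX]_x f t x ^+ 2) / K%:R
      - 2 * a * b * (\int[nuX]_x f t x * \int[nuY]_y g t y / fine (nuX setT))))%:E)%E.
Proof.
have [_ mf _] := nuXf; have [_ mg _] := nuYg.
have sq0 z : 0 <= sqdist a b c z.
  by rewrite mulr_ge0 ?invr_ge0// sumr_ge0// => t _; exact: sqr_ge0.
have msq : measurable_fun setT (fun z => (sqdist a b c z)%:E).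
  apply/measurable_EFinP; apply: measurable_funM => //.
  apply: measurable_sum => t; apply: measurable_funX; apply: measurable_funB.
    apply: measurable_funD => //; apply: measurable_funM => //.
    exact: measurableT_comp.
  apply: measurable_funM => //; exact: measurableT_comp.
pose inner x := (\int[D]_y (sqdist a b c (x, y))%:E)%E.
have minner : measurable_fun setT inner.
  by apply: (@measurable_fun_fubini_tonelli_F _ _ T1 T2 R D (fun z => (sqdist a b c z)%:E)) => // z; rewrite lee_fin.
have inner0 x : (0 <= inner x)%E by apply: integral_ge0 => y _; rewrite lee_fin.
have -> : (\int[P]_x ((w x)%:E * \int[D]_y (sqdist a b c (x, y))%:E) =
    \int[nuX]_x inner x)%E.
  rewrite integral_density//; apply: eq_integral => x _.
  by rewrite muleC.
have Kn0 : K%:R != 0 :> R by rewrite pnatr_eq0 -lt0n.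
(* If the message has mass zero, [nuYg] says nothing about [D] and the inner integral may be
   infinite, but it is integrated against a null measure. Otherwise square integrability passes from
   [nuY] to [D] by dividing by [q > 0]. *)
have [p0|p0] := eqVneq (fine (nuX setT)) 0.
  have nuX0 : nuX setT = 0%E.
    have [nuXoo _ _] := nuXf.
    by rewrite -[LHS]fineK ?p0// ge0_fin_numE.
  have q0 : q%:num = 0 by rewrite qE p0 mul0r.
  have X0 (h : T1 -> R) : measurable_fun setT h -> \int[nuX]_x h x = 0.
    move=> mh; rewrite /Rintegral null_set_integral//.
    exact/measurable_EFinP.
  have Y0 (h : T2 -> R) : measurable_fun setT h -> \int[nuY]_x h x = 0.
    move=> mh; rewrite /Rintegral null_set_integral//; first exact/measurable_EFinP.
    by change (q%:num%:E * D setT = 0)%E; rewrite q0 mul0e.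
  rewrite null_set_integral// mule0 big1 ?mulr0// => t _.
  rewrite q0 !X0// ?Y0//; try exact: measurable_funX.
  by rewrite !(mulr0, mul0r, addr0, subr0).
have q0 : 0 < q%:num.
  have [nuXoo _ _] := nuXf.
  by rewrite qE divr_gt0// ?ltr0n// lt_neqAle eq_sym p0 fine_ge0.
have DL2 : L2 D g.
  split => // [|t]; first by rewrite [X in (X < _)%E]probability_setT ltry.
  have [_ _ /(_ t)] := nuYg; rewrite ge0_integral_mscale//; last 2 first.
  - by apply/measurable_EFinP; exact: measurable_funX.
  - by move=> x _; rewrite lee_fin sqr_ge0.
  case: (\int[D]_x (g t x ^+ 2)%:E)%E => [r _| |_]//; first exact: ltry.
  by rewrite gt0_muley ?lte_fin.
have Y1 t : \int[nuY]_y g t y = q%:num * \int[D]_y g t y.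
  have ig := L2_integrable DL2 t.
  by rewrite /Rintegral integral_mscale// fineM//; apply: integrable_fin_num.
have Y2 t : \int[nuY]_y g t y ^+ 2 = q%:num * \int[D]_y g t y ^+ 2.
  have ig := L2_integrable_sq DL2 t.
  rewrite /Rintegral (@integral_mscale _ _ _ _ _ (fun y => g t y ^+ 2))// fineM//.
  by apply: integrable_fin_num.
pose G1 t := \int[D]_y g t y; pose G2 t := \int[D]_y g t y ^+ 2.
have innerE x : inner x = (\sum_t
     (n%:R^-1 * (c ^+ 2 - 2 * b * c * G1 t + b ^+ 2 * G2 t) +
      n%:R^-1 * (2 * a * c - 2 * a * b * G1 t) * f t x +
      n%:R^-1 * a ^+ 2 * f t x ^+ 2))%:E.
  transitivity (\int[D]_y (\sum_t (n%:R^-1 * (a * f t x + c) ^+ 2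
      + (n%:R^-1 * - (2 * b * (a * f t x + c))) * g t y
      + (n%:R^-1 * b ^+ 2) * g t y ^+ 2))%:E)%E.
    apply: eq_integral => y _; rewrite /sqdist mulr_sumr; congr (_%:E).
    by apply: eq_bigr => t _ /=; ring.
  rewrite integral_quad//; congr (_%:E); apply: eq_bigr => t _.
  rewrite -/(G1 t) -/(G2 t) [X in fine X]probability_setT/=; ring.
under eq_integral do rewrite innerE.
rewrite integral_quad// -EFinM; congr (_%:E).
rewrite !mulr_sumr; apply: eq_bigr => t _.
rewrite Y1 Y2 -/(G1 t) -/(G2 t) qE.
move: (fine _) p0 (\int[nuX]_x f t x) (\int[nuX]_x f t x ^+ 2) => p p0 F1 F2.
move: n%:R^-1 => N.
by field; rewrite p0 Kn0.
Qed.

End distortion_term.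

(** Cauchy-Schwarz by the discriminant: the weighted sum of squares of u - l v is nonnegative for
    every l. Null weights do no harm, division by zero being zero in all three sums. *)
Lemma sum_div_mul_le (R : realType) (I : finType) (u v p : I -> R) (A B : R) :
  (forall i, 0 <= p i) ->
  \sum_i u i ^+ 2 / p i <= A -> \sum_i v i ^+ 2 / p i <= B ->
  \sum_i u i * v i / p i <= Num.sqrt (A * B).
Proof.
move=> p0 HA HB.
set S := \sum_i _ * _ / _.
have sqp0 (w : I -> R) : 0 <= \sum_i w i ^+ 2 / p i.
  by apply: sumr_ge0 => i _; rewrite divr_ge0// sqr_ge0.
have A0 : 0 <= A by apply: le_trans HA.
have B0 : 0 <= B by apply: le_trans HB.
have key (l : R) : 0 <= B * l ^+ 2 - 2 * S * l + A.
  apply: (@le_trans _ _ (\sum_i (u i - l * v i) ^+ 2 / p i)); first exact: sqp0.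
  have -> : \sum_i (u i - l * v i) ^+ 2 / p i =
      (\sum_i v i ^+ 2 / p i) * l ^+ 2 - 2 * S * l + \sum_i u i ^+ 2 / p i.
    rewrite /S mulr_sumr !mulr_suml -sumrB -big_split/=; apply: eq_bigr => i _.
    by ring.
  by rewrite lerD// lerD2r ler_wpM2r// sqr_ge0.
have [S0|S0] := leP S 0; first by rewrite (le_trans S0)// sqrtr_ge0.
rewrite -[leLHS]ger0_norm ?(ltW S0)// -sqrtr_sqr ler_wsqrtr//.
(* The quadratic in l degenerates to an affine function, which is negative at l = (A + 1) / S when S
   > 0. *)
have [B00|B00] := eqVneq B 0.
  by have := key ((A + 1) / S); rewrite B00 mul0r add0r mulrAC -mulrA divfK ?gt_eqF//; lra.
have Bp : 0 < B by rewrite lt_neqAle eq_sym B00.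
have := key (S / B).
have -> : B * (S / B) ^+ 2 - 2 * S * (S / B) + A = (A * B - S ^+ 2) / B by field.
by rewrite pmulr_lge0 ?invr_gt0// subr_ge0.
Qed.

Section code.
Context {R : realType} {n : nat} {J K : finType}.
Variables (muX muXh sX sXh : R) (PX : probability (n.-tuple R) R).
Variables (e : n.-tuple R -> K -> J -> R) (dec : J -> K -> probability (n.-tuple R) R).
Hypotheses (sX0 : 0 < sX) (sXh0 : 0 < sXh) (n0 : (0 < n)%N) (K0 : (0 < #|K|)%N).
Hypothesis e0 : forall x k j, 0 <= e x k j.
Hypothesis e1 : forall x k, \sum_(j : J) e x k j = 1.
Hypothesis me : forall k j, measurable_fun [set: n.-tuple R] (fun x => e x k j).
Hypothesis PXn : iid_law PX (normal_prob muX sX).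
Hypothesis out : iid_law (code_output_law PX e dec) (normal_prob muXh sXh).

Definition std_coord (m s : R) (t : 'I_n) (x : n.-tuple R) : R := (tnth x t - m) / s.

Definition source_part (k : K) (j : J) : {measure set (n.-tuple R) -> \bar R} :=
  density_measure PX (me k j) (fun x => e0 x k j).

Definition letter_prob k j : R := fine (source_part k j setT).

Lemma letter_weight_ge0 (k : K) (j : J) : 0 <= letter_prob k j / #|K|%:R.
Proof. by rewrite divr_ge0// fine_ge0. Qed.

(** The joint law of message and output, averaged over the uniform seed. By contrast,
    [source_part k] is conditional on the seed and has total mass 1 for each [k]. *)
Definition output_part (m : K * J) : {measure set (n.-tuple R) -> \bar R} :=
  mscale (NngNum (letter_weight_ge0 m.1 m.2)) (dec m.2 m.1).

Local Notation f := (std_coord muX sX).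
Local Notation g := (std_coord muXh sXh).

Let gaussX : gauss PX f.
Proof. exact: iid_normal_gauss. Qed.

Lemma source_partE k A : measurable A -> PX A = (\sum_j source_part k j A)%E.
Proof.
move=> mA; rewrite /= /density_measure.
rewrite -ge0_integral_sum//; last 2 first.
- by move=> j; apply/measurable_EFinP; exact: measurable_funTS.
- by move=> j x _; rewrite lee_fin.
under eq_integral do rewrite sumEFin e1.
by rewrite integral_cst// mul1e.
Qed.

Let L2X k j : L2 (source_part k j) f.
Proof. exact: part_L2 gaussX (@source_partE k) j. Qed.

Lemma letter_probE k j : (\int[PX]_x (e x k j)%:E = (letter_prob k j)%:E)%E.
Proof.
by have [oo _ _] := L2X k j; rewrite /letter_prob fineK ?ge0_fin_numE.
Qed.

(** The output constraint is given on boxes; as the sum of the output parts is itself a measure, it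
    extends to all measurable sets. *)
Lemma output_partE : exists Q : probability (n.-tuple R) R,
  gauss Q g /\ forall A, measurable A -> Q A = (\sum_m output_part m A)%E.
Proof.
have [Q QP] := @integral_prod_law_exists _ _ _ (normal_law muXh sXh) n.
have QB := integral_prod_law_box QP.
have [mu muE] := fin_measure_sum_exists output_part.
exists Q; split; first by apply: iid_normal_gauss => // B mB; exact: QB.
move=> A mA; rewrite -muE; apply: tuple_measure_unique => //; last first.
  by rewrite [X in (X < _)%E]probability_setT ltry.
move=> B mB; rewrite QB// muE.
have /= <- := out mB.
rewrite /code_output_law pair_big/=; apply: eq_bigr => -[k j] _ /=.
rewrite /mscale/= letter_probE -EFinM; congr (_%:E * _)%E.
by rewrite mulrC.
Qed.

Let L2Y m : L2 (output_part m) g.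
Proof. by have [Q [gQ QE]] := output_partE; exact: part_L2 gQ QE m. Qed.

Definition source_mean k j t := \int[source_part k j]_x f t x.
Definition output_mean k j t := \int[output_part (k, j)]_x g t x.

(* [output_mean] is an integral against a measure of mass [letter_prob / #|K|],
   which accounts for the averaging over the seed. *)
Definition code_corr : R := n%:R^-1 *
  \sum_(m : K * J) \sum_t source_mean m.1 m.2 t * output_mean m.1 m.2 t / letter_prob m.1 m.2.

(** Source and output blocks both have standardized coordinates of mean 0 and second moment 1,
    whatever the code, so that only the cross term depends on it. *)
Lemma code_distortionE : code_distortion sq_err PX e dec =
  ((muX - muXh) ^+ 2 + sX ^+ 2 + sXh ^+ 2 - 2 * sX * sXh * code_corr)%:E.
Proof.
have Kn0 : #|K|%:R != 0 :> R by rewrite pnatr_eq0 -lt0n.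
have nn0 : n%:R != 0 :> R by rewrite pnatr_eq0 -lt0n.
set c := muX - muXh.
pose q (m : K * J) := letter_prob m.1 m.2 / #|K|%:R.
pose F1 (m : K * J) t := source_mean m.1 m.2 t.
pose F2 (m : K * J) t := \int[source_part m.1 m.2]_x f t x ^+ 2.
pose H1 (m : K * J) t := output_mean m.1 m.2 t.
pose H2 (m : K * J) t := \int[output_part m]_x g t x ^+ 2.
transitivity ((\sum_(m : K * J) n%:R^-1 * \sum_t (c ^+ 2 * q m - 2 * sXh * c * H1 m t
  + sXh ^+ 2 * H2 m t + (2 * sX * c * F1 m t + sX ^+ 2 * F2 m t) / #|K|%:R
  - 2 * sX * sXh * (F1 m t * H1 m t / letter_prob m.1 m.2)))%:E).
  rewrite -sumEFin /code_distortion pair_big/=; apply: eq_bigr => -[k j] _ /=.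
  rewrite -(@distortion_term _ _ _ _ _ _ PX _ (me k j) (fun x => e0 x k j) (dec j k)
     f g #|K| (NngNum (letter_weight_ge0 k j)) (L2X k j) (L2Y (k, j)) K0 erefl sX sXh c).
  congr (_ * _)%E; apply: eq_integral => x _; congr (_ * _)%E.
  apply: eq_integral => y _; congr (_ * _)%:E; apply: eq_bigr => t _ /=.
  rewrite /sq_err /std_coord mulrCA divff ?gt_eqF// mulr1 mulrCA divff ?gt_eqF// mulr1.
  by congr (_ ^+ 2); rewrite /c; ring.
congr (_%:E).
have sumX k := sum_part_mass gaussX (@source_partE k).
have sumF1 t : \sum_m F1 m t = 0.
  rewrite -(pair_bigA _ (fun k j => F1 (k, j) t))/= big1// => k _.
  exact: sum_part_mean gaussX (@source_partE k) t.
have sumF2 t : \sum_m F2 m t = #|K|%:R.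
  rewrite -(pair_bigA _ (fun k j => F2 (k, j) t))/=.
  rewrite (eq_bigr (fun=> 1)); first by rewrite sumr_const.
  by move=> k _; exact: sum_part_sq gaussX (@source_partE k) t.
have sumq : \sum_m q m = 1.
  rewrite -(pair_bigA _ (fun k j => q (k, j)))/=.
  rewrite (eq_bigr (fun=> #|K|%:R^-1)).
    by rewrite sumr_const -[LHS]mulr_natl divff.
  by move=> k _; rewrite -mulr_suml [X in X / _](sumX k) div1r.
have [Q [gQ QE]] := output_partE.
have sumH1 t : \sum_m H1 m t = 0.
  by rewrite -[RHS](sum_part_mean gQ QE t); apply: eq_bigr => -[].
have sumH2 t : \sum_m H2 m t = 1 by exact: sum_part_sq gQ QE t.
rewrite -mulr_sumr exchange_big/= /code_corr [in RHS]exchange_big/=.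
rewrite [X in n%:R^-1 * X = _](_ : _ = \sum_(t < n) (c ^+ 2 + sX ^+ 2 + sXh ^+ 2 -
   2 * sX * sXh * \sum_m F1 m t * H1 m t / letter_prob m.1 m.2)); last first.
  apply: eq_bigr => t _.
  rewrite sumrB -mulr_sumr; congr (_ - _).
  rewrite !big_split/= -!mulr_sumr sumq sumrN -mulr_sumr sumH1 sumH2.
  rewrite -mulr_suml big_split/= -!mulr_sumr sumF1 sumF2.
  by field.
rewrite sumrB sumr_const card_ord -mulr_sumr mulrBr -[(_ + sXh ^+ 2) *+ n]mulr_natl mulKf//.
by congr (_ - _); ring.
Qed.

(** For each seed the letter alone partitions the source law, so the alphabet [J] governs; summing
    over seeds gives the factor [#|K|]. *)
Lemma source_mean_bound (r : R) : #|J|%:R <= expR (n%:R * r) ->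
  \sum_(m : K * J) (\sum_t source_mean m.1 m.2 t ^+ 2) / letter_prob m.1 m.2 <=
  #|K|%:R * (n%:R * (1 - expR (- (2 * r)))).
Proof.
move=> Jr.
rewrite -(pair_bigA _ (fun k j => (\sum_t source_mean k j t ^+ 2) / letter_prob k j))/=.
rewrite [leRHS]mulr_natl -sumr_const; apply: ler_sum => k _.
exact: quantization_converse gaussX (@source_partE k) _ Jr.
Qed.

(** The output law is partitioned by pairs. The factor [#|K|%:R^-1] appears because the division is
    by [letter_prob], which is [#|K|] times the mass of the output part. *)
Lemma output_mean_bound (r : R) : (#|K| * #|J|)%:R <= expR (n%:R * r) ->
  \sum_(m : K * J) (\sum_t output_mean m.1 m.2 t ^+ 2) / letter_prob m.1 m.2 <=
  #|K|%:R^-1 * (n%:R * (1 - expR (- (2 * r)))).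
Proof.
move=> KJr; have [Q [gQ QE]] := output_partE.
have Kp : 0 < #|K|%:R :> R by rewrite ltr0n.
rewrite ler_pdivlMl//.
apply: le_trans (quantization_converse gQ QE (r := r) _); last by rewrite card_prod.
rewrite mulr_sumr; apply: ler_sum => -[k j] _ /=.
rewrite [X in fine X](_ : _ = (letter_prob k j / #|K|%:R)%:E); last first.
  by rewrite /mscale/= [X in (_ * X)%E]probability_setT mule1.
by rewrite /= invf_div mulrCA mulrA mulrC mulrA.
Qed.

(** One Cauchy-Schwarz over pairs of message and coordinate; the factors [#|K|] and [#|K|%:R^-1] of
    the two bounds cancel. *)
Lemma code_corr_le (Rt Rc : R) :
  n%:R^-1 * ln #|J|%:R <= Rt -> n%:R^-1 * ln #|K|%:R <= Rc ->
  code_corr <= xi Rt Rc.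
Proof.
move=> HJ HK.
have np : 0 < n%:R :> R by rewrite ltr0n.
have Kp : 0 < #|K|%:R :> R by rewrite ltr0n.
(* An empty [J] is excluded by the rows of the encoder, which sum to 1, and not by the rate bound,
   [ln 0] being 0. *)
have Jp : 0 < #|J|%:R :> R.
  rewrite ltr0n lt0n; apply/eqP => J0.
  have /card_gt0P[k _] := K0.
  have := e1 [tuple of nseq n (0:R)] k; rewrite big1 => [/eqP|j _].
    by rewrite eq_sym oner_eq0.
  by have := card0_eq J0 j.
have J1 : #|J|%:R <= expR (n%:R * Rt).
  by rewrite -[leLHS]lnK// ler_expR -ler_pdivrMl.
have K1 : #|K|%:R <= expR (n%:R * Rc).
  by rewrite -[leLHS]lnK// ler_expR -ler_pdivrMl.
have KJ1 : (#|K| * #|J|)%:R <= expR (n%:R * (Rt + Rc)).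
  by rewrite natrM mulrDr addrC expRD ler_pM// ltW.
have HX := source_mean_bound J1.
have HY := output_mean_bound KJ1.
rewrite /code_corr ler_pdivrMl//.
have split2 (u : K -> J -> 'I_n -> R) :
    \sum_(m : K * J) (\sum_t u m.1 m.2 t) / letter_prob m.1 m.2 =
    \sum_(i : (K * J) * 'I_n) u i.1.1 i.1.2 i.2 / letter_prob i.1.1 i.1.2.
  rewrite -(pair_bigA _ (fun m t => u m.1 m.2 t / letter_prob m.1 m.2))/=.
  by apply: eq_bigr => m _; rewrite mulr_suml.
rewrite (split2 (fun k j t => source_mean k j t ^+ 2)) in HX.
rewrite (split2 (fun k j t => output_mean k j t ^+ 2)) in HY.
have -> : \sum_(m : K * J) \sum_t source_mean m.1 m.2 t * output_mean m.1 m.2 t / letter_prob m.1 m.2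
   = \sum_(m : K * J) (\sum_t source_mean m.1 m.2 t * output_mean m.1 m.2 t) / letter_prob m.1 m.2.
  by apply: eq_bigr => m _; rewrite mulr_suml.
rewrite (split2 (fun k j t => source_mean k j t * output_mean k j t)).
apply: le_trans (sum_div_mul_le _ HX HY) _.
  by move=> i; exact: fine_ge0.
rewrite [X in Num.sqrt X](_ : _ = n%:R ^+ 2 *
  ((1 - expR (- (2 * Rt))) * (1 - expR (- (2 * (Rt + Rc)))))); last first.
  by field; rewrite gt_eqF.
by rewrite sqrtrM ?sqr_ge0// sqrtr_sqr ger0_norm// ltW.
Qed.

End code.

(** * Soft covering by Gaussian codebooks *)

Lemma expR_half_ln (R : realType) (x : R) : 0 < x -> expR (ln x / 2) = Num.sqrt x.
Proof.
move=> x0; rewrite -[LHS]ger0_norm ?expR_ge0// -sqrtr_sqr; congr Num.sqrt.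
by rewrite expr2 -expRD -[RHS]lnK//; congr expR; field.
Qed.

Section mehler.
Context {R : realType}.
Implicit Types rho : R.

(** The logarithm of the Mehler kernel: the density of a pair of standard normals with correlation
    [rho], relative to independent ones. *)
Definition mexp rho (a b : R) : R :=
  - ln (1 - rho ^+ 2) / 2 +
  (2 * rho * a * b - rho ^+ 2 * (a ^+ 2 + b ^+ 2)) / (2 * (1 - rho ^+ 2)).

(* The density of N(rho u, (1 - rho^2) I) with respect to N(0, I) at x; it is
   symmetric in u and x. *)
Definition mehler n rho (u x : 'I_n -> R) : R := expR (\sum_t mexp rho (u t) (x t)).

Lemma mexpC rho a b : mexp rho a b = mexp rho b a.
Proof. by rewrite /mexp; congr (_ + _ / _); ring. Qed.

Lemma mehlerC n rho (u x : 'I_n -> R) : mehler rho u x = mehler rho x u.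
Proof. by rewrite /mehler; congr expR; apply: eq_bigr => t _; rewrite mexpC. Qed.

Lemma mehler_ge0 n rho (u x : 'I_n -> R) : 0 <= mehler rho u x.
Proof. exact: expR_ge0. Qed.

Lemma measurable_mexp d (T : measurableType d) rho (a b : T -> R) :
  measurable_fun setT a -> measurable_fun setT b ->
  measurable_fun setT (fun z => mexp rho (a z) (b z)).
Proof.
move=> ma mb; apply: measurable_funD => //; apply: measurable_funM => //.
apply: measurable_funB.
  by apply: measurable_funM => //; exact: measurable_funM.
apply: measurable_funM => //.
by apply: measurable_funD; exact: measurable_funX.
Qed.

Lemma measurable_mehler d (T : measurableType d) n rho (a b : 'I_n -> T -> R) :
  (forall t, measurable_fun setT (a t)) -> (forall t, measurable_fun setT (b t)) ->
  measurable_fun setT (fun z => mehler rho (a ^~ z) (b ^~ z)).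
Proof.
move=> ma mb; apply: measurableT_comp => //; apply: measurable_sum => t.
exact: measurable_mexp.
Qed.

End mehler.

Section mehler_integrals.
Context {d} {T : measurableType d} {R : realType} {n : nat}.
Variables (P : probability T R) (f : 'I_n -> T -> R).
Hypothesis Pf : gauss P f.
Variable rho : R.
Hypothesis rho1 : rho ^+ 2 < 1.

Let mf i : measurable_fun setT (f i). Proof. by case: Pf. Qed.

Lemma gauss_expR_quad (a b c : 'I_n -> R) : (forall i, a i < 2^-1) ->
  (\int[P]_x (expR (\sum_i (c i + b i * f i x + a i * f i x ^+ 2)))%:E =
   (\prod_i (expR (c i) * gmgf (a i) (b i)))%:E)%E.
Proof.
move=> a2; have [_ mgf] := Pf.
rewrite big_split/= EFinM -mgf// -expR_sum -ge0_integralZl_EFin ?expR_ge0//; last first.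
  apply/measurable_EFinP; apply: measurableT_comp => //; apply: measurable_sum => t.
  by apply: measurable_funD; apply: measurable_funM => //; exact: measurable_funX.
apply: eq_integral => x _; rewrite -EFinM -expRD -big_split/=; congr (expR _)%:E.
by apply: eq_bigr => t _; rewrite -addrA [b t * _ + _]addrC.
Qed.

Let v0 : 0 < 1 - rho ^+ 2. Proof. by rewrite subr_gt0. Qed.

Let sqrt_expR_ln : expR (- ln (1 - rho ^+ 2) / 2) = (Num.sqrt (1 - rho ^+ 2))^-1.
Proof.
by rewrite mulNr expRN expR_half_ln.
Qed.

Lemma mehler_integral (u : 'I_n -> R) :
  (\int[P]_x (mehler rho u (f ^~ x))%:E = 1)%E.
Proof.
have vn0 : 1 - rho ^+ 2 != 0 by exact: lt0r_neq0.
pose A : R := - rho ^+ 2 / (2 * (1 - rho ^+ 2)).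
pose B : R := rho / (1 - rho ^+ 2).
have A2 : A < 2^-1.
  have : A <= 0; last by lra.
  by rewrite /A mulNr oppr_le0 divr_ge0 ?sqr_ge0// mulr_ge0// ltW.
have H := @gauss_expR_quad (fun=> A) (fun t => B * u t)
  (fun t => - ln (1 - rho ^+ 2) / 2 + A * u t ^+ 2).
transitivity (\int[P]_x (expR (\sum_i
   (- ln (1 - rho ^+ 2) / 2 + A * u i ^+ 2 + B * u i * f i x + A * f i x ^+ 2)))%:E)%E.
  apply: eq_integral => x _; congr (expR _)%:E; apply: eq_bigr => t _.
  rewrite /mexp /A /B; move: (ln _) => l; by field.
rewrite H//.
rewrite big1// => t _; rewrite expRD sqrt_expR_ln /gmgf.
have -> : 1 - 2 * A = (1 - rho ^+ 2)^-1 by rewrite /A; field.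
rewrite sqrtrV ?(ltW v0)// invrK.
set s := Num.sqrt _; have s0 : s != 0 by rewrite gt_eqF// sqrtr_gt0.
rewrite (mulrC (expR _) s) mulrACA mulVf// mul1r -expRD -[RHS]expR0; congr expR.
by rewrite /A /B; field.
Qed.

(** Under this density, coordinate [i] is normal with mean [rho * u i] and variance [1 - rho ^+ 2];
    the exponential moments of its squared deviation are those asked for by [sq_mgf_integral_le]. *)
Lemma mehler_sq_dist (u : 'I_n -> R) i :
  (\int[P]_x (mehler rho u (f ^~ x) * (f i x - rho * u i) ^+ 2)%:E <=
   (1 - rho ^+ 2)%:E)%E.
Proof.
have vn0 : 1 - rho ^+ 2 != 0 by exact: lt0r_neq0.
have mm : measurable_fun setT (fun x => mehler rho u (f ^~ x)).
  by apply: measurable_mehler => // t; exact: measurable_cst.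
have md : measurable_fun setT (fun x => (f i x - rho * u i) ^+ 2).
  by apply: measurable_funX; exact: measurable_funB.
pose nu := density_measure P mm (fun x => mehler_ge0 rho u (f ^~ x)).
rewrite (_ : (\int[P]_x _)%E = (\int[nu]_x ((f i x - rho * u i) ^+ 2)%:E)%E); last first.
  rewrite integral_density//.
  - by apply: eq_integral => x _; rewrite -EFinM mulrC.
  - exact/measurable_EFinP.
  - by move=> x; rewrite lee_fin sqr_ge0.
apply: sq_mgf_integral_le => //.
- exact: mehler_integral.
- by rewrite ltW//= gerBl sqr_ge0.
- by move=> x; exact: sqr_ge0.
move=> al /andP[al0 al4].
have -> : (\int[nu]_x (expR (al * (f i x - rho * u i) ^+ 2))%:E =
   \int[P]_x (mehler rho u (f ^~ x) * expR (al * (f i x - rho * u i) ^+ 2))%:E)%E.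
  rewrite integral_density//.
  - by apply: eq_integral => x _; rewrite -EFinM mulrC.
  - by apply/measurable_EFinP; apply: measurableT_comp => //; exact: measurable_funM.
(* The coefficients of the Mehler exponent, to which coordinate [i] adds the expansion of al (f_i -
   rho u_i)^2. *)
pose A t : R := - rho ^+ 2 / (2 * (1 - rho ^+ 2)) + (if t == i then al else 0).
pose B t : R := rho / (1 - rho ^+ 2) - (if t == i then 2 * al * rho else 0).
pose C t : R := - rho ^+ 2 / (2 * (1 - rho ^+ 2)) + (if t == i then al * rho ^+ 2 else 0).
have A2 t : A t < 2^-1.
  have : - rho ^+ 2 / (2 * (1 - rho ^+ 2)) <= 0.
    by rewrite mulNr oppr_le0 divr_ge0 ?sqr_ge0// mulr_ge0// ltW.
  by rewrite /A; case: ifP => _; lra.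
have H := @gauss_expR_quad A (fun t => B t * u t)
  (fun t => - ln (1 - rho ^+ 2) / 2 + C t * u t ^+ 2).
rewrite (_ : (\int[P]_x _)%E = (\int[P]_x (expR (\sum_i
   (- ln (1 - rho ^+ 2) / 2 + C i * u i ^+ 2 + B i * u i * f i x + A i * f i x ^+ 2)))%:E)%E); last first.
  apply: eq_integral => x _; rewrite -expRD; congr (expR _)%:E.
  rewrite (bigD1 i)//= [RHS](bigD1 i)//= addrAC; congr (_ + _).
    by rewrite /A /B /C eqxx /mexp; move: (ln _) => l; field.
  apply: eq_bigr => t /negPf ti; rewrite /A /B /C ti /mexp.
  by move: (ln _) => l; field.
rewrite H//.
have V2 : 0 < 1 - 2 * al * (1 - rho ^+ 2) by have := sqr_ge0 rho; nra.
rewrite lee_fin (bigD1 i)//= big1 ?mulr1.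
  rewrite expRD sqrt_expR_ln /gmgf.
  have -> : 1 - 2 * A i = (1 - 2 * al * (1 - rho ^+ 2)) / (1 - rho ^+ 2).
    by rewrite /A eqxx; field.
  rewrite sqrtrM ?(ltW V2)// sqrtrV ?(ltW v0)//.
  set s := Num.sqrt (1 - rho ^+ 2); have s0 : s != 0 by rewrite gt_eqF// sqrtr_gt0.
  set s' := Num.sqrt _; have s'0 : s' != 0 by rewrite gt_eqF// sqrtr_gt0.
  rewrite [X in X <= _](_ : _ = s'^-1 * (expR (C i * u i ^+ 2) *
      expR ((B i * u i) ^+ 2 / (2 * ((1 - 2 * al * (1 - rho ^+ 2)) / (1 - rho ^+ 2)))))).
    rewrite -expRD [X in expR X](_ : _ = 0) ?expR0 ?mulr1//.
    by rewrite /B /C eqxx; field; rewrite vn0 gt_eqF.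
  by move: (expR _) (expR _) => e1 e2; field; rewrite s0 s'0.
move=> t /negPf ti; rewrite expRD sqrt_expR_ln /gmgf.
have -> : 1 - 2 * A t = (1 - rho ^+ 2)^-1 by rewrite /A ti; field.
rewrite sqrtrV ?(ltW v0)// invrK.
set s := Num.sqrt _; have s0 : s != 0 by rewrite gt_eqF// sqrtr_gt0.
rewrite (mulrC (expR _) s) mulrACA mulVf// mul1r -expRD -[RHS]expR0; congr expR.
by rewrite /C /B ti; field.
Qed.

End mehler_integrals.

Section mehler_power.
Context {d1} {T1 : measurableType d1} {d2} {T2 : measurableType d2}.
Context {R : realType} {n : nat}.
Variables (P : probability T1 R) (f : 'I_n -> T1 -> R).
Variables (Q : probability T2 R) (g : 'I_n -> T2 -> R).
Hypotheses (Pf : gauss P f) (Qg : gauss Q g).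
Variables (rho s : R).
Hypotheses (rho1 : rho ^+ 2 < 1) (s0 : 0 <= s) (s1 : s <= 1).

(** The moment of order 1 + s of the density, used in the Chernoff bound. Two Gaussian integrations:
    the one over [x] leaves the exponential of a quadratic in [y]. *)
Lemma mehler_power_integral :
  (\int[Q]_y \int[P]_x (expR ((1 + s) * \sum_t mexp rho (f t x) (g t y)))%:E =
   ((expR (- s * ln (1 - rho ^+ 2) / 2) / Num.sqrt (1 - rho ^+ 2 * s ^+ 2)) ^+ n)%:E)%E.
Proof.
pose v : R := 1 - rho ^+ 2; have v0 : 0 < v by rewrite subr_gt0.
have vn0 : v != 0 by exact: lt0r_neq0.
have rE : rho ^+ 2 = 1 - v by rewrite /v; ring.
pose q : R := 1 + s.
pose W : R := 1 + q * rho ^+ 2 / v.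
have q0 : 0 <= q by rewrite addr_ge0.
have W0 : 0 < W by rewrite ltr_wpDr// divr_ge0 ?(ltW v0)// mulr_ge0// sqr_ge0.
have Wn0 : W != 0 by exact: lt0r_neq0.
have z0 : 0 < 1 - rho ^+ 2 * s ^+ 2.
  have s21 : s ^+ 2 <= 1 by rewrite expr_le1.
  by rewrite subr_gt0 (le_lt_trans _ rho1)// ler_piMr ?sqr_ge0.
pose l : R := - ln v / 2.
pose A : R := - q * rho ^+ 2 / (2 * v).
pose a' : R := A + (q * rho / v) ^+ 2 / (2 * W).
(* The determinant of the quadratic form in the pair (x, y) per coordinate; its positivity is what
   makes the second integral converge. *)
have Wa' : W * (1 - 2 * a') = (1 - rho ^+ 2 * s ^+ 2) / v.
  have -> : 1 - 2 * a' = (W ^+ 2 - (q * rho / v) ^+ 2) / W.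
    have -> : W ^+ 2 = W * (1 - 2 * A) by rewrite expr2; congr (_ * _); rewrite /A /W; field.
    by rewrite /a'; field; rewrite Wn0 vn0.
  by rewrite mulrC divfK// /W /q /v; field.
have a'2 : a' < 2^-1.
  have : 0 < W * (1 - 2 * a') by rewrite Wa' divr_gt0.
  by rewrite pmulr_rgt0//; lra.
have A2 : A < 2^-1.
  have : A <= 0; last by lra.
  rewrite /A !mulNr oppr_le0; apply: divr_ge0; apply: mulr_ge0 => //.
  - exact: sqr_ge0.
  - exact: ltW.
transitivity (\int[Q]_y (expR (\sum_t (q * l - ln W / 2 + 0 * g t y + a' * g t y ^+ 2)))%:E)%E.
  apply: eq_integral => y _.
  transitivity (\int[P]_x (expR (\sum_t (q * l + A * g t y ^+ 2 + (q * rho / v * g t y) * f t x + A * f t x ^+ 2)))%:E)%E.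
    apply: eq_integral => x _; congr (expR _)%:E; rewrite mulr_sumr.
    apply: eq_bigr => t _; rewrite /mexp -/v /A /l -/q; move: (ln _) => z.
    by field.
  rewrite (gauss_expR_quad Pf)// expR_sum; congr (_%:E); apply: eq_bigr => t _.
  rewrite /gmgf.
  have -> : 1 - 2 * A = W by rewrite /A /W; field.
  have -> : (Num.sqrt W)^-1 = expR (- ln W / 2) by rewrite mulNr expRN expR_half_ln.
  rewrite mulrA -!expRD; congr expR; rewrite /a'.
  by move: (ln _) => z; field; rewrite vn0 Wn0.
rewrite (gauss_expR_quad Qg)//; congr (_%:E).
rewrite prodr_const card_ord; congr (_ ^+ _).
rewrite /gmgf expr0n/= mul0r expR0.
have -> : (Num.sqrt (1 - 2 * a'))^-1 = Num.sqrt W * Num.sqrt v / Num.sqrt (1 - rho ^+ 2 * s ^+ 2).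
  have -> : 1 - 2 * a' = (1 - rho ^+ 2 * s ^+ 2) / (v * W).
    by rewrite -[LHS](mulKf Wn0) Wa'; field; rewrite Wn0 vn0.
  rewrite sqrtrM ?(ltW z0)// sqrtrV ?mulr_ge0 ?(ltW v0) ?(ltW W0)// sqrtrM ?(ltW v0)//.
  by rewrite invf_div (mulrC (Num.sqrt v)).
rewrite -(expR_half_ln W0) -(expR_half_ln v0) mul1r !mulrA -!expRD; congr (expR _ / _).
by rewrite /l /q; move: (ln _) (ln _) => lW lv; field.
Qed.

End mehler_power.

(** * Random codebooks: second moments and the covering bound *)

Section sampling.
Context {d1} {T1 : measurableType d1} {R : realType} (P : probability T1 R).
Context {N : nat} (M : probability (N.-tuple T1) R).
Hypothesis MP : integral_prod_law P M.

Lemma integral_sample i (phi : T1 -> \bar R) : measurable_fun setT phi ->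
  (forall x, 0 <= phi x)%E ->
  (\int[M]_u phi (tnth u i) = \int[P]_x phi x)%E.
Proof.
move=> mphi phi0.
pose h k := if k == i then phi else cst 1%E.
have mh k : measurable_fun setT (h k) by rewrite /h; case: (k == i).
have h0 k x : (0 <= h k x)%E by rewrite /h; case: (k == i).
have := MP mh h0; rewrite /h.
rewrite (bigD1 i)//= eqxx big1 ?mule1; last first.
  by move=> k /negPf ->; rewrite integral_cst// mul1e [LHS]probability_setT.
move=> <-; apply: eq_integral => u _; rewrite (bigD1 i)//= eqxx big1 ?mule1//.
by move=> k /negPf ->.
Qed.

Lemma integral_sample2 i j (phi psi : T1 -> \bar R) : i != j ->
  measurable_fun setT phi -> measurable_fun setT psi ->
  (forall x, 0 <= phi x)%E -> (forall x, 0 <= psi x)%E ->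
  (\int[M]_u (phi (tnth u i) * psi (tnth u j)) =
   (\int[P]_x phi x) * (\int[P]_x psi x))%E.
Proof.
move=> ij mphi mpsi phi0 psi0.
pose h k := if k == i then phi else if k == j then psi else cst 1%E.
have mh k : measurable_fun setT (h k).
  by rewrite /h; case: (k == i) => //; case: (k == j).
have h0 k x : (0 <= h k x)%E by rewrite /h; case: (k == i) => //; case: (k == j).
have := MP mh h0; rewrite /h.
have ji : (j == i) = false by rewrite eq_sym (negPf ij).
rewrite (bigD1 i)//= eqxx (bigD1 j)/= ?ji// eqxx big1 ?mule1; last first.
  move=> k /andP[/negPf -> /negPf ->].
  by rewrite integral_cst// mul1e [LHS]probability_setT.
move=> <-; apply: eq_integral => u _; rewrite (bigD1 i)//= eqxx (bigD1 j)/= ?ji//.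
rewrite eqxx big1 ?mule1//.
by move=> k /andP[/negPf -> /negPf ->].
Qed.

Context {I : finType} (iota : I -> 'I_N).
Hypotheses (iota_inj : injective iota) (I0 : (0 < #|I|)%N).

(** [iota] selects a subcodebook: the codewords sharing a seed for the source side, all of them for
    the output side. *)
Definition sample_mean (phi : T1 -> R) (u : N.-tuple T1) : R :=
  #|I|%:R^-1 * \sum_l phi (tnth u (iota l)).

Lemma measurable_sample_mean phi : measurable_fun setT phi ->
  measurable_fun setT (sample_mean phi).
Proof.
move=> mphi; apply: measurable_funM => //; apply: measurable_sum => l.
apply: (measurableT_comp mphi); exact: measurable_tnth.
Qed.

(** Pairwise independence bounds the second moment of the mean by m^2 + B / L, with L the sample
    size. Then 1 - 2 m + m^2 <= 1 - m because 0 <= m <= 1. *)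
Lemma sample_mean_sq_dist (phi : T1 -> R) (m B : R) : 0 <= B -> measurable_fun setT phi ->
  (forall x, 0 <= phi x <= B) -> (\int[P]_x (phi x)%:E = m%:E)%E -> m <= 1 ->
  (\int[M]_u ((1 - sample_mean phi u) ^+ 2)%:E <= (1 - m + B / #|I|%:R)%:E)%E.
Proof.
move=> B0 mphi phiB Em m1.
have phi0 x : 0 <= phi x by have /andP[] := phiB x.
have mphiE : measurable_fun setT (EFin \o phi) by exact/measurable_EFinP.
have L0 : 0 < #|I|%:R :> R by rewrite ltr0n.
set L : R := #|I|%:R in L0 *.
have mS := measurable_sample_mean mphi.
have S0 u : 0 <= sample_mean phi u.
  by rewrite mulr_ge0 ?invr_ge0 ?(ltW L0)// sumr_ge0.
have m0 : 0 <= m by rewrite -lee_fin -Em; apply: integral_ge0 => x _; rewrite lee_fin.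
have mtn l : measurable_fun setT (fun u : N.-tuple T1 => phi (tnth u (iota l))).
  by apply: (measurableT_comp mphi); exact: measurable_tnth.
have ES : (\int[M]_u (sample_mean phi u)%:E = m%:E)%E.
  under eq_integral do rewrite EFinM.
  rewrite ge0_integralZl_EFin ?invr_ge0 ?(ltW L0)//; last 2 first.
  - by move=> u _; rewrite lee_fin sumr_ge0.
  - by apply/measurable_EFinP; exact: measurable_sum.
  under eq_integral do rewrite -sumEFin.
  rewrite ge0_integral_sum//; last 2 first.
  - by move=> l; apply/measurable_EFinP.
  - by move=> l u _; rewrite lee_fin.
  rewrite (eq_bigr (fun=> m%:E)).
    by rewrite sumEFin sumr_const -EFinM -[m *+ _]mulr_natl mulKf// gt_eqF.
  by move=> l _; rewrite -Em -(integral_sample (iota l) mphiE).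
have ES2 : (\int[M]_u (sample_mean phi u ^+ 2)%:E <= (m ^+ 2 + B / L)%:E)%E.
  have -> : (\int[M]_u (sample_mean phi u ^+ 2)%:E = (L ^- 2)%:E *
     \sum_l \sum_k \int[M]_u ((phi (tnth u (iota l)))%:E * (phi (tnth u (iota k)))%:E))%E.
    transitivity (\int[M]_u ((L ^- 2)%:E * (\sum_l \sum_k
       ((phi (tnth u (iota l)))%:E * (phi (tnth u (iota k)))%:E))))%E.
      apply: eq_integral => u _.
      under eq_bigr do under eq_bigr do rewrite -EFinM.
      under eq_bigr do rewrite sumEFin.
      rewrite sumEFin -EFinM /sample_mean exprMn exprVn; congr (_ * _)%:E.
      by rewrite expr2 mulr_suml; apply: eq_bigr => l _; rewrite mulr_sumr.
    have mprod l k : measurable_fun setT (fun u : N.-tuple T1 =>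
        ((phi (tnth u (iota l)))%:E * (phi (tnth u (iota k)))%:E)%E).
      by apply: emeasurable_funM; exact/measurable_EFinP.
    rewrite ge0_integralZl_EFin//; last 3 first.
    - by move=> u _; apply: sume_ge0 => l _; apply: sume_ge0 => k _; rewrite mule_ge0// lee_fin.
    - by apply: emeasurable_sum => l; exact: emeasurable_sum.
    - by rewrite invr_ge0 sqr_ge0.
    congr (_ * _)%E; rewrite ge0_integral_sum//; last 2 first.
    - by move=> l; exact: emeasurable_sum.
    - by move=> l u _; apply: sume_ge0 => k _; rewrite mule_ge0// lee_fin.
    apply: eq_bigr => l _; rewrite ge0_integral_sum//.
    by move=> k u _; rewrite mule_ge0// lee_fin.
  (* Off the diagonal the factors are independent. On it one factor is bounded by B and the other
     integrates to m <= 1. *)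
  have bnd l k : (\int[M]_u ((phi (tnth u (iota l)))%:E * (phi (tnth u (iota k)))%:E)
      <= (m ^+ 2 + (if l == k then B else 0))%:E)%E.
    have [->|lk] := eqVneq l k.
      apply: (@le_trans _ _ (\int[M]_u (B%:E * (phi (tnth u (iota k)))%:E))%E).
        apply: ge0_le_integral => //.
        - by move=> u _; rewrite mule_ge0// lee_fin.
        - by apply: emeasurable_funM; exact/measurable_EFinP.
        - by apply: measurable_funeM; exact/measurable_EFinP.
        - move=> u _; rewrite lee_wpmul2r ?lee_fin//.
          by have /andP[] := phiB (tnth u (iota k)).
      rewrite ge0_integralZl_EFin//; last 2 first.
      - by move=> u _; rewrite lee_fin.
      - exact/measurable_EFinP.
      rewrite (integral_sample (iota k) mphiE)// Em -EFinM lee_fin.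
      by rewrite ler_wpDl ?sqr_ge0// ler_piMr.
    rewrite (@integral_sample2 _ _ (EFin \o phi) (EFin \o phi))//; last first.
      by rewrite (inj_eq iota_inj).
    by rewrite /= Em -EFinM lee_fin addr0 expr2.
  apply: (@le_trans _ _ ((L ^- 2)%:E * \sum_l \sum_k (m ^+ 2 + (if l == k then B else 0))%:E)%E).
    rewrite lee_wpmul2l ?lee_fin ?invr_ge0 ?sqr_ge0//.
    by apply: lee_sum => l _; apply: lee_sum.
  under eq_bigr do rewrite sumEFin.
  rewrite sumEFin -EFinM lee_fin.
  rewrite (eq_bigr (fun=> L * m ^+ 2 + B)); last first.
    move=> l _; rewrite big_split/= sumr_const -[m ^+ 2 *+ _]mulr_natl; congr (_ + _).
    by rewrite (bigD1 l)//= eqxx big1 ?addr0// => k /negPf; rewrite eq_sym => ->.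
  rewrite sumr_const -[_ *+ #|I|]mulr_natl -/L.
  by rewrite le_eqVlt; apply/orP; left; apply/eqP; field; rewrite gt_eqF.
(* The square is expanded with the cross term moved to the left, so that every integrand stays
   nonnegative. *)
have : (\int[M]_u ((1 - sample_mean phi u) ^+ 2)%:E + 2%:E * \int[M]_u (sample_mean phi u)%:E
   = 1 + \int[M]_u (sample_mean phi u ^+ 2)%:E)%E.
  have -> : (1 + \int[M]_u (sample_mean phi u ^+ 2)%:E =
     \int[M]_u (1 + (sample_mean phi u ^+ 2)%:E))%E.
    have := @integral_1DZ _ _ R M (probability_setT M) 1 (fun u => (sample_mean phi u ^+ 2)%:E).
    rewrite mul1e => <-//.
    - by apply: eq_integral => u _; rewrite mul1e.
    - by apply/measurable_EFinP; exact: measurable_funX.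
    - by move=> u; rewrite lee_fin sqr_ge0.
  rewrite -ge0_integralZl_EFin//; last 2 first.
  - by move=> u _; rewrite lee_fin.
  - exact/measurable_EFinP.
  rewrite -ge0_integralD//; last 4 first.
  - by move=> u _; rewrite lee_fin sqr_ge0.
  - by apply/measurable_EFinP; apply: measurable_funX; exact: measurable_funB.
  - by move=> u _; rewrite mule_ge0// lee_fin.
  - by apply: measurable_funeM; exact/measurable_EFinP.
  by apply: eq_integral => u _; rewrite -EFinM -!EFinD; congr (_%:E); ring.
rewrite ES.
have : (0 <= \int[M]_u ((1 - sample_mean phi u) ^+ 2)%:E)%E.
  by apply: integral_ge0 => u _; rewrite lee_fin sqr_ge0.
have : (0 <= \int[M]_u (sample_mean phi u ^+ 2)%:E)%E.
  by apply: integral_ge0 => u _; rewrite lee_fin sqr_ge0.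
move: ES2; case: (\int[M]_u (sample_mean phi u ^+ 2)%:E)%E => [a| |]//.
case: (\int[M]_u ((1 - sample_mean phi u) ^+ 2)%:E)%E => [b| |]//.
rewrite -EFinM -!EFinD !lee_fin => ha _ _ [hb].
have : m ^+ 2 <= m by rewrite expr2 ler_piMl.
lra.
Qed.

End sampling.

Section covering.
Context {d1} {T1 : measurableType d1} {R : realType} (P : probability T1 R).
Context {N : nat} (M : probability (N.-tuple T1) R).
Hypothesis MP : integral_prod_law P M.
Context {I : finType} (iota : I -> 'I_N).
Hypotheses (iota_inj : injective iota) (I0 : (0 < #|I|)%N).
Context {d2} {T2 : measurableType d2} (Q : probability T2 R).
Variable h : T1 * T2 -> R.
Hypotheses (mh : measurable_fun setT h) (h0 : forall z, 0 <= h z).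
Hypothesis h1 : forall y, (\int[P]_x (h (x, y))%:E = 1)%E.

(* The part of [h]'s average over the codewords missing to reach 1; when the
   [h (x, .)] are densities with respect to [Q], its integral
   is the total variation distance between the codebook mixture and [Q]. *)
Definition defect (z : N.-tuple T1 * T2) : R :=
  Num.max 0 (1 - sample_mean iota (fun x => h (x, z.2)) z.1).

Lemma measurable_defect : measurable_fun setT defect.
Proof.
apply: measurable_maxr => //; apply: measurable_funB => //.
apply: measurable_funM => //; apply: measurable_sum => l.
apply: (measurableT_comp mh); apply: measurable_fun_pair => //=.
by apply: (measurableT_comp (measurable_tnth (iota l))).
Qed.

(* Truncate [h] at level [B], and bound the defect by its second moment through
   [d <= kappa + d^2 / (4 kappa)]. *)
Lemma covering (B kappa Delta : R) : 0 <= B -> 0 < kappa ->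
  (\int[Q]_y \int[P]_x (if B < h (x, y) then h (x, y) else 0)%:E <= Delta%:E)%E ->
  (\int[M]_u \int[Q]_y (defect (u, y))%:E <=
   (kappa + (Delta + B / #|I|%:R) / (4 * kappa))%:E)%E.
Proof.
move=> B0 k0 HD.
have L0 : 0 < #|I|%:R :> R by rewrite ltr0n.
have mdE : measurable_fun setT (fun z => (defect z)%:E).
  by apply/measurable_EFinP; exact: measurable_defect.
have d0 z : 0 <= defect z by rewrite le_max lexx.
(* With the order exchanged, [y] is fixed and the codebook random: the defect then concerns the
   sample mean of one function of mean 1. *)
rewrite (@fubini_tonelli _ _ _ _ _ M Q (fun z => (defect z)%:E))//.
pose big z := if B < h z then h z else 0.
pose small z := if B < h z then 0 else h z.
have mlt : measurable_fun setT (fun z => B < h z).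
  exact: measurable_fun_ltr.
have mbig : measurable_fun setT big by exact: measurable_fun_ifT.
have msmall : measurable_fun setT small by exact: measurable_fun_ifT.
have big0 z : 0 <= big z by rewrite /big; case: ifP.
have small0 z : 0 <= small z by rewrite /small; case: ifP.
have smallB z : 0 <= small z <= B by rewrite small0 /small; case: ltP.
have sec (F : T1 * T2 -> R) y : measurable_fun setT F -> measurable_fun setT (fun x => F (x, y)).
  by move=> mF; exact: measurableT_comp.
pose tail y := (\int[P]_x (big (x, y))%:E)%E.
have tail0 y : (0 <= tail y)%E by apply: integral_ge0 => x _; rewrite lee_fin.
have mtail : measurable_fun setT tail.
  apply: (@measurable_fun_fubini_tonelli_G _ _ T1 T2 R P (fun z => (big z)%:E)) => //.
  exact/measurable_EFinP.
have slice y : (\int[M]_u (defect (u, y))%:E <=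
   (kappa + B / #|I|%:R / (4 * kappa))%:E + ((4 * kappa)^-1)%:E * tail y)%E.
  have E1 : (\int[P]_x (small (x, y))%:E + tail y = 1)%E.
    rewrite -(h1 y) -ge0_integralD//.
    - apply: eq_integral => x _; rewrite -EFinD /small /big; congr (_%:E).
      by case: ifP; rewrite ?add0r ?addr0.
    - by move=> x _; rewrite lee_fin.
    - by apply/measurable_EFinP; exact: sec.
    - by move=> x _; rewrite lee_fin.
    - by apply/measurable_EFinP; exact: sec.
  have : (0 <= \int[P]_x (small (x, y))%:E)%E.
    by apply: integral_ge0 => x _; rewrite lee_fin.
  move: (tail0 y) E1; case: (tail y) => [b| |]//; last first.
    by case: (\int[P]_x _)%E.
  case E : (\int[P]_x (small (x, y))%:E)%E => [m| |]// b0 [mb] m0.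
  rewrite lee_fin in b0.
  have m1 : m <= 1 by lra.
  have mS : measurable_fun setT (fun u => (1 - sample_mean iota (fun x => small (x, y)) u) ^+ 2).
    by apply: measurable_funX; apply: measurable_funB => //; apply: measurable_sample_mean; exact: sec.
  have := sample_mean_sq_dist MP iota_inj I0 B0 (sec _ y msmall) (fun x => smallB (x, y)) E m1.
  move=> H.
  apply: (@le_trans _ _ (\int[M]_u ((kappa)%:E + ((4 * kappa)^-1)%:E *
     ((1 - sample_mean iota (fun x => small (x, y)) u) ^+ 2)%:E))%E).
    apply: ge0_le_integral => //.
    - by move=> u _; rewrite lee_fin; exact: d0.
    - by apply: (measurableT_comp mdE); exact: measurable_fun_pair.
    - apply: emeasurable_funD => //; apply: measurable_funeM.
      exact/measurable_EFinP.
    - move=> u _; rewrite -EFinM -EFinD lee_fin /defect/=.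
      set S := sample_mean _ _ _; set S' := sample_mean _ _ _.
      have SS' : S' <= S.
        rewrite /S /S' /sample_mean ler_pM2l ?invr_gt0//.
        by apply: ler_sum => l _; rewrite /small; case: ifP.
      have sq : 0 <= (4 * kappa)^-1 * (2 * kappa - (1 - S')) ^+ 2.
        by rewrite mulr_ge0 ?sqr_ge0// invr_ge0 mulr_ge0// ltW.
      have kE : (4 * kappa)^-1 * (2 * kappa - (1 - S')) ^+ 2 =
         kappa - (1 - S') + (4 * kappa)^-1 * (1 - S') ^+ 2.
        by field; rewrite gt_eqF.
      rewrite ge_max; apply/andP; split; last by lra.
      rewrite addr_ge0 ?(ltW k0)// mulr_ge0 ?sqr_ge0//.
      by rewrite invr_ge0 mulr_ge0// ltW.
  rewrite ge0_integralD//; last 3 first.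
  - by move=> u _; rewrite lee_fin ltW.
  - move=> u _; rewrite lee_fin mulr_ge0 ?sqr_ge0//.
    by rewrite invr_ge0 mulr_ge0// ltW.
  - by apply: measurable_funeM; exact/measurable_EFinP.
  rewrite ge0_integralZl_EFin//; last 3 first.
  - by move=> u _; rewrite lee_fin sqr_ge0.
  - exact/measurable_EFinP.
  - by rewrite invr_ge0 mulr_ge0// ltW.
  rewrite integral_cst// [X in (_ * X)%E]probability_setT mule1.
  apply: (@le_trans _ _ (kappa%:E + ((4 * kappa)^-1)%:E * (1 - m + B / #|I|%:R)%:E)%E).
    by rewrite leeD2l// lee_wpmul2l// lee_fin invr_ge0 mulr_ge0// ltW.
  rewrite -!EFinM -!EFinD lee_fin le_eqVlt; apply/orP; left; apply/eqP.
  have -> : m = 1 - b by lra.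
  by field; rewrite !gt_eqF.
apply: (@le_trans _ _ (\int[Q]_y ((kappa + B / #|I|%:R / (4 * kappa))%:E + ((4 * kappa)^-1)%:E * tail y))%E).
  apply: ge0_le_integral => //.
  - by move=> y _; apply: integral_ge0 => u _; rewrite lee_fin.
  - apply: (@measurable_fun_fubini_tonelli_G _ _ _ _ R M (fun z => (defect z)%:E)) => //.
  - by apply: emeasurable_funD => //; exact: measurable_funeM.
rewrite ge0_integralD//; last 3 first.
- by move=> y _; rewrite lee_fin addr_ge0 ?(ltW k0)// !divr_ge0// ltW// mulr_gt0.
- by move=> y _; rewrite mule_ge0// lee_fin invr_ge0 mulr_ge0// ltW.
- exact: measurable_funeM.
rewrite integral_cst// [X in (_ * X)%E]probability_setT mule1.
rewrite ge0_integralZl_EFin//; last by rewrite invr_ge0 mulr_ge0// ltW.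
apply: (@le_trans _ _ ((kappa + B / #|I|%:R / (4 * kappa))%:E + ((4 * kappa)^-1)%:E * Delta%:E)%E).
  by rewrite leeD2l// lee_wpmul2l// lee_fin invr_ge0 mulr_ge0// ltW.
rewrite -EFinM -EFinD lee_fin le_eqVlt; apply/orP; left; apply/eqP.
by field; rewrite !gt_eqF.
Qed.

End covering.

(** The factor 2 creates the strict gap: [F] above [2 * c] everywhere would have integral at least
    [2 * c > c]. *)
Lemma exists_le_integral d (T : measurableType d) (R : realType) (M : probability T R)
    (F : T -> \bar R) (c : R) : 0 < c -> measurable_fun setT F -> (forall x, 0 <= F x)%E ->
  (\int[M]_x F x <= c%:E)%E -> exists x, (F x <= (2 * c)%:E)%E.
Proof.
move=> c0 mF F0 H; apply/not_existsP => HF.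
have : ((2 * c)%:E <= c%:E :> \bar R)%E.
  apply: le_trans H.
  have -> : ((2 * c)%:E = \int[M]_x (2 * c)%:E)%E.
    by rewrite integral_cst// [X in (_ * X)%E]probability_setT mule1.
  apply: ge0_le_integral => //.
    by move=> x _; rewrite lee_fin; lra.
  move=> x _; apply: ltW; rewrite ltNge; apply/negP; exact: HF.
by rewrite lee_fin; lra.
Qed.

(** * Tail exponents and the choice of a codebook *)

Import numFieldNormedType.Exports.

Lemma expr_le_eventually (R : realType) (th eps : R) : 0 <= th < 1 -> 0 < eps ->
  exists n0, forall n, (n0 <= n)%N -> th ^+ n <= eps.
Proof.
move=> /andP[th0 th1] eps0.
have : th ^+ n @[n --> \oo] --> (0 : R) by apply: cvg_expr; rewrite ger0_norm.
move/cvgrPdist_le => /(_ _ eps0) [n0 _ H]; exists n0 => n n0n.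
by have := H n n0n; rewrite /= sub0r normrN ger0_norm// exprn_ge0.
Qed.

(* Chernoff exponent: the left-hand side has derivative
   [- (c + ln (1 - rho ^+ 2) / 2) < 0] at [s = 0]. *)
Lemma mehler_tail_rate (R : realType) (rho c : R) : rho ^+ 2 < 1 ->
  - ln (1 - rho ^+ 2) / 2 < c ->
  exists s : R, [/\ 0 <= s, s <= 1 &
    expR (- s * (c + ln (1 - rho ^+ 2) / 2)) / Num.sqrt (1 - rho ^+ 2 * s ^+ 2) < 1].
Proof.
move=> r1 rc.
have : 0 < c + ln (1 - rho ^+ 2) / 2 by lra.
move: (c + _) => d d0.
(* Squaring reduces the claim to (1 - q s^2) (1 + 2 s d) > 1 with q = rho^2, that is, 2 d - q s - 2
   q s^2 d > 0. Here s <= d gives q s <= d, and s <= 1/2 gives 2 q s^2 d <= d / 2. *)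
pose s := Num.min 2^-1 d; exists s.
have s0 : 0 < s by rewrite lt_min d0 invr_gt0 ltr0n.
have sh : s <= 2^-1 by rewrite ge_min lexx.
have sd : s <= d by rewrite ge_min lexx orbT.
have rho0 := sqr_ge0 rho.
split; [exact: ltW|by lra|].
move: (rho ^+ 2) rho0 r1 rc => q q0 q1 _.
have w0 : 0 < 1 - q * s ^+ 2 by rewrite subr_gt0 expr2; nra.
have sq0 : 0 < Num.sqrt (1 - q * s ^+ 2) by rewrite sqrtr_gt0.
rewrite ltr_pdivrMr// mul1r -[ltLHS]ger0_norm ?expR_ge0// -sqrtr_sqr.
rewrite ltr_sqrt// expr2 -expRD -mulrDl.
have -> : (- s - s) * d = - (2 * s * d) by ring.
rewrite expRN -[ltLHS]mul1r ltr_pdivrMr ?expR_gt0//.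
have x1 := expR_ge1Dx (2 * s * d).
have : 1 < (1 - q * s ^+ 2) * (1 + 2 * s * d).
  rewrite -subr_gt0.
  have -> : (1 - q * s ^+ 2) * (1 + 2 * s * d) - 1 =
     s * (2 * d - q * s - 2 * q * s ^+ 2 * d) by ring.
  rewrite mulr_gt0//.
  have : q * s <= d by nra.
  have : q * s ^+ 2 <= 4^-1.
    have : s ^+ 2 <= 4^-1 by rewrite expr2; nra.
    by have := sqr_ge0 s; nra.
  have -> : 2 * q * s ^+ 2 * d = 2 * (q * s ^+ 2) * d by ring.
  by nra.
move=> H; apply: lt_le_trans H _; rewrite ler_pM2l//.
Qed.

(** Chernoff bound: where the density h exceeds exp (n c), it is at most exp (- s n c) h^(1 + s). *)
Lemma mehler_tail (R : realType) d1 (T1 : measurableType d1) d2 (T2 : measurableType d2)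
    n (P : probability T1 R) (f : 'I_n -> T1 -> R) (Q : probability T2 R)
    (g : 'I_n -> T2 -> R) (rho s c : R) :
  gauss P f -> gauss Q g -> rho ^+ 2 < 1 -> 0 <= s -> s <= 1 ->
  (\int[Q]_y \int[P]_x (if expR (n%:R * c) < mehler rho (f ^~ x) (g ^~ y)
     then mehler rho (f ^~ x) (g ^~ y) else 0)%:E <=
   ((expR (- s * (c + ln (1 - rho ^+ 2) / 2)) /
     Num.sqrt (1 - rho ^+ 2 * s ^+ 2)) ^+ n)%:E)%E.
Proof.
move=> Pf Qg r1 s0 s1; have [mf _] := Pf; have [mg _] := Qg.
have mM : measurable_fun setT (fun z : T1 * T2 => mehler rho (f ^~ z.1) (g ^~ z.2)).
  by apply: measurable_mehler => t; exact: measurableT_comp.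
have mE : measurable_fun setT (fun z : T1 * T2 => \sum_t mexp rho (f t z.1) (g t z.2)).
  by apply: measurable_sum => t; apply: measurable_mexp; exact: measurableT_comp.
pose k z : R := expR (- s * (n%:R * c)) *
  expR ((1 + s) * \sum_t mexp rho (f t z.1) (g t z.2)).
have mk : measurable_fun setT k.
  by apply: measurable_funM => //; apply: measurableT_comp => //; exact: measurable_funM.
have k0 z : 0 <= k z by rewrite mulr_ge0 ?expR_ge0.
pose big (z : T1 * T2) := if expR (n%:R * c) < mehler rho (f ^~ z.1) (g ^~ z.2)
     then mehler rho (f ^~ z.1) (g ^~ z.2) else 0.
have mbig : measurable_fun setT big.
  by apply: measurable_fun_ifT => //; exact: measurable_fun_ltr.
have big0 z : 0 <= big z by rewrite /big; case: ifP => // _; exact: mehler_ge0.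
have bigk z : big z <= k z.
  rewrite /big; case: ifP => // H.
  rewrite /k /mehler -expRD ler_expR; move: H; rewrite /mehler ltr_expR.
  move: (\sum_t _) => m mc; nra.
have mbigE : measurable_fun setT (EFin \o big) by exact/measurable_EFinP.
have mkE : measurable_fun setT (EFin \o k) by exact/measurable_EFinP.
have sec (F : T1 * T2 -> \bar R) y : measurable_fun setT F ->
    measurable_fun setT (fun x => F (x, y)).
  by move=> mF; exact: measurableT_comp.
apply: (@le_trans _ _ (\int[Q]_y \int[P]_x (k (x, y))%:E)%E).
  apply: ge0_le_integral => //.
  - by move=> y _; apply: integral_ge0 => x _; rewrite lee_fin; exact: (big0 (x, y)).
  - apply: (@measurable_fun_fubini_tonelli_G _ _ T1 T2 R P (EFin \o big)) => //.
  - apply: (@measurable_fun_fubini_tonelli_G _ _ T1 T2 R P (EFin \o k)) => //.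
  - move=> y _; apply: ge0_le_integral => //.
    + by move=> x _; rewrite lee_fin; exact: (big0 (x, y)).
    + exact: (sec _ y mbigE).
    + exact: (sec _ y mkE).
    + by move=> x _; rewrite lee_fin; exact: (bigk (x, y)).
rewrite le_eqVlt; apply/orP; left; apply/eqP.
pose k' (z : T1 * T2) := (expR ((1 + s) * \sum_t mexp rho (f t z.1) (g t z.2)))%:E.
have mk' : measurable_fun setT k'.
  by apply/measurable_EFinP; apply: measurableT_comp => //; exact: measurable_funM.
have k'0 z : (0 <= k' z)%E by rewrite lee_fin expR_ge0.
transitivity ((expR (- s * (n%:R * c)))%:E * \int[Q]_y \int[P]_x k' (x, y))%E.
  rewrite -ge0_integralZl_EFin ?expR_ge0//; last 2 first.
  - by move=> y _; apply: integral_ge0 => x _.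
  - exact: (@measurable_fun_fubini_tonelli_G _ _ T1 T2 R P k').
  apply: eq_integral => y _; rewrite -ge0_integralZl_EFin ?expR_ge0//.
  exact: (sec _ y mk').
rewrite /k' (mehler_power_integral Pf Qg r1 s0 s1) -EFinM; congr (_%:E).
have -> : - s * (n%:R * c) = n%:R * (- s * c) by ring.
rewrite expRM_natl -exprMn mulrA -expRD; congr ((expR _ / _) ^+ _).
by move: (ln _) => l; field.
Qed.

(** Soft covering when the rate [r] exceeds the mutual information - ln (1 - rho^2) / 2. The
    threshold [n0] is uniform in the spaces and the index set, so one block length serves all seeds;
    [C] absorbs the rounding of the codebook size. *)
Lemma mehler_covering (R : realType) (rho r eta C : R) : rho ^+ 2 < 1 ->
  - ln (1 - rho ^+ 2) / 2 < r -> 0 < eta -> 0 < C ->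
  exists n0, forall n, (n0 <= n)%N ->
  forall d1 (T1 : measurableType d1) d2 (T2 : measurableType d2)
    (P : probability T1 R) (f : 'I_n -> T1 -> R) (Q : probability T2 R)
    (g : 'I_n -> T2 -> R) N (M : probability (N.-tuple T1) R)
    (I : finType) (iota : I -> 'I_N),
  gauss P f -> gauss Q g -> integral_prod_law P M -> injective iota ->
  expR (n%:R * r) <= C * #|I|%:R ->
  (\int[M]_u \int[Q]_y (defect iota
     (fun z => mehler rho (f ^~ z.1) (g ^~ z.2)) (u, y))%:E <= eta%:E)%E.
Proof.
move=> r1 rr eta0 C0.
(* The truncation level exp (n c) has [c] midway between mutual information and rate: above the
   former the tail decays, below the latter the level is small compared with the codebook. *)
pose c := (r - ln (1 - rho ^+ 2) / 2) / 2.
have c1 : - ln (1 - rho ^+ 2) / 2 < c by rewrite /c; lra.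
have cr : c < r by rewrite /c; lra.
have [s [s0 s1]] := mehler_tail_rate r1 c1.
set th := expR _ / _ => th1.
have th0 : 0 <= th by rewrite divr_ge0 ?expR_ge0 ?sqrtr_ge0.
(* In [covering] with kappa = eta / 2, tail and ratio at most eta^2 / 2 each give eta / 2 + eta^2 /
   (2 eta) = eta. *)
have eps0 : 0 < eta ^+ 2 / 2 by rewrite divr_gt0 ?exprn_gt0.
have th01 : 0 <= th < 1 by rewrite th0.
have [n1 H1] := expr_le_eventually th01 eps0.
have eps0' : 0 < eta ^+ 2 / (2 * C) by rewrite divr_gt0 ?exprn_gt0 ?mulr_gt0.
have cr01 : 0 <= expR (c - r) < 1 by rewrite expR_ge0/= expR_lt1; lra.
have [n2 H2] := expr_le_eventually cr01 eps0'.
exists (maxn n1 n2) => n; rewrite geq_max => /andP[n1n n2n].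
move=> d1 T1 d2 T2 P f Q g N M I iota Pf Qg MP inj IC.
have L0 : 0 < #|I|%:R :> R.
  by rewrite -(pmulr_rgt0 _ C0) (lt_le_trans _ IC)// expR_gt0.
have [mf _] := Pf; have [mg _] := Qg.
have mM : measurable_fun setT (fun z : T1 * T2 => mehler rho (f ^~ z.1) (g ^~ z.2)).
  by apply: measurable_mehler => t; exact: measurableT_comp.
have I0 : (0 < #|I|)%N by rewrite ltr0n in L0.
have h1 y : (\int[P]_x (mehler rho (f ^~ x) (g ^~ y))%:E = 1)%E.
  under eq_integral do rewrite mehlerC.
  exact: mehler_integral.
have e20 : 0 < eta / 2 by rewrite divr_gt0.
have := covering MP inj I0 mM (fun z => mehler_ge0 _ _ _) h1
  (expR_ge0 (n%:R * c)) e20 (mehler_tail c Pf Qg r1 s0 s1).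
move=> /le_trans; apply; rewrite -/th lee_fin.
have a1 : th ^+ n <= eta ^+ 2 / 2 by exact: H1.
have a2 : expR (n%:R * c) / #|I|%:R <= eta ^+ 2 / 2.
  have : expR (c - r) ^+ n <= eta ^+ 2 / (2 * C).
    exact: H2.
  rewrite -expRM_natl mulrBr expRD expRN ler_pdivrMr ?expR_gt0// => H.
  rewrite ler_pdivrMr//; apply: le_trans H _.
  apply: (@le_trans _ _ (eta ^+ 2 / (2 * C) * (C * #|I|%:R))).
    by rewrite ler_wpM2l// ltW.
  by rewrite le_eqVlt; apply/orP; left; apply/eqP; field; rewrite gt_eqF.
have : (th ^+ n + expR (n%:R * c) / #|I|%:R) / (4 * (eta / 2)) <= eta / 2.
  rewrite ler_pdivrMr ?mulr_gt0//.
  have -> : eta / 2 * (4 * (eta / 2)) = eta ^+ 2 by field.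
  lra.
lra.
Qed.

Section codebook.
Context {d1} {T1 : measurableType d1} {d2} {T2 : measurableType d2} {R : realType}.
Context {n : nat} {J K : finType}.
Variables (P : probability T1 R) (f : 'I_n -> T1 -> R) (Q : probability T2 R).
Variable M : probability (#|{: K * J}|.-tuple T1) R.
Hypotheses (n0 : (0 < n)%N) (J0 : (0 < #|J|)%N) (K0 : (0 < #|K|)%N).
Hypotheses (Pf : gauss P f) (MP : integral_prod_law P M).
Variables (h1 : T1 * T1 -> R) (h2 : T1 * T2 -> R) (eta : R).
Hypotheses (mh1 : measurable_fun setT h1) (mh2 : measurable_fun setT h2).
Hypothesis eta0 : 0 < eta.
Hypothesis cov1 : forall k : K, (\int[M]_u \int[P]_x
  (defect (fun j : J => enum_rank (k, j)) h1 (u, x))%:E <= eta%:E)%E.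
Hypothesis cov2 : (\int[M]_u \int[Q]_y
  (defect (fun m : K * J => enum_rank m) h2 (u, y))%:E <= eta%:E)%E.

(** The source defects are controlled on average over the seed only. The constants come from a
    single averaging argument for all three requirements, with 384 = 6 * 64. *)
Lemma codebook_exists : exists U : K * J -> T1,
  [/\ (\sum_k \int[P]_x (Num.max 0 (1 - #|J|%:R^-1 * \sum_j h1 (U (k, j), x)))%:E
        <= (6 * eta * #|K|%:R)%:E)%E,
      (\int[Q]_y (Num.max 0 (1 - #|{: K * J}|%:R^-1 * \sum_m h2 (U m, y)))%:E
        <= (6 * eta)%:E)%E &
      \sum_m \sum_t f t (U m) ^+ 4 <= 384 * n%:R * #|{: K * J}|%:R].
Proof.
have [mf _] := Pf.
have Kp : 0 < #|K|%:R :> R by rewrite ltr0n.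
have np : 0 < n%:R :> R by rewrite ltr0n.
have Np : 0 < #|{: K * J}|%:R :> R by rewrite card_prod natrM mulr_gt0// ltr0n.
pose N := #|{: K * J}|; rewrite -/N in Np.
pose D1 k (u : N.-tuple T1) : \bar R := (\int[P]_x (defect (fun j : J => enum_rank (k, j)) h1 (u, x))%:E)%E.
pose D2 (u : N.-tuple T1) : \bar R := (\int[Q]_y (defect (fun m : K * J => enum_rank m) h2 (u, y))%:E)%E.
pose F4 (u : N.-tuple T1) := \sum_m \sum_t f t (tnth u (enum_rank m)) ^+ 4.
have def0 (I : finType) d (T : measurableType d) (io : I -> 'I_N) (h : T1 * T -> R) z : 0 <= defect io h z.
  by rewrite le_max lexx.
have D10 k u : (0 <= D1 k u)%E by apply: integral_ge0 => x _; rewrite lee_fin def0.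
have D20 u : (0 <= D2 u)%E by apply: integral_ge0 => x _; rewrite lee_fin def0.
have F40 u : 0 <= F4 u.
  by apply: sumr_ge0 => m _; apply: sumr_ge0 => t _; rewrite -[4%N]/(2 * 2)%N exprM sqr_ge0.
have mD1 k : measurable_fun setT (D1 k).
  apply: (@measurable_fun_fubini_tonelli_F _ _ _ _ R P
    (fun z => (defect (fun j : J => enum_rank (k, j)) h1 z)%:E)).
    by apply/measurable_EFinP; exact: measurable_defect.
  by move=> z; rewrite lee_fin def0.
have mD2 : measurable_fun setT D2.
  apply: (@measurable_fun_fubini_tonelli_F _ _ _ _ R Q
    (fun z => (defect (fun m : K * J => enum_rank m) h2 z)%:E)).
    by apply/measurable_EFinP; exact: measurable_defect.
  by move=> z; rewrite lee_fin def0.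
have mf4 t m : measurable_fun setT (fun u : N.-tuple T1 => f t (tnth u (enum_rank m)) ^+ 4).
  apply: measurable_funX; apply: (measurableT_comp (mf t)); exact: measurable_tnth.
have mF4 : measurable_fun setT (EFin \o F4).
  by apply/measurable_EFinP; apply: measurable_sum => m; apply: measurable_sum => t; exact: mf4.
have E4 : (\int[M]_u (F4 u)%:E <= (64 * (n%:R * N%:R))%:E)%E.
  have pos4 (x : R) : 0 <= x ^+ 4 by rewrite -[4%N]/(2 * 2)%N exprM sqr_ge0.
  rewrite /F4; under eq_integral do rewrite -sumEFin.
  rewrite ge0_integral_sum//; last 2 first.
  - by move=> m; apply/measurable_EFinP; apply: measurable_sum => t; exact: mf4.
  - by move=> m u _; rewrite lee_fin sumr_ge0.
  apply: (@le_trans _ _ (\sum_(m : K * J) (64 * n%:R)%:E)%E); last first.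
    by rewrite sumEFin sumr_const -[_ *+ _]mulr_natr mulrA.
  apply: lee_sum => m _.
  under eq_integral do rewrite -sumEFin.
  rewrite ge0_integral_sum//; last 2 first.
  - by move=> t; apply/measurable_EFinP; exact: mf4.
  - by move=> t u _; rewrite lee_fin.
  apply: (@le_trans _ _ (\sum_(t < n) 64%:E)%E); last first.
    by rewrite sumEFin sumr_const card_ord -[_ *+ _]mulr_natr.
  apply: lee_sum => t _.
  rewrite (integral_sample MP (enum_rank m) (phi := fun x => (f t x ^+ 4)%:E)).
  - exact: gauss_fourth.
  - by apply/measurable_EFinP; exact: measurable_funX.
  - by move=> x; rewrite lee_fin.
(* Three nonnegative terms, each scaled to expectation at most 1. Some codebook has total at most 6,
   hence each term at most 6. *)
pose Phi u := ((eta^-1)%:E * ((#|K|%:R^-1)%:E * \sum_k D1 k u + D2 u) +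
   ((64 * (n%:R * N%:R))^-1)%:E * (F4 u)%:E)%E.
have sD10 u : (0 <= \sum_k D1 k u)%E by apply: sume_ge0.
have eta0' : 0 <= eta^-1 by rewrite invr_ge0 ltW.
have K0' : 0 <= #|K|%:R^-1 :> R by rewrite invr_ge0 ltW.
have C0 : 0 < 64 * (n%:R * N%:R) :> R by rewrite mulr_gt0// mulr_gt0.
have C0' : 0 <= (64 * (n%:R * N%:R))^-1 :> R by rewrite invr_ge0 ltW.
have a0 u : (0 <= (#|K|%:R^-1)%:E * \sum_k D1 k u)%E by rewrite mule_ge0.
have b0 u : (0 <= (#|K|%:R^-1)%:E * \sum_k D1 k u + D2 u)%E by rewrite adde_ge0.
have c0 u : (0 <= (eta^-1)%:E * ((#|K|%:R^-1)%:E * \sum_k D1 k u + D2 u))%E.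
  by rewrite mule_ge0.
have e0 u : (0 <= ((64 * (n%:R * N%:R))^-1)%:E * (F4 u)%:E)%E.
  by rewrite mule_ge0// lee_fin.
have Phi0 u : (0 <= Phi u)%E by rewrite adde_ge0.
have msD1 : measurable_fun setT (fun u => \sum_k D1 k u)%E by exact: emeasurable_sum.
have ma : measurable_fun setT (fun u => (#|K|%:R^-1)%:E * \sum_k D1 k u)%E.
  exact: measurable_funeM.
have mb : measurable_fun setT (fun u => (#|K|%:R^-1)%:E * \sum_k D1 k u + D2 u)%E.
  exact: emeasurable_funD.
have mPhi : measurable_fun setT Phi.
  by apply: emeasurable_funD; exact: measurable_funeM.
have EPhi : (\int[M]_u Phi u <= 3%:E)%E.
  rewrite /Phi ge0_integralD//; last 2 first.
  - exact: measurable_funeM.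
  - exact: measurable_funeM.
  rewrite ge0_integralZl_EFin// ge0_integralD// ge0_integralZl_EFin//.
  rewrite ge0_integral_sum// ge0_integralZl_EFin//; last first.
    by move=> u _; rewrite lee_fin.
  apply: (@le_trans _ _ ((eta^-1)%:E * ((#|K|%:R^-1)%:E * (eta * #|K|%:R)%:E + eta%:E) +
      ((64 * (n%:R * N%:R))^-1)%:E * (64 * (n%:R * N%:R))%:E)%E).
    apply: leeD; last by rewrite lee_wpmul2l.
    rewrite lee_wpmul2l//; apply: leeD => //; rewrite lee_wpmul2l//.
    apply: (@le_trans _ _ (\sum_(k : K) eta%:E)%E); first by apply: lee_sum => k _; exact: cov1.
    by rewrite sumEFin sumr_const -[_ *+ _]mulr_natr.
  rewrite -!(EFinM, EFinD) lee_fin [X in _ + X]mulVf ?gt_eqF//.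
  have -> : eta^-1 * (#|K|%:R^-1 * (eta * #|K|%:R) + eta) = 2.
    by field; rewrite !gt_eqF.
  lra.
have [u] := exists_le_integral (ltr0n _ 3) mPhi Phi0 EPhi.
rewrite /Phi => Hu.
have H1 : ((eta^-1)%:E * ((#|K|%:R^-1)%:E * \sum_k D1 k u + D2 u) <= 6%:E)%E.
  apply: le_trans (le_trans Hu _); first by rewrite leeDl.
  by rewrite lee_fin; lra.
have H2 : (((64 * (n%:R * N%:R))^-1)%:E * (F4 u)%:E <= 6%:E)%E.
  apply: le_trans (le_trans Hu _); first by rewrite leeDr.
  by rewrite lee_fin; lra.
rewrite muleC lee_pdivrMr// -EFinM in H1.
exists (fun m => tnth u (enum_rank m)); split.
- have : ((#|K|%:R^-1)%:E * \sum_k D1 k u <= (6 * eta)%:E)%E.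
    by apply: le_trans H1; rewrite leeDl.
  by rewrite muleC lee_pdivrMr// -EFinM.
- apply: le_trans H1; apply: (@le_trans _ _ (D2 u)); last by rewrite leeDr.
  by [].
- move: H2; rewrite -EFinM lee_fin mulrC ler_pdivrMr//.
  by rewrite /F4; lra.
Qed.

End codebook.

(** * Soft partitions of unity *)

Section nonneg_integral.
Context {d} {T : measurableType d} {R : realType} (P : probability T R).
Implicit Types (phi psi : T -> R) (a b c : R).

(** The side conditions of integration travel with the bound, so that estimates combine like
    inequalities between numbers. *)
Definition int_le phi a := [/\ measurable_fun setT phi, (forall x, 0 <= phi x) &
  (\int[P]_x (phi x)%:E <= a%:E)%E].

Definition int_eq phi a := [/\ measurable_fun setT phi, (forall x, 0 <= phi x) &
  (\int[P]_x (phi x)%:E = a%:E)%E].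

Lemma int_eq_le phi a : int_eq phi a -> int_le phi a.
Proof. by move=> [? ? E]; split => //; rewrite E. Qed.

Lemma int_le_trans phi a b : a <= b -> int_le phi a -> int_le phi b.
Proof. by move=> ab [? ? H]; split => //; apply: le_trans H _; rewrite lee_fin. Qed.

Lemma int_le_fun phi psi a : measurable_fun setT phi -> (forall x, 0 <= phi x) ->
  (forall x, phi x <= psi x) -> int_le psi a -> int_le phi a.
Proof.
move=> mphi phi0 phipsi [mpsi psi0 H]; split => //; apply: le_trans H.
apply: ge0_le_integral => //.
- by move=> x _; rewrite lee_fin.
- exact/measurable_EFinP.
- exact/measurable_EFinP.
- by move=> x _; rewrite lee_fin.
Qed.

Lemma int_le_ge0 phi a : int_le phi a -> 0 <= a.
Proof.
move=> [_ phi0 H]; rewrite -lee_fin; apply: le_trans H.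
by apply: integral_ge0 => x _; rewrite lee_fin.
Qed.

Lemma int_eq_ge0 phi a : int_eq phi a -> 0 <= a.
Proof. by move/int_eq_le/int_le_ge0. Qed.

Lemma int_eq_mono phi psi a b : int_eq phi a -> int_eq psi b ->
  (forall x, phi x <= psi x) -> a <= b.
Proof.
move=> [mphi phi0 E] psib H; rewrite -lee_fin -E.
by have [] := int_le_fun mphi phi0 H (int_eq_le psib).
Qed.

Lemma int_eq_unique phi a b : int_eq phi a -> int_eq phi b -> a = b.
Proof. by move=> [_ _ E] [_ _]; rewrite E => -[]. Qed.

Lemma int_eq_ext phi psi a : phi =1 psi -> int_eq phi a -> int_eq psi a.
Proof. by move=> /funext ->. Qed.

Lemma int_eqD phi psi a b : int_eq phi a -> int_eq psi b ->
  int_eq (fun x => phi x + psi x) (a + b).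
Proof.
move=> [m1 p1 E1] [m2 p2 E2]; split; first exact: measurable_funD.
  by move=> x; exact: addr_ge0.
under eq_integral do rewrite EFinD.
rewrite ge0_integralD ?E1 ?E2//.
- by move=> x _; rewrite lee_fin.
- exact/measurable_EFinP.
- by move=> x _; rewrite lee_fin.
- exact/measurable_EFinP.
Qed.

Lemma int_leD phi psi a b : int_le phi a -> int_le psi b ->
  int_le (fun x => phi x + psi x) (a + b).
Proof.
move=> [m1 p1 E1] [m2 p2 E2]; split; first exact: measurable_funD.
  by move=> x; exact: addr_ge0.
under eq_integral do rewrite EFinD.
rewrite ge0_integralD//; first by rewrite EFinD leeD.
- by move=> x _; rewrite lee_fin.
- exact/measurable_EFinP.
- by move=> x _; rewrite lee_fin.
- exact/measurable_EFinP.
Qed.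

Lemma int_eqZ c phi a : 0 <= c -> int_eq phi a -> int_eq (fun x => c * phi x) (c * a).
Proof.
move=> c0 [m1 p1 E1]; split; first exact: measurable_funM.
  by move=> x; exact: mulr_ge0.
under eq_integral do rewrite EFinM.
rewrite ge0_integralZl_EFin// ?E1//.
- by move=> x _; rewrite lee_fin.
- exact/measurable_EFinP.
Qed.

Lemma int_leZ c phi a : 0 <= c -> int_le phi a -> int_le (fun x => c * phi x) (c * a).
Proof.
move=> c0 [m1 p1 E1]; split; first exact: measurable_funM.
  by move=> x; exact: mulr_ge0.
under eq_integral do rewrite EFinM.
rewrite ge0_integralZl_EFin//; first by rewrite EFinM lee_wpmul2l.
- by move=> x _; rewrite lee_fin.
- exact/measurable_EFinP.
Qed.

Lemma int_eq_cst c : 0 <= c -> int_eq (fun=> c) c.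
Proof.
by move=> c0; split => //; rewrite integral_cst// [X in (_ * X)%E]probability_setT mule1.
Qed.

Lemma int_eq_sum (I : finType) (phi : I -> T -> R) (a : I -> R) :
  (forall i, int_eq (phi i) (a i)) -> int_eq (fun x => \sum_i phi i x) (\sum_i a i).
Proof.
move=> H; split.
- by apply: measurable_sum => i; have [] := H i.
- by move=> x; apply: sumr_ge0 => i _; have [] := H i.
- under eq_integral do rewrite -sumEFin.
  rewrite ge0_integral_sum//.
  + by rewrite -sumEFin; apply: eq_bigr => i _; have [] := H i.
  + by move=> i; apply/measurable_EFinP; have [] := H i.
  + by move=> i x _; rewrite lee_fin; have [] := H i.
Qed.

Lemma int_le_sum (I : finType) (phi : I -> T -> R) (a : I -> R) :
  (forall i, int_le (phi i) (a i)) -> int_le (fun x => \sum_i phi i x) (\sum_i a i).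
Proof.
move=> H; split.
- by apply: measurable_sum => i; have [] := H i.
- by move=> x; apply: sumr_ge0 => i _; have [] := H i.
- under eq_integral do rewrite -sumEFin.
  rewrite ge0_integral_sum//.
  + by rewrite -sumEFin; apply: lee_sum => i _; have [] := H i.
  + by move=> i; apply/measurable_EFinP; have [] := H i.
  + by move=> i x _; rewrite lee_fin; have [] := H i.
Qed.

Lemma int_eq_bounded phi c : measurable_fun setT phi ->
  (forall x, 0 <= phi x <= c) -> exists a, int_eq phi a.
Proof.
move=> mphi phic; have phi0 x : 0 <= phi x by have /andP[] := phic x.
have c0 : 0 <= c by have /andP[] := phic point; exact: le_trans.
have [_ _ H] : int_le phi c.
  apply: int_le_fun (int_eq_le (int_eq_cst c0)) => // x.
  by have /andP[] := phic x.
exists (fine (\int[P]_x (phi x)%:E)); split => //.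
rewrite fineK// ge0_fin_numE ?(le_lt_trans H) ?ltry//.
by apply: integral_ge0 => x _; rewrite lee_fin.
Qed.

Lemma gauss_int_fourth n (f : 'I_n -> T -> R) t : gauss P f ->
  int_le (fun x => f t x ^+ 4) 64.
Proof.
move=> Pf; have [mf _] := Pf; split; [exact: measurable_funX| |exact: gauss_fourth].
by move=> x; rewrite -[4%N]/(2 * 2)%N exprM sqr_ge0.
Qed.

Lemma int_mehler n (f : 'I_n -> T -> R) (rho : R) (u : 'I_n -> R) : gauss P f ->
  rho ^+ 2 < 1 -> int_eq (fun x => mehler rho u (f ^~ x)) 1.
Proof.
move=> Pf r1; have [mf _] := Pf; split.
- by apply: measurable_mehler => // t; exact: measurable_cst.
- by move=> x; exact: mehler_ge0.
- exact: mehler_integral.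
Qed.

Lemma int_mehler_sq_dist n (f : 'I_n -> T -> R) (rho : R) (u : 'I_n -> R) t : gauss P f ->
  rho ^+ 2 < 1 -> int_le (fun x => mehler rho u (f ^~ x) * (f t x - rho * u t) ^+ 2)
    (1 - rho ^+ 2).
Proof.
move=> Pf r1; have [mf _] := Pf; split.
- apply: measurable_funM; last by apply: measurable_funX; exact: measurable_funB.
  by apply: measurable_mehler => // s; exact: measurable_cst.
- by move=> x; rewrite mulr_ge0 ?sqr_ge0// mehler_ge0.
- exact: mehler_sq_dist.
Qed.

End nonneg_integral.

Lemma div_max1D (R : realFieldType) (s : R) : 0 <= s ->
  s / Num.max 1 s + Num.max 0 (1 - s) = 1.
Proof.
move=> s0; have [s1|s1] := leP 1 s.
  by rewrite divff ?gt_eqF ?(lt_le_trans _ s1)// max_l ?addr0// subr_le0.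
by rewrite divr1 max_r ?subr_ge0 ?(ltW s1)// addrC subrK.
Qed.

Section soft_partition.
Context {d} {T : measurableType d} {R : realType} (P : probability T R).
Context {I : finType}.
Variables (q : I -> R) (h : I -> T -> R).
Hypotheses (q0 : forall i, 0 <= q i) (h1 : forall i, int_eq P (h i) 1).

Let mix x := \sum_i q i * h i x.
Let rest x := Num.max 0 (1 - mix x).

Definition mixture_rest := rest.
(** Clipping: densities are left alone where the mixture is at most 1 and scaled down to total 1
    elsewhere. With [mixture_rest] they sum to 1 by [div_max1D]. *)
Definition mixture_core i x := q i * h i x / Num.max 1 (mix x).

Let h0 i x : 0 <= h i x. Proof. by have [] := h1 i. Qed.
Let mh i : measurable_fun setT (h i). Proof. by have [] := h1 i. Qed.

Lemma mixture_ge0 x : 0 <= mix x.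
Proof. by apply: sumr_ge0 => i _; rewrite mulr_ge0. Qed.

Lemma measurable_mixture : measurable_fun setT mix.
Proof. by apply: measurable_sum => i; exact: measurable_funM. Qed.

Lemma max1_gt0 x : 0 < Num.max 1 (mix x).
Proof. by rewrite lt_max ltr01. Qed.

Lemma mixture_core_ge0 i x : 0 <= mixture_core i x.
Proof. by rewrite divr_ge0 ?mulr_ge0// ltW// max1_gt0. Qed.

Lemma mixture_core_le i x : mixture_core i x <= q i * h i x.
Proof.
rewrite ler_pdivrMr ?max1_gt0// ler_peMr ?mulr_ge0//.
by rewrite le_max lexx.
Qed.

Lemma measurable_mixture_core i : measurable_fun setT (mixture_core i).
Proof.
rewrite /mixture_core; apply: measurable_funM; first exact: measurable_funM.
have -> : (fun x => (Num.max 1 (mix x))^-1) = (fun x => Num.max 1 (mix x) `^ (-1)).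
  by apply/funext => x; rewrite powR_inv1// ltW// max1_gt0.
apply: (measurableT_comp (@measurable_powR R (-1))).
apply: measurable_maxr => //; exact: measurable_mixture.
Qed.

Lemma mixture_restP x : 0 <= rest x <= 1.
Proof.
by rewrite le_max lexx ge_max ler01 gerBl mixture_ge0.
Qed.

Lemma measurable_mixture_rest : measurable_fun setT rest.
Proof.
by apply: measurable_maxr => //; apply: measurable_funB => //; exact: measurable_mixture.
Qed.

Lemma sum_mixture_core x : \sum_i mixture_core i x + rest x = 1.
Proof.
by rewrite /mixture_core -mulr_suml; exact: div_max1D (mixture_ge0 x).
Qed.

Lemma int_mixture_core i : exists2 a, int_eq P (mixture_core i) a & a <= q i.
Proof.
have [|a ia] := @int_eq_bounded _ _ _ P (mixture_core i) 1 (measurable_mixture_core i).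
  move=> x; rewrite mixture_core_ge0/= -(sum_mixture_core x) (bigD1 i)//=.
  rewrite -addrA lerDl addr_ge0//; last by have /andP[] := mixture_restP x.
  by apply: sumr_ge0 => j _; exact: mixture_core_ge0.
exists a => //; rewrite -[leRHS]mulr1.
exact: int_eq_mono ia (int_eqZ (q0 i) (h1 i)) (mixture_core_le i).
Qed.

Lemma int_mixture_rest : exists b, int_eq P rest b.
Proof. exact: int_eq_bounded measurable_mixture_rest mixture_restP. Qed.

End soft_partition.

(** Controls a second moment under a weight of small mass by that mass and a fourth moment; [lam]
    sets the exchange rate. *)
Lemma weighted_sq_le (R : realFieldType) (a z lam : R) : 0 <= a -> 0 < lam ->
  2 * (a * z ^+ 2) <= lam * a + lam^-1 * (a * z ^+ 4).
Proof.
move=> a0 l0; have H : 0 <= a * (lam^-1 * (lam - z ^+ 2) ^+ 2).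
  by rewrite mulr_ge0// mulr_ge0 ?sqr_ge0// invr_ge0 ltW.
have E : a * (lam^-1 * (lam - z ^+ 2) ^+ 2) =
    lam * a - 2 * (a * z ^+ 2) + lam^-1 * (a * z ^+ 4).
  by field; rewrite gt_eqF.
lra.
Qed.

Lemma clipped_sq_le (R : realFieldType) (a z lam : R) : 0 <= a <= 1 -> 0 < lam ->
  2 * (a * z ^+ 2) <= lam * a + lam^-1 * z ^+ 4.
Proof.
move=> /andP[a0 a1] l0; apply: le_trans (weighted_sq_le z a0 l0) _.
rewrite lerD2l ler_pM2l ?invr_gt0// ler_piMl//.
by rewrite -[4%N]/(2 * 2)%N exprM sqr_ge0.
Qed.

Lemma sqrB_le (R : realFieldType) (f u rho : R) : rho ^+ 2 <= 1 ->
  (f - rho * u) ^+ 2 <= 2 * f ^+ 2 + 2 * u ^+ 2.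
Proof.
move=> rho1; have : 0 <= (f + rho * u) ^+ 2 by exact: sqr_ge0.
have : rho ^+ 2 * u ^+ 2 <= u ^+ 2 by rewrite ler_piMl// sqr_ge0.
have -> : (f + rho * u) ^+ 2 = f ^+ 2 + 2 * rho * f * u + rho ^+ 2 * u ^+ 2 by ring.
have -> : (f - rho * u) ^+ 2 = f ^+ 2 - 2 * rho * f * u + rho ^+ 2 * u ^+ 2 by ring.
lra.
Qed.

Lemma sumr_cst (R : pzSemiRingType) (I : finType) (c : R) : \sum_(i : I) c = #|I|%:R * c.
Proof. by rewrite sumr_const mulr_natl. Qed.

Section weights.
Context {d1} {T1 : measurableType d1} {d2} {T2 : measurableType d2} {R : realType}.
Context {n : nat} {J K : finType}.
Variables (P : probability T1 R) (f : 'I_n -> T1 -> R).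
Variables (Q : probability T2 R) (g : 'I_n -> T2 -> R).
Variables (u : K * J -> 'I_n -> R) (rho1 rho2 lam eta1 eta2 C4 : R).
Hypotheses (J0 : (0 < #|J|)%N) (K0 : (0 < #|K|)%N).
Hypotheses (Pf : gauss P f) (Qg : gauss Q g).
Hypotheses (rho11 : rho1 ^+ 2 < 1) (rho21 : rho2 ^+ 2 < 1) (lam0 : 0 < lam).

Let h1 m x := mehler rho1 (u m) (f ^~ x).
Let h2 m y := mehler rho2 (u m) (g ^~ y).

Hypothesis cov1 : (\sum_k \int[P]_x
  (Num.max 0 (1 - #|J|%:R^-1 * \sum_j h1 (k, j) x))%:E <= (eta1 * #|K|%:R)%:E)%E.
Hypothesis cov2 : (\int[Q]_y
  (Num.max 0 (1 - #|{: K * J}|%:R^-1 * \sum_m h2 m y))%:E <= eta2%:E)%E.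
Hypothesis u4 : \sum_m \sum_t u m t ^+ 4 <= C4 * n%:R * #|{: K * J}|%:R.

Let ih1 m : int_eq P (h1 m) 1. Proof. exact: int_mehler. Qed.
Let ih2 m : int_eq Q (h2 m) 1. Proof. exact: int_mehler. Qed.

Let Kp : 0 < #|K|%:R :> R. Proof. by rewrite ltr0n. Qed.
Let Jp : 0 < #|J|%:R :> R. Proof. by rewrite ltr0n. Qed.
Let NE : #|{: K * J}|%:R = #|K|%:R * #|J|%:R :> R.
Proof. by rewrite card_prod natrM. Qed.

(** Clipping is done on the source side for each seed with uniform weights, then on the output side
    with the message probabilities so obtained. Each error is the conditional variance
    [1 - rho ^+ 2] from the core plus the cost of the remainder. *)
Lemma weights_exist : exists (w : K * J -> T1 -> R) (v : K * J -> T2 -> R)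
    (p e1 e2 : K * J -> R),
  [/\ forall m, int_eq P (w m) (p m), forall k x, \sum_j w (k, j) x = 1,
      forall m, int_eq Q (v m) (p m / #|K|%:R) & forall y, \sum_m v m y = 1] /\
  [/\ forall m, int_le P (fun x => w m x * \sum_t (f t x - rho1 * u m t) ^+ 2) (e1 m),
      \sum_m e1 m <= #|K|%:R * (n%:R * (1 - rho1 ^+ 2 +
         (2 * lam * eta1 + lam^-1 * (64 + C4)))),
      forall m, int_le Q (fun y => v m y * \sum_t (g t y - rho2 * u m t) ^+ 2) (e2 m) &
      \sum_m e2 m <= n%:R * (1 - rho2 ^+ 2 +
         (2 * lam * (eta2 + 2 * eta1) + 2 * lam^-1 * (64 + C4)))].
Proof.
have [mf _] := Pf; have [mg _] := Qg.
have Jn0 : #|J|%:R != 0 :> R by rewrite gt_eqF.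
have Kn0 : #|K|%:R != 0 :> R by rewrite gt_eqF.
have lamV0 : 0 <= lam^-1 by rewrite invr_ge0 ltW.
pose q1 (j : J) : R := #|J|%:R^-1.
have q10 j : 0 <= q1 j by rewrite invr_ge0 ltW.
pose c1 k := mixture_core q1 (fun j => h1 (k, j)).
pose r1 k := mixture_rest q1 (fun j => h1 (k, j)).
have r1E k x : r1 k x = Num.max 0 (1 - #|J|%:R^-1 * \sum_j h1 (k, j) x).
  by rewrite /r1 /mixture_rest mulr_sumr.
pose w (m : K * J) x := c1 m.1 m.2 x + #|J|%:R^-1 * r1 m.1 x.
have /choice[A HA] : forall m : K * J, exists a : R,
    int_eq P (c1 m.1 m.2) a /\ a <= #|J|%:R^-1.
  move=> m; have [a ia aq] := int_mixture_core q10 (fun j => ih1 (m.1, j)) m.2.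
  by exists a.
have /choice[B HB] : forall k, exists b, int_eq P (r1 k) b.
  by move=> k; apply: int_mixture_rest q10 (fun j => ih1 (k, j)).
have B0 k : 0 <= B k by exact: int_eq_ge0 (HB k).
have sumB : \sum_k B k <= eta1 * #|K|%:R.
  rewrite -lee_fin -sumEFin; apply: le_trans cov1.
  rewrite le_eqVlt; apply/orP; left; apply/eqP; apply: eq_bigr => k _.
  have [_ _ <-] := HB k.
  by apply: eq_integral => x _; rewrite r1E.
have r1P k x : 0 <= r1 k x <= 1 by exact: mixture_restP q10 (fun j => ih1 (k, j)) x.
have sumw k x : \sum_j w (k, j) x = 1.
  rewrite /w big_split/= sumr_cst mulVKf//.
  exact: sum_mixture_core q10 (fun j => ih1 (k, j)) x.
pose p m := A m + #|J|%:R^-1 * B m.1.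
have iw m : int_eq P (w m) (p m).
  by apply: int_eqD; [have [] := HA m|apply: int_eqZ; [rewrite invr_ge0 ltW|exact: HB]].
have w0 m x : 0 <= w m x by have [] := iw m.
have p0 m : 0 <= p m by exact: int_eq_ge0 (iw m).
have ABk k : \sum_j A (k, j) + B k = 1.
  apply: (int_eq_unique (P := P) (phi := fun=> 1)); last exact: int_eq_cst.
  apply: int_eq_ext (int_eqD (int_eq_sum (fun j => (HA (k, j)).1)) (HB k)) => x.
  exact: sum_mixture_core q10 (fun j => ih1 (k, j)) x.
have c1le m x : c1 m.1 m.2 x <= #|J|%:R^-1 * h1 m x.
  case: m => k j; exact: mixture_core_le q10 (fun j => ih1 (k, j)) j x.
pose q (m : K * J) : R := p m / #|K|%:R.
have q0 m : 0 <= q m by rewrite divr_ge0// ltW.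
have pairE (F : K * J -> R) : \sum_m F m = \sum_k \sum_j F (k, j).
  by rewrite pair_big; apply: eq_bigr => -[].
have sumq : \sum_m q m = 1.
  rewrite pairE.
  rewrite (eq_bigr (fun=> #|K|%:R^-1)).
    by rewrite sumr_cst divff.
  move=> k _; rewrite -mulr_suml /p/= big_split/= sumr_cst.
  by rewrite mulVKf// ABk mul1r.
have B1 k : B k <= 1.
  rewrite -(ABk k) lerDr; apply: sumr_ge0 => j _.
  by have [/int_eq_ge0] := HA (k, j).
have qle m : q m <= 2 / #|{: K * J}|%:R.
  rewrite /q NE invfM [#|K|%:R^-1 * _]mulrC mulrA ler_pM2r ?invr_gt0//.
  have [_ HAm] := HA m.
  have : #|J|%:R^-1 * B m.1 <= #|J|%:R^-1 by rewrite ler_piMr// invr_ge0 ltW.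
  rewrite /p; lra.
(* For fixed [k], clipping removes total mass [B k] from the letters and the shared remainder
   returns [B k]; both count in the absolute deviation, hence the factor 2. *)
have dev : \sum_m `|#|{: K * J}|%:R^-1 - q m| <= 2 * eta1.
  apply: (@le_trans _ _ (\sum_m #|K|%:R^-1 * ((#|J|%:R^-1 - A m) + #|J|%:R^-1 * B m.1))).
    apply: ler_sum => m _; have [_ HAm] := HA m.
    have -> : #|{: K * J}|%:R^-1 - q m =
        #|K|%:R^-1 * ((#|J|%:R^-1 - A m) - #|J|%:R^-1 * B m.1).
      by rewrite NE /q /p; field; rewrite Jn0 Kn0.
    rewrite normrM ger0_norm ?invr_ge0 ?(ltW Kp)//.
    rewrite ler_wpM2l ?invr_ge0 ?(ltW Kp)//.
    apply: le_trans (ler_normB _ _) _; rewrite ger0_norm ?subr_ge0//.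
    by rewrite ger0_norm// mulr_ge0 ?invr_ge0 ?(ltW Jp).
  rewrite -mulr_sumr pairE ler_pdivrMl//.
  rewrite (eq_bigr (fun k => 2 * B k)).
    by rewrite -mulr_sumr; lra.
  move=> k _ /=; rewrite big_split/= sumrB !sumr_cst.
  rewrite mulfV// mulVKf//; have := ABk k; lra.
pose c2 := mixture_core q h2.
pose r2 := mixture_rest q h2.
have /choice[D HD] : forall m, exists a, int_eq Q (c2 m) a /\ a <= q m.
  by move=> m; have [a ia aq] := int_mixture_core q0 ih2 m; exists a.
have [tau Htau] : exists tau, int_eq Q r2 tau by exact: int_mixture_rest q0 ih2.
have tau0 : 0 <= tau by exact: int_eq_ge0 Htau.
have r2P y : 0 <= r2 y <= 1 by exact: mixture_restP q0 ih2 y.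
have r20 y : 0 <= r2 y by have /andP[] := r2P y.
have Dtau : \sum_m D m + tau = 1.
  apply: (int_eq_unique (P := Q) (phi := fun=> 1)); last exact: int_eq_cst.
  apply: int_eq_ext (int_eqD (int_eq_sum (fun m => (HD m).1)) Htau) => y.
  exact: sum_mixture_core q0 ih2 y.
(* [cov2] concerns uniform weights. Passing to the weights [q] enlarges the remainder by at most the
   deviation [dev], each [h2 m] having integral 1. *)
have tau_le : tau <= eta2 + 2 * eta1.
  pose r' := mixture_rest (fun=> #|{: K * J}|%:R^-1) h2.
  have N0 (m : K * J) : 0 <= #|{: K * J}|%:R^-1 :> R by rewrite invr_ge0.
  have r'E y : r' y = Num.max 0 (1 - #|{: K * J}|%:R^-1 * \sum_m h2 m y).
    by rewrite /r' /mixture_rest mulr_sumr.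
  have ir' : int_le Q r' eta2.
    split; first exact: measurable_mixture_rest ih2.
      by move=> y; have /andP[] := mixture_restP N0 ih2 y.
    by under eq_integral do rewrite r'E.
  have idev : int_le Q (fun y => \sum_m `|#|{: K * J}|%:R^-1 - q m| * h2 m y) (2 * eta1).
    apply: int_le_trans dev _; apply: int_le_sum => m.
    by rewrite -[X in int_le _ _ X]mulr1; apply: int_leZ => //; exact: int_eq_le.
  have := int_leD ir' idev.
  have [mr2 _ Er2] := Htau.
  have cmp y : r2 y <= r' y + \sum_m `|#|{: K * J}|%:R^-1 - q m| * h2 m y.
    rewrite /r2 /mixture_rest ge_max; apply/andP; split.
      rewrite addr_ge0//; first by have /andP[] := mixture_restP N0 ih2 y.
      by apply: sumr_ge0 => m _; rewrite mulr_ge0//; have [] := ih2 m.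
    have : 1 - \sum_m #|{: K * J}|%:R^-1 * h2 m y <= r' y.
      by rewrite /r' /mixture_rest le_max lexx orbT.
    have : \sum_m (#|{: K * J}|%:R^-1 * h2 m y - q m * h2 m y) <=
       \sum_m `|#|{: K * J}|%:R^-1 - q m| * h2 m y.
      apply: ler_sum => m _; rewrite -mulrBl ler_wpM2r ?ler_norm//.
      by have [] := ih2 m.
    rewrite sumrB; clear N0; lra.
  move=> /(int_le_fun mr2 r20 cmp)[_ _]; by rewrite Er2 lee_fin.
pose t' m := q m - D m.
have t'0 m : 0 <= t' m by rewrite subr_ge0; have [] := HD m.
have sumt' : \sum_m t' m = tau.
  by rewrite sumrB sumq; lra.
(* Shares of the output remainder that fill exactly the deficit [t' m] of each message. If
   [tau = 0], all deficits vanish and any shares of total 1 serve. *)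
have [th [th0 th1 thE]] : exists th : K * J -> R,
    [/\ forall m, 0 <= th m, \sum_m th m = 1 & forall m, th m * tau = t' m].
  have [tauz|taun] := eqVneq tau 0.
    exists (fun=> #|{: K * J}|%:R^-1); split => [//||m].
      by rewrite sumr_cst divff// NE mulf_neq0.
    rewrite tauz mulr0; apply/esym/eqP; move: sumt' => /eqP.
    by rewrite tauz psumr_eq0// => /allP/(_ m); apply; rewrite mem_index_enum.
  exists (fun m => t' m / tau); split => [m||m].
  - by rewrite divr_ge0.
  - by rewrite -mulr_suml sumt' divff.
  - by rewrite divfK.
pose v m y := c2 m y + th m * r2 y.
have iv m : int_eq Q (v m) (q m).
  have -> : q m = D m + th m * tau by rewrite thE /t' addrC subrK.
  by apply: int_eqD; [have [] := HD m|exact: int_eqZ].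
have sumv y : \sum_m v m y = 1.
  rewrite /v big_split/= -[X in _ + X]mulr_suml th1 mul1r.
  exact: sum_mixture_core q0 ih2 y.
pose e1 m := #|J|%:R^-1 * \sum_t ((1 - rho1 ^+ 2) + (2 * lam * B m.1
   + lam^-1 * (64 + u m t ^+ 4))).
pose e2 m := \sum_t (q m * (1 - rho2 ^+ 2) + (th m * (lam * tau + lam^-1 * 64)
   + (lam * t' m + lam^-1 * (2 / #|{: K * J}|%:R * u m t ^+ 4)))).
have pow4 (z : R) : 0 <= z ^+ 4 by rewrite -[4%N]/(2 * 2)%N exprM sqr_ge0.
exists w, v, p, e1, e2; split; split => //.
- move=> m; have [mw _ _] := iw m.
  (* The core is dominated by [h1 m / #|J|]; on the remainder, (f - rho u)^2 <= 2 f^2 + 2 u^2 is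
     traded for fourth powers by [clipped_sq_le]. *)
  pose psi x := #|J|%:R^-1 * \sum_t (h1 m x * (f t x - rho1 * u m t) ^+ 2 +
     (2 * lam * r1 m.1 x + lam^-1 * (f t x ^+ 4 + u m t ^+ 4))).
  apply: (@int_le_fun _ _ _ _ _ psi).
  + apply: measurable_funM => //; apply: measurable_sum => t.
    by apply: measurable_funX; exact: measurable_funB.
  + by move=> x; rewrite mulr_ge0// sumr_ge0// => t _; exact: sqr_ge0.
  + move=> x; rewrite /psi !mulr_sumr; apply: ler_sum => t _.
    rewrite /w mulrDl [leRHS]mulrDr lerD//.
      by rewrite [leRHS]mulrA ler_wpM2r ?sqr_ge0//; exact: c1le.
    rewrite -[leLHS]mulrA ler_wpM2l ?invr_ge0 ?(ltW Jp)//.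
    have /andP[r10 r11] := r1P m.1 x.
    have := ler_wpM2l r10 (sqrB_le (f t x) (u m t) (ltW rho11)).
    have := clipped_sq_le (f t x) (r1P m.1 x) lam0.
    have := clipped_sq_le (u m t) (r1P m.1 x) lam0.
    lra.
  + apply: int_leZ; first by rewrite invr_ge0 ltW.
    apply: int_le_sum => t; apply: int_leD; first exact: int_mehler_sq_dist.
    apply: int_leD.
      by apply: int_eq_le; apply: int_eqZ => //; rewrite mulr_ge0// ltW.
    apply: int_leZ => //; apply: int_leD; first exact: gauss_int_fourth Pf.
    exact: int_eq_le (int_eq_cst _ (pow4 _)).
- rewrite /e1 -mulr_sumr ler_pdivrMl//.
  rewrite (eq_bigr (fun m => n%:R * (1 - rho1 ^+ 2 + 64 * lam^-1) +
     (2 * lam * n%:R * B m.1 + lam^-1 * \sum_t u m t ^+ 4))); last first.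
    move=> m _; rewrite !big_split/= !sumr_cst card_ord -mulr_sumr big_split/=.
    rewrite sumr_cst card_ord; ring.
  rewrite !big_split/= sumr_cst -!mulr_sumr NE.
  rewrite [X in _ + (_ * X + _)]pairE/=.
  under eq_bigr do rewrite sumr_cst.
  rewrite -mulr_sumr.
  have H1 := ler_wpM2l lamV0 u4; rewrite NE in H1.
  have l2 : 0 <= 2 * lam * n%:R by rewrite !mulr_ge0// ltW.
  have H2 := ler_wpM2l l2 (ler_wpM2l (ltW Jp) sumB).
  lra.
- move=> m; have [mv v0 _] := iv m.
  pose psi y := \sum_t (q m * (h2 m y * (g t y - rho2 * u m t) ^+ 2) +
     (th m * (lam * r2 y + lam^-1 * g t y ^+ 4) + th m * (2 * u m t ^+ 2) * r2 y)).
  apply: (@int_le_fun _ _ _ _ _ psi).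
  + apply: measurable_funM => //; apply: measurable_sum => t.
    by apply: measurable_funX; exact: measurable_funB.
  + by move=> x; rewrite mulr_ge0// sumr_ge0// => t _; exact: sqr_ge0.
  + move=> y; rewrite /psi mulr_sumr; apply: ler_sum => t _.
    rewrite /v mulrDl lerD//.
      by rewrite mulrA ler_wpM2r ?sqr_ge0//; exact: mixture_core_le q0 ih2 m y.
    have := ler_wpM2l (r20 y) (sqrB_le (g t y) (u m t) (ltW rho21)).
    have := clipped_sq_le (g t y) (r2P y) lam0.
    move=> H1 H2.
    have H3 : r2 y * (g t y - rho2 * u m t) ^+ 2 <=
      (lam * r2 y + lam^-1 * g t y ^+ 4) + 2 * u m t ^+ 2 * r2 y by lra.
    have := ler_wpM2l (th0 m) H3; lra.
  + apply: int_le_sum => t; apply: int_leD.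
      by apply: int_leZ => //; exact: int_mehler_sq_dist.
    apply: int_leD.
      apply: int_leZ => //; apply: int_leD.
        by apply: int_eq_le; apply: int_eqZ => //; exact: ltW.
      by apply: int_leZ => //; exact: gauss_int_fourth Qg.
    (* The codeword is constant in [y], so the weight is the mass [t' m], and t' m <= q m <= 2 / N,
       with N the number of messages, lets the codeword bound [u4] be averaged. *)
    apply: (@int_le_trans _ _ _ _ _ (th m * (2 * u m t ^+ 2) * tau)).
      have -> : th m * (2 * u m t ^+ 2) * tau = 2 * (t' m * u m t ^+ 2).
        by rewrite -thE; ring.
      apply: le_trans (weighted_sq_le (u m t) (t'0 m) lam0) _.
      rewrite lerD2l ler_wpM2l// ler_wpM2r//.
      apply: le_trans (qle m).
      by rewrite /t' gerBl; have [/int_eq_ge0] := HD m.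
    by apply: int_eq_le; apply: int_eqZ => //; rewrite mulr_ge0// mulr_ge0 ?sqr_ge0.
- rewrite /e2.
  rewrite (eq_bigr (fun m => q m * (n%:R * (1 - rho2 ^+ 2)) +
     (th m * (n%:R * (lam * tau + lam^-1 * 64)) + (t' m * (n%:R * lam) +
      lam^-1 * (2 / #|{: K * J}|%:R) * \sum_t u m t ^+ 4)))); last first.
    move=> m _; rewrite !big_split/= !sumr_cst card_ord -!mulr_sumr; ring.
  rewrite !big_split/= -[X in X + _]mulr_suml -[X in _ + (X + _)]mulr_suml.
  rewrite -[X in _ + (_ + (X + _))]mulr_suml -[X in _ + (_ + (_ + X))]mulr_sumr.
  rewrite sumq th1 sumt'.
  have Np : 0 < #|{: K * J}|%:R :> R by rewrite NE mulr_gt0.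
  have H1 : lam^-1 * (2 / #|{: K * J}|%:R) * (\sum_m \sum_t u m t ^+ 4) <=
      2 * lam^-1 * (C4 * n%:R).
    apply: (@le_trans _ _ (lam^-1 * (2 / #|{: K * J}|%:R) * (C4 * n%:R * #|{: K * J}|%:R))).
      by rewrite ler_wpM2l// mulr_ge0// divr_ge0// ltW.
    rewrite le_eqVlt; apply/orP; left; apply/eqP.
    by move: Np lam0; move: (#|_|%:R) => N' Np l0; field; rewrite !gt_eqF.
  have n0' : 0 <= n%:R * lam by rewrite mulr_ge0// ltW.
  have H2 := ler_wpM2l n0' tau_le.
  have H3 : 0 <= n%:R * lam^-1 by rewrite mulr_ge0.
  lra.
Qed.

End weights.

(* Expand [0 <= \sum_i (x i / rho1 + y i / rho2 - 2 * q i * u i) ^+ 2 / q i]. *)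
Lemma corr_lower (R : realFieldType) (I : finType) (q x y u : I -> R)
    (N r1 r2 rho1 rho2 eps1 eps2 : R) :
  (forall i, 0 <= q i) -> (forall i, q i = 0 -> x i = 0 /\ y i = 0) ->
  0 < rho1 -> 0 < rho2 ->
  N - 2 * rho1 * (\sum_i u i * x i) + rho1 ^+ 2 * (\sum_i q i * u i ^+ 2) <=
    N * (1 - rho1 ^+ 2 + eps1) ->
  N - 2 * rho2 * (\sum_i u i * y i) + rho2 ^+ 2 * (\sum_i q i * u i ^+ 2) <=
    N * (1 - rho2 ^+ 2 + eps2) ->
  \sum_i x i ^+ 2 / q i <= N * r1 -> \sum_i y i ^+ 2 / q i <= N * r2 ->
  N * (rho1 * rho2 * (2 - (r1 / rho1 ^+ 2 + r2 / rho2 ^+ 2) / 2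
     - eps1 / rho1 ^+ 2 - eps2 / rho2 ^+ 2)) <= \sum_i x i * y i / q i.
Proof.
move=> q0 qxy p1 p2.
set U := \sum_i q i * _; set C1 := \sum_i u i * x i; set C2 := \sum_i u i * y i.
set XX := \sum_i x i ^+ 2 / q i; set YY := \sum_i y i ^+ 2 / q i.
set C := \sum_i x i * y i / q i.
move=> H1 H2 HX HY.
have n1 : rho1 != 0 by rewrite gt_eqF.
have n2 : rho2 != 0 by rewrite gt_eqF.
(* The square vanishes in the ideal case x = rho1 q u, y = rho2 q u. The terms in [U], [C1], [C2]
   regroup as -2 (2 C1 / rho1 - U) - 2 (2 C2 / rho2 - U), so the rescaled [H1] and [H2] suffice
   without any estimate of [U]. *)
have key : 0 <= XX / rho1 ^+ 2 + YY / rho2 ^+ 2 + 4 * U - 4 * (C1 / rho1)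
     - 4 * (C2 / rho2) + 2 * (C / (rho1 * rho2)).
  have -> : XX / rho1 ^+ 2 + YY / rho2 ^+ 2 + 4 * U - 4 * (C1 / rho1)
     - 4 * (C2 / rho2) + 2 * (C / (rho1 * rho2)) =
     \sum_i (x i ^+ 2 / q i / rho1 ^+ 2 + y i ^+ 2 / q i / rho2 ^+ 2
       + 4 * (q i * u i ^+ 2) - 4 * (u i * x i / rho1) - 4 * (u i * y i / rho2)
       + 2 * (x i * y i / q i / (rho1 * rho2))).
    by rewrite !big_split/= !sumrN -!mulr_sumr -!mulr_suml.
  apply: sumr_ge0 => i _; have [qz|qn] := eqVneq (q i) 0.
    have [-> ->] := qxy i qz; rewrite qz.
    by rewrite !(expr0n, mulr0, mul0r, addr0, subr0)/=.
  have -> : x i ^+ 2 / q i / rho1 ^+ 2 + y i ^+ 2 / q i / rho2 ^+ 2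
       + 4 * (q i * u i ^+ 2) - 4 * (u i * x i / rho1) - 4 * (u i * y i / rho2)
       + 2 * (x i * y i / q i / (rho1 * rho2)) =
      (x i / rho1 + y i / rho2 - 2 * q i * u i) ^+ 2 / q i.
    by field; rewrite qn n1 n2.
  by rewrite divr_ge0 ?sqr_ge0.
have s1 : 0 < rho1 ^+ 2 by rewrite exprn_gt0.
have s2 : 0 < rho2 ^+ 2 by rewrite exprn_gt0.
have {}H1 : N - N * (eps1 / rho1 ^+ 2) <= 2 * (C1 / rho1) - U.
  rewrite -(ler_pM2r s1).
  have -> : (N - N * (eps1 / rho1 ^+ 2)) * rho1 ^+ 2 = N * rho1 ^+ 2 - N * eps1 by field.
  have -> : (2 * (C1 / rho1) - U) * rho1 ^+ 2 = 2 * rho1 * C1 - rho1 ^+ 2 * U by field.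
  lra.
have {}H2 : N - N * (eps2 / rho2 ^+ 2) <= 2 * (C2 / rho2) - U.
  rewrite -(ler_pM2r s2).
  have -> : (N - N * (eps2 / rho2 ^+ 2)) * rho2 ^+ 2 = N * rho2 ^+ 2 - N * eps2 by field.
  have -> : (2 * (C2 / rho2) - U) * rho2 ^+ 2 = 2 * rho2 * C2 - rho2 ^+ 2 * U by field.
  lra.
have {}HX : XX / rho1 ^+ 2 <= N * (r1 / rho1 ^+ 2).
  by rewrite mulrA ler_pM2r ?invr_gt0.
have {}HY : YY / rho2 ^+ 2 <= N * (r2 / rho2 ^+ 2).
  by rewrite mulrA ler_pM2r ?invr_gt0.
have p12 : 0 < rho1 * rho2 by rewrite mulr_gt0.
have CE : C = (rho1 * rho2) * (C / (rho1 * rho2)) by rewrite mulrC divfK ?gt_eqF.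
rewrite CE mulrCA ler_pM2l//; lra.
Qed.

Lemma null_measure_Rintegral d (T : measurableType d) (R : realType) (I : finType)
    (nu : {measure set T -> \bar R}) (f : I -> T -> R) t :
  L2 nu f -> fine (nu setT) = 0 -> \int[nu]_x f t x = 0.
Proof.
move=> [nuoo mf _] nu0; rewrite /Rintegral null_set_integral//.
  exact/measurable_EFinP.
by rewrite -[LHS]fineK ?nu0// ge0_fin_numE.
Qed.

(** * Achievability *)

Section realization.
Context {R : realType} {n : nat} {J K : finType}.
Variables (muX muXh sX sXh : R) (PX Q : probability (n.-tuple R) R).
Hypotheses (sX0 : 0 < sX) (sXh0 : 0 < sXh) (n0 : (0 < n)%N).
Hypothesis K0 : (0 < #|K|)%N.
Hypothesis PXn : iid_law PX (normal_prob muX sX).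
Hypothesis Qn : iid_law Q (normal_prob muXh sXh).
Variables (w v : K * J -> n.-tuple R -> R) (p : K * J -> R).
Hypothesis iw : forall m, int_eq PX (w m) (p m).
Hypothesis w1 : forall k x, \sum_j w (k, j) x = 1.
Hypothesis iv : forall m, int_eq Q (v m) (p m / #|K|%:R).
Hypothesis v1 : forall y, \sum_m v m y = 1.

Local Notation f := (std_coord muX sX).
Local Notation g := (std_coord muXh sXh).

Let e (x : n.-tuple R) (k : K) (j : J) := w (k, j) x.
Let mv m : measurable_fun setT (v m). Proof. by have [] := iv m. Qed.
Let v0 m y : 0 <= v m y. Proof. by have [] := iv m. Qed.
Let e0 x k j : 0 <= e x k j. Proof. by have [_ + _] := iw (k, j); apply. Qed.
Let me k j : measurable_fun setT (fun x => e x k j).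
Proof. by have [] := iw (k, j). Qed.
Let e1 x k : \sum_j e x k j = 1. Proof. exact: w1. Qed.

(* [mnormalize] falls back to [Q] when the weight [v (k, j)] has integral zero. *)
Definition decoder (j : J) (k : K) : probability (n.-tuple R) R :=
  mnormalize (density_measure Q (mv (k, j)) (v0 (k, j))) Q.

Let Kp : 0 < #|K|%:R :> R. Proof. by rewrite ltr0n. Qed.

(** The mass undoes the normalization of [v m]; when it is zero both sides vanish, whatever the
    fallback law. *)
Lemma decoderE m A : measurable A ->
  ((p m / #|K|%:R)%:E * decoder m.2 m.1 A = \int[Q]_(y in A) (v m y)%:E)%E.
Proof.
case: m => k j mA /=; have [_ _ E] := iv (k, j).
have vle : (\int[Q]_(y in A) (v (k, j) y)%:E <= (p (k, j) / #|K|%:R)%:E)%E.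
  rewrite -E; apply: ge0_subset_integral => //.
    exact/measurable_EFinP.
  by move=> y _; rewrite lee_fin.
have -> : decoder j k A = (if (p (k, j) / #|K|%:R)%:E == 0 :> \bar R then Q A else
    (\int[Q]_(y in A) (v (k, j) y)%:E) * ((p (k, j) / #|K|%:R)^-1)%:E)%E.
  transitivity ((if ((\int[Q]_y (v (k, j) y)%:E == 0) || (\int[Q]_y (v (k, j) y)%:E == +oo))
    then (fun U => Q U) else (fun U => (\int[Q]_(y in U) (v (k, j) y)%:E) *
      ((fine (\int[Q]_y (v (k, j) y)%:E))^-1)%:E)) A)%E; first by [].
  by rewrite E orbF; case: ifP.
case: ifPn => [/eqP q0|q0].
  rewrite q0 mul0e; apply/eqP; rewrite eq_le -{2}q0 vle andbT.
  by apply: integral_ge0 => y _; rewrite lee_fin.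
rewrite muleCA -EFinM/= divff ?mule1//.
Qed.

Lemma realization_output : iid_law (code_output_law PX e decoder) (normal_prob muXh sXh).
Proof.
move=> B mB; rewrite -Qn//.
have mbox : measurable [set x : n.-tuple R | forall i, B i (tnth x i)].
  exact: measurable_box.
rewrite /code_output_law pair_big/=.
transitivity (\sum_(m : K * J) \int[Q]_(y in [set x | forall i, B i (tnth x i)]) (v m y)%:E)%E.
  apply: eq_bigr => -[k j] _ /=; rewrite -(decoderE (k, j) mbox)/=.
  have [_ _ E] := iw (k, j).
  by rewrite [X in (_ * X * _)%E](_ : _ = (p (k, j))%:E) // -EFinM mulrC.
rewrite -ge0_integral_sum//.
- under eq_integral do rewrite sumEFin v1.
  by rewrite integral_cst// mul1e.
- by move=> m; apply/measurable_EFinP; exact: measurable_funTS.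
- by move=> m y _; rewrite lee_fin.
Qed.

Let spart := source_part PX e0 me.
Let opart m : {measure set (n.-tuple R) -> \bar R} := output_part PX decoder e0 me m.

Lemma realization_letter_prob m : letter_prob PX e0 me m.1 m.2 = p m.
Proof. by case: m => k j; have [_ _ E] := iw (k, j); rewrite /letter_prob/= /density_measure E. Qed.

Let gX : gauss PX f. Proof. exact: iid_normal_gauss. Qed.
Let gQ : gauss Q g. Proof. exact: iid_normal_gauss. Qed.

Let spartE k A : measurable A -> PX A = (\sum_j spart k j A)%E.
Proof. exact: source_partE. Qed.

Let opartE m A : measurable A -> opart m A = (\int[Q]_(y in A) (v m y)%:E)%E.
Proof.
move=> mA; rewrite -decoderE//.
change ((letter_prob PX e0 me m.1 m.2 / #|K|%:R)%:E * decoder m.2 m.1 A =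
   (p m / #|K|%:R)%:E * decoder m.2 m.1 A)%E.
by rewrite realization_letter_prob.
Qed.

Let opart_sum A : measurable A -> Q A = (\sum_m opart m A)%E.
Proof.
move=> mA; under eq_bigr do rewrite opartE//.
rewrite -ge0_integral_sum//.
- under eq_integral do rewrite sumEFin v1.
  by rewrite integral_cst// mul1e.
- by move=> m; apply/measurable_EFinP; exact: measurable_funTS.
- by move=> m y _; rewrite lee_fin.
Qed.

Variables (u : K * J -> 'I_n -> R) (rho1 rho2 eps1 eps2 r1 r2 : R) (d1 d2 : K * J -> R).
Hypothesis id1 : forall m,
  int_le PX (fun x => w m x * \sum_t (f t x - rho1 * u m t) ^+ 2) (d1 m).
Hypothesis sd1 : \sum_m d1 m <= #|K|%:R * (n%:R * (1 - rho1 ^+ 2 + eps1)).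
Hypothesis id2 : forall m,
  int_le Q (fun y => v m y * \sum_t (g t y - rho2 * u m t) ^+ 2) (d2 m).
Hypothesis sd2 : \sum_m d2 m <= n%:R * (1 - rho2 ^+ 2 + eps2).
Hypotheses (rho10 : 0 < rho1) (rho20 : 0 < rho2).
Hypothesis Jr : #|J|%:R <= expR (n%:R * r1).
Hypothesis KJr : (#|K| * #|J|)%:R <= expR (n%:R * r2).

(** [corr_lower] over pairs of message and coordinate: the distances come from [id1] and [id2], the
    bounds on squared means from the converse applied to this very code. *)
Lemma realization_corr :
  rho1 * rho2 * (2 - ((1 - expR (- (2 * r1))) / rho1 ^+ 2 +
      (1 - expR (- (2 * r2))) / rho2 ^+ 2) / 2
     - eps1 / rho1 ^+ 2 - eps2 / rho2 ^+ 2) <=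
  code_corr muX muXh sX sXh PX decoder e0 me.
Proof.
have np : 0 < n%:R :> R by rewrite ltr0n.
have Kn0 : #|K|%:R != 0 :> R by rewrite gt_eqF.
have L2X m : L2 (spart m.1 m.2) f by exact: part_L2 gX (@spartE m.1) m.2.
have L2Y m : L2 (opart m) g by exact: part_L2 gQ opart_sum m.
pose F1 (m : K * J) t := source_mean muX sX PX e0 me m.1 m.2 t.
pose H1 (m : K * J) t := output_mean muXh sXh PX decoder e0 me m.1 m.2 t.
have pE m : fine (spart m.1 m.2 setT) = p m by exact: realization_letter_prob.
have qE m : fine (opart m setT) = p m / #|K|%:R.
  by rewrite opartE//; have [_ _ ->] := iv m.
have p0 m : 0 <= p m by exact: int_eq_ge0 (iw m).
rewrite /code_corr ler_pdivlMl//.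
have pairE (F : K * J -> 'I_n -> R) : \sum_m \sum_t F m t = \sum_(i : (K * J) * 'I_n) F i.1 i.2.
  by rewrite pair_bigA.
have M1 m : \sum_t (rho1 ^+ 2 * u m t ^+ 2 * p m - 2 * rho1 * u m t * F1 m t +
    \int[spart m.1 m.2]_x f t x ^+ 2) <= d1 m.
  rewrite -lee_fin; have [mph _] := id1 m; apply: le_trans.
  rewrite le_eqVlt; apply/orP; left; apply/eqP.
  transitivity (\int[spart m.1 m.2]_x (\sum_t (f t x - rho1 * u m t) ^+ 2)%:E)%E; last first.
    rewrite integral_density//.
    - apply: eq_integral => x _; rewrite -EFinM mulrC.
      by case: (m).
    - apply/measurable_EFinP; apply: measurable_sum => t; apply: measurable_funX.
      by apply: measurable_funB => //; have [] := gX.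
    - by move=> x; rewrite lee_fin sumr_ge0// => t _; exact: sqr_ge0.
  have := integral_quad (L2X m) (fun t => rho1 ^+ 2 * u m t ^+ 2)
    (fun t => - (2 * rho1 * u m t)) (fun=> 1).
  rewrite pE => E; transitivity ((\sum_t (rho1 ^+ 2 * u m t ^+ 2 * p m +
     - (2 * rho1 * u m t) * F1 m t + 1 * \int[spart m.1 m.2]_x f t x ^+ 2))%:E).
    by congr (_%:E); apply: eq_bigr => t _; rewrite mul1r mulNr.
  rewrite -E; apply: eq_integral => x _; congr (_%:E); apply: eq_bigr => t _; ring.
have M2 m : \sum_t (rho2 ^+ 2 * u m t ^+ 2 * (p m / #|K|%:R) - 2 * rho2 * u m t * H1 m t +
    \int[opart m]_x g t x ^+ 2) <= d2 m.
  rewrite -lee_fin; have [mph _] := id2 m; apply: le_trans.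
  rewrite le_eqVlt; apply/orP; left; apply/eqP.
  have msq : measurable_fun setT (fun y => \sum_t (g t y - rho2 * u m t) ^+ 2).
    apply: measurable_sum => t; apply: measurable_funX.
    by apply: measurable_funB => //; have [] := gQ.
  transitivity (\int[opart m]_y (\sum_t (g t y - rho2 * u m t) ^+ 2)%:E)%E; last first.
    transitivity (\int[density_measure Q (mv m) (v0 m)]_y
       (\sum_t (g t y - rho2 * u m t) ^+ 2)%:E)%E.
      by apply: eq_measure_integral => A mA _; rewrite opartE.
    rewrite integral_density//.
    - by apply: eq_integral => y _; rewrite -EFinM mulrC.
    - exact/measurable_EFinP.
    - by move=> y; rewrite lee_fin sumr_ge0// => t _; exact: sqr_ge0.
  have := integral_quad (L2Y m) (fun t => rho2 ^+ 2 * u m t ^+ 2)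
    (fun t => - (2 * rho2 * u m t)) (fun=> 1).
  rewrite qE => E; transitivity ((\sum_t (rho2 ^+ 2 * u m t ^+ 2 * (p m / #|K|%:R) +
     - (2 * rho2 * u m t) * H1 m t + 1 * \int[opart m]_x g t x ^+ 2))%:E).
    by congr (_%:E); apply: eq_bigr => t _; rewrite mul1r mulNr.
  rewrite -E; apply: eq_integral => x _; congr (_%:E); apply: eq_bigr => t _; ring.
have S1 : \sum_m \sum_t \int[spart m.1 m.2]_x f t x ^+ 2 = #|K|%:R * n%:R.
  rewrite exchange_big/= (eq_bigr (fun=> #|K|%:R)).
    by rewrite sumr_cst card_ord mulrC.
  move=> t _; rewrite -(pair_bigA _ (fun k j => \int[spart k j]_x f t x ^+ 2))/=.
  rewrite (eq_bigr (fun=> 1)); first by rewrite sumr_cst mulr1.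
  by move=> k _; exact: sum_part_sq gX (@spartE k) t.
have S2 : \sum_m \sum_t \int[opart m]_x g t x ^+ 2 = n%:R.
  rewrite exchange_big/= (eq_bigr (fun=> 1)).
    by rewrite sumr_cst card_ord mulr1.
  by move=> t _; exact: sum_part_sq gQ opart_sum t.
have T1 := le_trans (ler_sum _ (fun m _ => M1 m)) sd1.
have T2 := le_trans (ler_sum _ (fun m _ => M2 m)) sd2.
have HX := @source_mean_bound R n J K muX sX PX e sX0 e0 e1 me PXn r1 Jr.
have HY := @output_mean_bound R n J K muX muXh sX sXh PX e decoder sX0 sXh0 K0 e0 e1 me PXn realization_output r2 KJr.
(* Source parts have mass [p m], output parts [p m / #|K|]. Dividing the source means by [#|K|]
   brings both to the weight [q] and, by [divK], leaves the correlation unchanged. *)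
pose q (i : (K * J) * 'I_n) := p i.1 / #|K|%:R.
pose x (i : (K * J) * 'I_n) := F1 i.1 i.2 / #|K|%:R.
pose y (i : (K * J) * 'I_n) := H1 i.1 i.2.
pose u' (i : (K * J) * 'I_n) := u i.1 i.2.
have divK (a b c : R) : (a / #|K|%:R) * b / (c / #|K|%:R) = a * b / c.
  by rewrite invf_div; move: c^-1 => c'; field.
rewrite [leRHS](_ : _ = \sum_i x i * y i / q i); last first.
  rewrite -(pairE (fun m t => F1 m t / #|K|%:R * H1 m t / (p m / #|K|%:R))).
  apply: eq_bigr => m _; apply: eq_bigr => t _.
  by rewrite divK realization_letter_prob.
apply: (@corr_lower R _ q x y u').
- by move=> i; rewrite divr_ge0// ltW.
- move=> i /eqP; rewrite mulf_eq0 invr_eq0 (negPf Kn0) orbF => /eqP pi0.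
  rewrite /x /y /F1 /H1 /source_mean /output_mean.
  rewrite (null_measure_Rintegral i.2 (L2X i.1)) ?mul0r ?pE//; split => //.
  have := null_measure_Rintegral i.2 (L2Y i.1); rewrite qE pi0 mul0r => /(_ erefl).
  by case: (i.1).
- by [].
- by [].
- rewrite -(ler_pM2l Kp); apply: le_trans T1.
  rewrite -(pairE (fun m t => u m t * (F1 m t / #|K|%:R))).
  rewrite -(pairE (fun m t => p m / #|K|%:R * u m t ^+ 2)).
  under [leRHS]eq_bigr do rewrite big_split/=.
  rewrite big_split/= S1 addrC -addrA mulrDr lerD2l.
  rewrite !mulr_sumr -sumrN -big_split/= mulr_sumr; apply: ler_sum => m _.
  rewrite !mulr_sumr -sumrN -big_split/= mulr_sumr; apply: ler_sum => t _.
  by rewrite le_eqVlt; apply/orP; left; apply/eqP; field.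
- apply: le_trans T2.
  rewrite -(pairE (fun m t => u m t * H1 m t)).
  rewrite -(pairE (fun m t => p m / #|K|%:R * u m t ^+ 2)).
  under [leRHS]eq_bigr do rewrite big_split/=.
  rewrite big_split/= S2 -[leLHS]addrA [leRHS]addrC lerD2l.
  rewrite !mulr_sumr -sumrN -big_split/=; apply: ler_sum => m _.
  rewrite !mulr_sumr -sumrN -big_split/=; apply: ler_sum => t _.
  by rewrite le_eqVlt; apply/orP; left; apply/eqP; field.
- rewrite -(ler_pM2l Kp); apply: le_trans HX.
  rewrite -(pairE (fun m t => (F1 m t / #|K|%:R) ^+ 2 / (p m / #|K|%:R))) mulr_sumr.
  apply: ler_sum => m _; rewrite mulr_suml mulr_sumr; apply: ler_sum => t _.
  rewrite realization_letter_prob expr2 [_ * (_ / _) / _]mulrAC.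
  by rewrite le_eqVlt; apply/orP; left; apply/eqP; rewrite invf_div /F1; move: (p m)^-1 => p'; field.
- move: HY; rewrite ler_pdivlMl// => HY; apply: le_trans HY.
  rewrite -(pairE (fun m t => H1 m t ^+ 2 / (p m / #|K|%:R))) mulr_sumr.
  apply: ler_sum => m _; rewrite mulr_suml mulr_sumr; apply: ler_sum => t _.
  rewrite realization_letter_prob.
  by rewrite le_eqVlt; apply/orP; left; apply/eqP; rewrite invf_div /H1; move: (p m)^-1 => p'; ring.
Qed.

End realization.

(** Alphabet sizes are integers within a factor 2 of the exponential; hence the constants 2 for [J]
    and 4 for pairs when [mehler_covering] is applied. *)
Lemma expR_floor (R : realType) (x : R) : 0 <= x ->
  exists a : nat, [/\ (0 < a)%N, a%:R <= expR x & expR x <= 2 * a%:R].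
Proof.
move=> x0; have e1 : 1 <= expR x by rewrite -expR0 ler_expR.
exists (Num.truncn (expR x)).
have /andP[t1 t2] := truncn_itv (expR_ge0 x).
have a0 : (0 < Num.truncn (expR x))%N by rewrite truncn_gt0.
split => //; apply: le_trans (ltW t2) _.
rewrite -natr1; have : 1 <= (Num.truncn (expR x))%:R :> R by rewrite ler1n.
lra.
Qed.

(** Here rho1 rho2 = (1 - th) sqrt (a1 a2) and a_i / rho_i^2 = 1 / (1 - th). The loss is at most 2
    th + del / 2, and th <= del / 4. *)
Lemma shrunk_corr_ge (R : realType) (a1 a2 th del eps1 eps2 rho1 rho2 : R) :
  0 < a1 <= 1 -> 0 < a2 <= 1 -> 0 < th -> th <= del / 4 -> th <= 2^-1 ->
  0 < rho1 -> 0 < rho2 -> rho1 ^+ 2 = a1 * (1 - th) -> rho2 ^+ 2 = a2 * (1 - th) ->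
  eps1 <= rho1 ^+ 2 * (del / 4) -> eps2 <= rho2 ^+ 2 * (del / 4) ->
  Num.sqrt (a1 * a2) - del <= rho1 * rho2 *
    (2 - (a1 / rho1 ^+ 2 + a2 / rho2 ^+ 2) / 2 - eps1 / rho1 ^+ 2 - eps2 / rho2 ^+ 2).
Proof.
move=> /andP[a10 a11] /andP[a20 a21] th0 th4 th2 r1 r2 sq1 sq2 he1 he2.
have t1 : 0 < 1 - th by lra.
have H1 : eps1 / rho1 ^+ 2 <= del / 4 by rewrite ler_pdivrMr ?exprn_gt0// mulrC.
have H2 : eps2 / rho2 ^+ 2 <= del / 4 by rewrite ler_pdivrMr ?exprn_gt0// mulrC.
have E1 : a1 / rho1 ^+ 2 = (1 - th)^-1 by rewrite sq1; field; rewrite !gt_eqF.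
have E2 : a2 / rho2 ^+ 2 = (1 - th)^-1 by rewrite sq2; field; rewrite !gt_eqF.
have E3 : rho1 * rho2 = (1 - th) * Num.sqrt (a1 * a2).
  apply/eqP; rewrite -(@eqrXn2 _ 2)// ?mulr_ge0 ?ltW ?sqrtr_gt0 ?mulr_gt0//.
  by rewrite !exprMn sq1 sq2 sqr_sqrtr ?mulr_ge0 ?ltW//; apply/eqP; ring.
have x0 : 0 <= Num.sqrt (a1 * a2) := sqrtr_ge0 _.
have x1 : Num.sqrt (a1 * a2) <= 1 by rewrite -sqrtr1 ler_wsqrtr// mulr_ile1// ltW.
move: (Num.sqrt _) x0 x1 E3 => x x0 x1 E3.
have P0 : 0 <= rho1 * rho2 by rewrite mulr_ge0 ?ltW.
apply: (@le_trans _ _ (rho1 * rho2 * (2 - (1 - th)^-1 - del / 2))); last first.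
  by apply: ler_wpM2l => //; rewrite E1 E2; lra.
have -> : rho1 * rho2 * (2 - (1 - th)^-1 - del / 2) = x * (1 - 2 * th - (1 - th) * del / 2).
  by rewrite E3; field; rewrite gt_eqF.
have : x * (2 * th + (1 - th) * del / 2) <= 2 * th + (1 - th) * del / 2.
  by apply: ler_piMl => //; rewrite addr_ge0// ?mulr_ge0// ?ltW//; lra.
have : 0 <= th * del by rewrite mulr_ge0 ?ltW//; lra.
lra.
Qed.

(** The order matters: [lam] is taken large to kill the fourth moments, then [eta] small relative to
    [lam]. The 6 is that of [codebook_exists], and 36 = 2 * (6 + 12). *)
Lemma truncation_parameters (R : realFieldType) (C del : R) : 0 < C -> 0 < del ->
  exists lam eta : R, [/\ 0 < lam, 0 < eta,
    2 * lam * (6 * eta) + lam^-1 * C <= del &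
    2 * lam * (6 * eta + 2 * (6 * eta)) + 2 * lam^-1 * C <= del].
Proof.
move=> C0 del0.
have [lam lam0 lamE] : exists2 lam : R, 0 < lam & 2 * lam^-1 * C = del / 2.
  exists (4 * C / del); first by rewrite !mulr_gt0 ?invr_gt0.
  by field; rewrite !gt_eqF.
have [eta eta0 etaE] : exists2 eta : R, 0 < eta & 36 * lam * eta = del / 2.
  exists (del / (72 * lam)); first by rewrite divr_gt0// mulr_gt0// ltr0n.
  by field; rewrite gt_eqF.
have lC : 0 < lam^-1 * C by rewrite mulr_gt0// invr_gt0.
have le : 0 < lam * eta by rewrite mulr_gt0.
by exists lam, eta; split => //; lra.
Qed.

(** * The two inequalities for the distortion-rate function *)

Section theorem.
Context {R : realType}.
Variables (muX muXh sX sXh : R) (PX : forall n : nat, probability (n.-tuple R) R).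
Hypotheses (sX0 : 0 < sX) (sXh0 : 0 < sXh).
Hypothesis PXn : forall n, iid_law (PX n) (normal_prob muX sX).

Local Notation ach := (achievable sq_err PX (normal_prob muXh sXh)).
Let dist (c : R) := (muX - muXh) ^+ 2 + sX ^+ 2 + sXh ^+ 2 - 2 * sX * sXh * c.

Lemma achievable_ge Rt Rc D : ach Rt Rc D -> dist (xi Rt Rc) <= D.
Proof.
move=> [n [J [K [e [dec [[n0 K0 HJ HK] [[e0 e1 me] [HD out]]]]]]]].
move: HD; rewrite (code_distortionE sX0 sXh0 n0 K0 e0 e1 me (@PXn n) out) lee_fin.
apply: le_trans; rewrite /dist lerD2l lerN2 ler_wpM2l ?mulr_ge0 ?(ltW sX0) ?(ltW sXh0)//.
exact: code_corr_le.
Qed.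

Lemma output_law_exists n : exists Q : probability (n.-tuple R) R,
  iid_law Q (normal_prob muXh sXh).
Proof.
have [Q QP] := integral_prod_law_exists (normal_law muXh sXh) n.
by exists Q => B mB; exact: (integral_prod_law_box QP mB).
Qed.

Lemma ln_rate (n a : nat) (r : R) : (0 < n)%N -> (0 < a)%N ->
  a%:R <= expR (n%:R * r) -> n%:R^-1 * ln a%:R <= r.
Proof.
move=> n0 a0 H; rewrite ler_pdivrMl ?ltr0n// -[leRHS]expRK.
by rewrite ler_ln ?posrE ?expR_gt0 ?ltr0n.
Qed.

(** The general construction divides by [rho1], which must be positive with square below 1 - exp (-2
    R), impossible at rate 0. One message suffices there: its part is the whole source law, of
    standardized mean 0, so the correlation vanishes. *)
Lemma achievable_rate0 (Rc : R) : 0 <= Rc -> exists2 D, ach 0 Rc D & D <= dist 0.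
Proof.
move=> Rc0; have [Q Qn] := output_law_exists 1.
pose one (m : 'I_1 * 'I_1) (x : 1.-tuple R) : R := 1.
pose p (m : 'I_1 * 'I_1) : R := 1.
have iw m : int_eq (PX 1) (one m) (p m) by exact: int_eq_cst.
have w1 k x : \sum_(j < 1) one (k, j) x = 1 by rewrite big_ord1.
have iv m : int_eq Q (one m) (p m / #|'I_1|%:R).
  by rewrite card_ord divr1; exact: int_eq_cst.
have v1 y : \sum_m one m y = 1 by rewrite sumr_cst card_prod !card_ord mulr1.
have K0 : (0 < #|'I_1|)%N by rewrite card_ord.
have out := realization_output Qn iw iv v1.
pose e (x : 1.-tuple R) (k j : 'I_1) : R := one (k, j) x.
have e0 x k j : 0 <= e x k j by exact: ler01.
have e1 x k : \sum_(j < 1) e x k j = 1 by exact: w1.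
have me k j : measurable_fun setT (fun x => e x k j) by [].
have := code_distortionE sX0 sXh0 (ltn0Sn 0) K0 e0 e1 me (@PXn 1) out.
set c := code_corr _ _ _ _ _ _ _ _ => Ec.
have c0 : c = 0.
  rewrite /c /code_corr big1 ?mulr0// => -[k j] _; rewrite big1// => t _ /=.
  suff -> : source_mean muX sX (PX 1) e0 me k j t = 0 by rewrite !mul0r.
  have := sum_part_mean (iid_normal_gauss sX0 (@PXn 1)) (@source_partE _ _ _ _ (PX 1) e e0 e1 me k) t.
  by rewrite big_ord1 (ord1 j).
exists (dist c); last by rewrite c0.
exists 1%N, 'I_1, 'I_1, e, (decoder iv); split; split => //.
- by rewrite card_ord ln1 mulr0.
- by rewrite card_ord ln1 mulr0.
- by rewrite Ec.
Qed.

Lemma achievable_near (Rt Rc eps : R) : 0 < Rt -> 0 <= Rc -> 0 < eps ->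
  exists2 D, ach Rt Rc D & D <= dist (xi Rt Rc) + eps.
Proof.
move=> Rt0 Rc0 eps0.
pose eps' := eps / (2 * sX * sXh).
have ss0 : 0 < 2 * sX * sXh by rewrite !mulr_gt0.
have eps'0 : 0 < eps' by rewrite divr_gt0.
(* [code_corr] takes the proofs about the encoder as arguments, so its bound is requested for every
   choice of them. *)
suff [n [J [K [e [dec [[n0 J0 K0] [HJ HK] [e0 e1 me] [out corr]]]]]]] :
    exists (n : nat) (J K : finType) (e : n.-tuple R -> K -> J -> R)
      (dec : J -> K -> probability (n.-tuple R) R),
    [/\ [/\ (0 < n)%N, (0 < #|J|)%N & (0 < #|K|)%N],
      #|J|%:R <= expR (n%:R * Rt) /\ #|K|%:R <= expR (n%:R * Rc),
      [/\ (forall x k j, 0 <= e x k j), (forall x k, \sum_(j : J) e x k j = 1) &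
      (forall k j, measurable_fun [set: n.-tuple R] (fun x => e x k j))] &
      iid_law (code_output_law (PX n) e dec) (normal_prob muXh sXh) /\
      forall (e0 : forall x k j, 0 <= e x k j)
        (me : forall k j, measurable_fun [set: n.-tuple R] (fun x => e x k j)),
      xi Rt Rc - eps' <= code_corr muX muXh sX sXh (PX n) dec e0 me].
  have Ec := code_distortionE sX0 sXh0 n0 K0 e0 e1 me (@PXn n) out.
  exists (dist (code_corr muX muXh sX sXh (PX n) dec e0 me)).
    exists n, J, K, e, dec; split; split => //.
    - exact: ln_rate.
    - exact: ln_rate.
    - by rewrite Ec.
  have := corr e0 me; rewrite lerBlDr => H.
  have := ler_wpM2l (ltW ss0) H; rewrite mulrDr /eps' [X in _ <= _ + X]mulrC divfK ?gt_eqF//.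
  rewrite /dist; lra.
pose a1 : R := 1 - expR (- (2 * Rt)); pose a2 : R := 1 - expR (- (2 * (Rt + Rc))).
have a10 : 0 < a1 by rewrite subr_gt0 expR_lt1; lra.
have a20 : 0 < a2 by rewrite subr_gt0 expR_lt1; lra.
have a11 : a1 < 1 by have := expR_gt0 (- (2 * Rt)); rewrite /a1; lra.
have a21 : a2 < 1 by have := expR_gt0 (- (2 * (Rt + Rc))); rewrite /a2; lra.
(* Shrinking the squared correlations by [1 - th] puts the mutual informations strictly below the
   rates, as soft covering requires. *)
pose th : R := Num.min (eps' / 4) 2^-1.
have th0 : 0 < th by rewrite lt_min invr_gt0 ltr0n divr_gt0.
have th4 : th <= eps' / 4 by rewrite ge_min lexx.
have th2 : th <= 2^-1 by rewrite ge_min lexx orbT.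
have th1 : 0 < 1 - th by lra.
pose rho1 := Num.sqrt (a1 * (1 - th)); pose rho2 := Num.sqrt (a2 * (1 - th)).
have b1 : 0 < a1 * (1 - th) by rewrite mulr_gt0.
have b2 : 0 < a2 * (1 - th) by rewrite mulr_gt0.
have r1 : 0 < rho1 by rewrite sqrtr_gt0.
have r2 : 0 < rho2 by rewrite sqrtr_gt0.
have sq1 : rho1 ^+ 2 = a1 * (1 - th) by rewrite sqr_sqrtr// ltW.
have sq2 : rho2 ^+ 2 = a2 * (1 - th) by rewrite sqr_sqrtr// ltW.
have sq1a : rho1 ^+ 2 < a1 by rewrite sq1; nra.
have sq2a : rho2 ^+ 2 < a2 by rewrite sq2; nra.
have sq11 : rho1 ^+ 2 < 1 by exact: lt_trans a11.
have sq21 : rho2 ^+ 2 < 1 by exact: lt_trans a21.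
have ln1 : - ln (1 - rho1 ^+ 2) / 2 < Rt.
  have : - (2 * Rt) < ln (1 - rho1 ^+ 2).
    rewrite -[ltLHS]expRK ltr_ln ?posrE ?expR_gt0 ?subr_gt0//.
    by rewrite /a1 in sq1a; lra.
  lra.
have ln2 : - ln (1 - rho2 ^+ 2) / 2 < Rt + Rc.
  have : - (2 * (Rt + Rc)) < ln (1 - rho2 ^+ 2).
    rewrite -[ltLHS]expRK ltr_ln ?posrE ?expR_gt0 ?subr_gt0//.
    by rewrite /a2 in sq2a; lra.
  lra.
pose s := Num.min (rho1 ^+ 2) (rho2 ^+ 2).
have s0 : 0 < s by rewrite lt_min !exprn_gt0.
have ss1 : s <= rho1 ^+ 2 by rewrite ge_min lexx.
have ss2 : s <= rho2 ^+ 2 by rewrite ge_min lexx orbT.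
pose del := s * (eps' / 4).
have del0 : 0 < del by rewrite mulr_gt0// divr_gt0.
have C0 : 0 < 64 + 384 :> R by rewrite addr_gt0 ?ltr0n.
have [lam [eta [lam0 eta0 le1 le2]]] := truncation_parameters C0 del0.
have [n1 H1] := @mehler_covering R rho1 Rt eta 2 sq11 ln1 eta0 (ltr0Sn R 1).
have [n2 H2] := @mehler_covering R rho2 (Rt + Rc) eta 4 sq21 ln2 eta0 (ltr0Sn R 3).
pose n := (maxn n1 n2).+1.
have n0 : (0 < n)%N by [].
have n1n : (n1 <= n)%N by rewrite leqW// leq_maxl.
have n2n : (n2 <= n)%N by rewrite leqW// leq_maxr.
have nRt : 0 <= n%:R * Rt by rewrite mulr_ge0// ltW.
have nRc : 0 <= n%:R * Rc by rewrite mulr_ge0.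
have [a [A0 Aub Alb]] := expR_floor nRt.
have [b [B0 Bub Blb]] := expR_floor nRc.
have J0 : (0 < #|'I_a|)%N by rewrite card_ord.
have K0 : (0 < #|'I_b|)%N by rewrite card_ord.
have [Q Qn] := output_law_exists n.
have gX := iid_normal_gauss sX0 (@PXn n).
have gQ := iid_normal_gauss sXh0 Qn.
have [mfX _] := gX; have [mfQ _] := gQ.
(* Codewords are drawn from the source block law and standardized by [f], so [gX] serves both the
   source and the codebook. *)
have [M MP] := integral_prod_law_exists (PX n) #|{: 'I_b * 'I_a}|.
pose f := std_coord (n := n) muX sX; pose g := std_coord (n := n) muXh sXh.
pose h1 (z : n.-tuple R * n.-tuple R) := mehler rho1 (f ^~ z.1) (f ^~ z.2).
pose h2 (z : n.-tuple R * n.-tuple R) := mehler rho2 (f ^~ z.1) (g ^~ z.2).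
have mh1 : measurable_fun setT h1.
  by apply: measurable_mehler => t; apply: measurableT_comp => //; exact: mfX.
have mh2 : measurable_fun setT h2.
  apply: measurable_mehler => t; apply: measurableT_comp => //.
    exact: mfX.
  exact: mfQ.
have [U [U1 U2 U4]] := @codebook_exists _ _ _ _ R n 'I_a 'I_b (PX n) f Q M
  n0 J0 K0 gX MP h1 h2 eta mh1 mh2 eta0
  (fun k => H1 n n1n _ _ _ _ (PX n) f (PX n) f _ M _ (fun j => enum_rank (k, j)) gX gX MP
     (fun j j' E => congr1 snd (enum_rank_inj E)) ltac:(by rewrite card_ord))
  (H2 n n2n _ _ _ _ (PX n) f Q g _ M _ (fun m => enum_rank m) gX gQ MP enum_rank_inj
     ltac:(by rewrite card_prod !card_ord natrM mulrDr expRD; nra)).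
pose u (m : 'I_b * 'I_a) (t : 'I_n) : R := f t (U m).
have [w [v [p [d1 [d2 [[iw w1 iv v1] [id1 sd1 id2 sd2]]]]]]] :=
  @weights_exist _ _ _ _ R n 'I_a 'I_b (PX n) f Q g u rho1 rho2 lam (6 * eta) (6 * eta) 384
    J0 K0 gX gQ sq11 sq21 lam0 U1 U2 U4.
have Jr : #|'I_a|%:R <= expR (n%:R * Rt) by rewrite card_ord.
have KJr : (#|'I_b| * #|'I_a|)%:R <= expR (n%:R * (Rt + Rc)).
  by rewrite !card_ord natrM mulrC mulrDr expRD ler_pM.
have H := realization_corr sX0 sXh0 n0 K0 (@PXn n) Qn iw w1 iv v1 id1 sd1 id2 sd2 r1 r2 Jr KJr.
exists n, 'I_a, 'I_b, (fun x k j => w (k, j) x), (decoder iv); split.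
- by split.
- by rewrite !card_ord.
- split=> [x k j|x k|k j].
  + by have [_ + _] := iw (k, j); apply.
  + exact: w1.
  + by have [] := iw (k, j).
split; first exact (realization_output Qn iw iv v1).
move=> e0 me; apply: (le_trans _ H).
have del1 : del <= rho1 ^+ 2 * (eps' / 4) by rewrite /del ler_wpM2r// divr_ge0// ltW.
have del2 : del <= rho2 ^+ 2 * (eps' / 4) by rewrite /del ler_wpM2r// divr_ge0// ltW.
apply: (@shrunk_corr_ge _ a1 a2 th eps') => //.
- by rewrite a10 ltW.
- by rewrite a20 ltW.
- exact: le_trans del1.
- exact: le_trans del2.
Qed.

End theorem.

Theorem theorem2 (R : realType) (muX muXh sX sXh Rt Rc : R)
    (PX : forall n : nat, probability (n.-tuple R) R) :
  0 < sX -> 0 < sXh -> 0 <= Rt -> 0 <= Rc ->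
  (forall n, iid_law (PX n) (normal_prob muX sX)) ->
  oc_distortion_rate sq_err PX (normal_prob muXh sXh) Rt Rc =
    ((muX - muXh) ^+ 2 + sX ^+ 2 + sXh ^+ 2 - 2 * sX * sXh * xi Rt Rc)%:E.
Proof.
move=> sX0 sXh0 Rt0 Rc0 PXn.
apply/eqP; rewrite eq_le; apply/andP; split; last first.
  apply: le_ereal_inf_tmp => _ [D aD <-]; rewrite lee_fin.
  exact: achievable_ge aD.
apply/lee_addgt0Pr => eps eps0.
suff [D aD HD] : exists2 D, achievable sq_err PX (normal_prob muXh sXh) Rt Rc D &
    D <= (muX - muXh) ^+ 2 + sX ^+ 2 + sXh ^+ 2 - 2 * sX * sXh * xi Rt Rc + eps.
  apply: (@le_trans _ _ D%:E); last by rewrite -EFinD lee_fin.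
  by apply: ereal_inf_lbound; exists D.
have [Rt00|Rtn] := eqVneq Rt 0; last first.
  by apply: achievable_near => //; rewrite lt_neqAle eq_sym Rtn.
have [D aD HD] := @achievable_rate0 R muX muXh sX sXh PX sX0 sXh0 PXn Rc Rc0.
rewrite Rt00; exists D => //; apply: le_trans HD _.
have -> : xi 0 Rc = 0 by rewrite /xi mulr0 oppr0 expR0 subrr mul0r sqrtr0.
lra.
Qed.
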